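(* Let $n\in\mathbb{N}$ and $f\in L^\infty(\mathbb{C}^n)$. Then $\lim_{t\to0}\tilde f^{(t)}(w)=f(w)$ for almost every $w\in\mathbb{C}^n$. In particular, $$\lim_{t\to0}\|\tilde f^{(t)}\|_\infty=\lim_{t\to0}\|T_f^{(t)}\|_t=\|f\|_\infty.$$
   Context: For $t>0$ let $d\mu_t(z)=\frac{1}{(4\pi t)^n}e^{-|z|^2/(4t)}\,dv(z)$ on $\mathbb{C}^n$, where $dv$ is Lebesgue measure, let $L_t^2=L^2(\mathbb{C}^n,d\mu_t)$ with norm $\|\cdot\|_t$, let $H_t^2$ be the closed subspace of entire functions in $L_t^2$, and let $P^{(t)}:L_t^2\to H_t^2$ be the orthogonal projection. For $f\in L^\infty(\mathbb{C}^n)$ the Toeplitz operator is $T_f^{(t)}:H_t^2\to H_t^2$, $T_f^{(t)}h=P^{(t)}(fh)$, and $\|T_f^{(t)}\|_t$ is its operator norm. The heat transform is $\tilde f^{(t)}(w)=\int_{\mathbb{C}^n}f(w-z)\,d\mu_t(z)$. $\|\cdot\|_\infty$ is the (essential) supremum norm. *)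

(* Defs.v *)
From HB Require Import structures.
From mathcomp Require Import all_boot all_order all_algebra.
From mathcomp Require Import all_classical all_reals all_analysis.
From mathcomp Require Import measurable_realfun ess_sup_inf.
From mathcomp Require Export complex.

Set Implicit Arguments.
Unset Strict Implicit.
Unset Printing Implicit Defensive.

Import Order.TTheory GRing.Theory Num.Theory numFieldNormedType.Exports.

Local Open Scope classical_set_scope.
Local Open Scope ring_scope.
Local Open Scope complex_scope.

(* R[i] as a normed space over itself: `differentiable` on functions
   'rV[R[i]]_n -> R[i] is then complex (Frechet) differentiability. *)
HB.instance Definition _ (R : realType) := NormedModule.copy R[i] R[i]^o.

(* The norm of R[i] takes its values in R[i]; cabs is the real-valued modulus. *)
Definition cabs {R : realType} (z : R[i]) : R := complex.Re `|z|.

Definition sqnorm {R : realType} {n : nat} (z : 'rV[R[i]]_n) : R :=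
  \sum_(j < n) cabs (z ord0 j) ^+ 2.

(* The sigma-algebra of C, transported from the product one on R * R. *)
Section measurable_complex.
Context {R : realType}.

Definition complex_pair (z : R[i]) : measurableTypeR R * measurableTypeR R :=
  (complex.Re z, complex.Im z).

Definition pair_complex (p : measurableTypeR R * measurableTypeR R) : R[i] :=
  p.1 +i* p.2.

Definition measurable_complex : set (set R[i]) :=
  preimage_set_system setT complex_pair measurable.

Let sigmaC : sigma_algebra setT measurable_complex.
Proof. exact/sigma_algebra_preimage/sigma_algebra_measurable. Qed.

Let complex_set0 : measurable_complex set0.
Proof. by case: sigmaC. Qed.

Let complex_setC A : measurable_complex A -> measurable_complex (~` A).
Proof. by case: sigmaC => _ h _ /h; rewrite setTD. Qed.

Let complex_bigcup (F : (set R[i])^nat) :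
  (forall i, measurable_complex (F i)) -> measurable_complex (\bigcup_i F i).
Proof. by case: sigmaC => _ _; apply. Qed.

Definition complex_display : measure_display.
Proof. exact: default_measure_display. Qed.

HB.instance Definition _ := @isMeasurable.Build complex_display R[i]
  measurable_complex complex_set0 complex_setC complex_bigcup.

Lemma measurable_complex_pair : measurable_fun [set: R[i]] complex_pair.
Proof. by move=> _ Y mY; exists Y. Qed.

Lemma measurable_pair_complex : measurable_fun setT pair_complex.
Proof.
move=> _ _ [Y mY <-]; rewrite !setTI.
by rewrite (_ : _ @^-1` _ = Y)//; apply/seteqP; split => -[].
Qed.

Lemma measurable_Re : measurable_fun setT (@complex.Re R : R[i] -> _).
Proof. exact: (measurableT_comp measurable_fst measurable_complex_pair). Qed.

Lemma measurable_Im : measurable_fun setT (@complex.Im R : R[i] -> _).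
Proof. exact: (measurableT_comp measurable_snd measurable_complex_pair). Qed.

Lemma cabsE (z : R[i]) :
  cabs z = Num.sqrt (complex.Re z ^+ 2 + complex.Im z ^+ 2).
Proof. by case: z. Qed.

Lemma measurable_cabs : measurable_fun setT (@cabs R).
Proof.
rewrite (_ : @cabs R = fun z =>
  Num.sqrt (complex.Re z ^+ 2 + complex.Im z ^+ 2)); last first.
  by apply/funext => z; exact: cabsE.
apply: measurableT_comp; first exact: (continuous_measurable_fun (@sqrt_continuous R)).
apply: measurable_funD.
- by apply: measurable_funX; exact: measurable_Re.
- by apply: measurable_funX; exact: measurable_Im.
Qed.

End measurable_complex.

(* The sigma-algebra of C^n, generated by the coordinates. *)
Section measurable_rV.
Context {R : realType} {n : nat}.

Definition rV_coord (i : 'I_n) (z : 'rV[R[i]]_n) : R[i] := z ord0 i.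

Definition rV_display : measure_display.
Proof. exact: default_measure_display. Qed.

HB.instance Definition _ := @isMeasurable.Build rV_display 'rV[R[i]]_n
  (g_sigma_preimage rV_coord)
  (@sigma_algebra0 _ _ _) (@sigma_algebraC _ _)
  (@sigma_algebra_bigcup _ _ _).

Lemma measurable_rV_coord i : measurable_fun setT (rV_coord i).
Proof.
move=> _ Y mY; rewrite setTI; apply: sub_sigma_algebra => /=.
rewrite -bigcup_seq/=; exists i => /=; first by rewrite mem_index_enum.
by exists Y => //; rewrite setTI.
Qed.

Lemma measurable_fun_rVP d (T : measurableType d) (f : T -> 'rV[R[i]]_n) :
  (forall i, measurable_fun setT (rV_coord i \o f)) -> measurable_fun setT f.
Proof.
move=> mf.
have prefS : g_sigma_preimage (fun i => rV_coord i \o f) `<=` measurable.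
  apply: smallest_sub; first exact: sigma_algebra_measurable.
  rewrite -bigcup_seq; apply: bigcup_sub => i _.
  by move=> A [B mB <-]; exact: mf.
move: prefS; rewrite g_sigma_preimage_comp => prefS _ A mA.
by apply: prefS; exists A.
Qed.

Lemma measurable_sqnorm : measurable_fun setT (@sqnorm R n).
Proof.
apply: measurable_sum => j; apply: measurable_funX.
exact: (measurableT_comp measurable_cabs (measurable_rV_coord j)).
Qed.

End measurable_rV.

(* The image of a product measure under an injection f with a measurable left
   inverse g.  The proof arguments let the instances below be inferred. *)
Section product_image.
Local Open Scope ereal_scope.
Context d1 d2 d3 (T1 : measurableType d1) (T2 : measurableType d2)
  (T3 : measurableType d3) (R : realType).
Variable m1 : {sigma_finite_measure set T1 -> \bar R}.
Variable m2 : {sigma_finite_measure set T2 -> \bar R}.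
Variables (f : T1 * T2 -> T3) (g : T3 -> T1 * T2).

Definition product_image of measurable_fun setT f & measurable_fun setT g
  & cancel f g : set T3 -> \bar R := pushforward (m1 \x m2) f.

Hypotheses (mf : measurable_fun setT f) (mg : measurable_fun setT g).
Hypothesis fK : cancel f g.

Let nu := product_image mf mg fK.

Let nu0 : nu set0 = 0.
Proof. by rewrite /nu /product_image /pushforward preimage_set0 measure0. Qed.

Let nu_ge0 A : 0 <= nu A.
Proof. exact: measure_ge0. Qed.

Let nu_sigma_additive : semi_sigma_additive nu.
Proof.
exact: (@measure_semi_sigma_additive _ _ _ (pushforward (m1 \x m2) f)).
Qed.

HB.instance Definition _ := isMeasure.Build _ _ _
  (product_image mf mg fK) nu0 nu_ge0 nu_sigma_additive.

Let nu_sigma_finite : sigma_finite setT nu.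
Proof.
have /sigma_finiteP[F [TF ndF Foo]] := sigma_finiteT m1.
have /sigma_finiteP[G [TG ndG Goo]] := sigma_finiteT m2.
exists (fun k => g @^-1` (F k `*` G k)).
  rewrite -preimage_bigcup -[LHS](preimage_setT g); congr (g @^-1` _).
  rewrite -setXTT TF TG predeqE => -[x y]; split.
    move=> [/= [n _ Fnx] [k _ Gky]]; exists (maxn n k) => //; split.
    - by move: x Fnx; exact/subsetPset/ndF/leq_maxl.
    - by move: y Gky; exact/subsetPset/ndG/leq_maxr.
  by move=> [n _ []/= ? ?]; split; exists n.
move=> k; have [? ?] := Foo k; have [? ?] := Goo k; split.
  by rewrite -[X in measurable X]setTI; apply: mg => //; exact: measurableX.
rewrite /nu /product_image /pushforward -comp_preimage.
rewrite (_ : g \o f = id) ?preimage_id; last by apply/funext => x /=; rewrite fK.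
by rewrite product_measure1E// lte_mul_pinfty// ge0_fin_numE.
Qed.

HB.instance Definition _ := Measure_isSigmaFinite.Build _ _ _
  (product_image mf mg fK) nu_sigma_finite.

End product_image.

Section lebesgue_Cn.
Local Open Scope ereal_scope.
Context {R : realType}.

Lemma pair_complexK : cancel (@pair_complex R) complex_pair.
Proof. by case. Qed.

(* Area measure on C. *)
Definition lebesgue_C : {sigma_finite_measure set R[i] -> \bar R} :=
  product_image (@lebesgue_measure R) (@lebesgue_measure R)
    measurable_pair_complex measurable_complex_pair pair_complexK.

Definition rV_cons n (p : R[i] * 'rV[R[i]]_n) : 'rV[R[i]]_n.+1 :=
  row_mx (const_mx p.1 : 'rV[R[i]]_1) p.2.

Definition rV_uncons n (z : 'rV[R[i]]_n.+1) : R[i] * 'rV[R[i]]_n :=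
  (z ord0 ord0, \row_j z ord0 (lift ord0 j)).

Lemma rV_cons0 n (p : R[i] * 'rV[R[i]]_n) : rV_cons p ord0 ord0 = p.1.
Proof.
have -> : ord0 = lshift n (ord0 : 'I_1) :> 'I_n.+1 by exact/val_inj.
by rewrite /rV_cons (@row_mxEl _ 1 1 n) mxE.
Qed.

Lemma rV_consS n (p : R[i] * 'rV[R[i]]_n) j :
  rV_cons p ord0 (lift ord0 j) = p.2 ord0 j.
Proof.
have -> : lift ord0 j = rshift 1 j :> 'I_n.+1 by exact/val_inj.
by rewrite /rV_cons (@row_mxEr _ 1 1 n).
Qed.

Lemma rV_consK n : cancel (@rV_cons n) (@rV_uncons n).
Proof.
move=> p; rewrite /rV_uncons rV_cons0 [RHS]surjective_pairing; congr pair.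
by apply/rowP => j; rewrite mxE rV_consS.
Qed.

Lemma measurable_rV_cons n : measurable_fun setT (@rV_cons n).
Proof.
apply: measurable_fun_rVP => i; case: (unliftP ord0 i) => [j|] ->.
  rewrite (_ : _ \o _ = rV_coord j \o snd); last first.
    by apply/funext => p /=; rewrite /rV_coord rV_consS.
  exact: (measurableT_comp (measurable_rV_coord j) measurable_snd).
rewrite (_ : _ \o _ = fst); first exact: measurable_fst.
by apply/funext => p /=; rewrite /rV_coord rV_cons0.
Qed.

Lemma measurable_rV_uncons n : measurable_fun setT (@rV_uncons n).
Proof.
apply/measurable_fun_pairP; split; first exact: measurable_rV_coord.
apply: measurable_fun_rVP => j; rewrite (_ : _ \o _ = rV_coord (lift ord0 j)).
  exact: measurable_rV_coord.
by apply/funext => z /=; rewrite /rV_coord mxE.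
Qed.

(* Lebesgue measure on C^n = C * ... * C as an iterated product measure. *)
Fixpoint lebesgue_Cn n : {sigma_finite_measure set 'rV[R[i]]_n -> \bar R} :=
  match n with
  | 0 => \d_(0%R : 'rV[R[i]]_0)
  | m.+1 => product_image lebesgue_C (lebesgue_Cn m)
      (@measurable_rV_cons m) (@measurable_rV_uncons m) (@rV_consK m)
  end.

End lebesgue_Cn.
Arguments lebesgue_Cn {R} n.

(* The measure mu_t. Its density is cut off to 0 when t <= 0, only so that mu_t
   is a measure for every real t. *)
Section gauss_measure.
Context {R : realType} {n : nat}.
Implicit Types (t : R) (z : 'rV[R[i]]_n).

Definition gauss_density t z : R :=
  if 0 < t then ((4 * pi * t) ^+ n)^-1 * expR (- sqnorm z / (4 * t)) else 0.

Definition gauss_measure t (A : set 'rV[R[i]]_n) : \bar R :=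
  (\int[lebesgue_Cn n]_(z in A) (gauss_density t z)%:E)%E.

Lemma gauss_density_ge0 t z : 0 <= gauss_density t z.
Proof.
rewrite /gauss_density; case: ifPn => // t0.
by rewrite mulr_ge0 ?expR_ge0// invr_ge0 exprn_ge0// !mulr_ge0 ?pi_ge0// ltW.
Qed.

Lemma measurable_gauss_density t :
  measurable_fun setT (gauss_density t : 'rV[R[i]]_n -> R).
Proof.
rewrite /gauss_density; case: (0 < t) => //.
apply: measurable_funM => //; apply: measurableT_comp => //.
apply: measurable_funM => //; apply: measurable_funN.
exact: measurable_sqnorm.
Qed.

Section measure_instance.
Variable t : R.

Let gauss0 : gauss_measure t set0 = 0%E.
Proof. exact: integral_set0. Qed.

Let gauss_ge0 A : (0 <= gauss_measure t A)%E.
Proof. by apply: integral_ge0 => z _; rewrite lee_fin gauss_density_ge0. Qed.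

Let gauss_sigma_additive : semi_sigma_additive (gauss_measure t).
Proof.
move=> F mF tF mUF; rewrite /gauss_measure ge0_integral_bigcup//=.
- by apply: is_cvg_nneseries => k _ _; exact: gauss_ge0.
- apply: measurable_funTS; apply/measurable_EFinP.
  exact: measurable_gauss_density.
- by move=> z _; rewrite lee_fin gauss_density_ge0.
Qed.

HB.instance Definition _ := isMeasure.Build _ _ _
  (gauss_measure t) gauss0 gauss_ge0 gauss_sigma_additive.

End measure_instance.
End gauss_measure.

Section complex_functions.
Local Open Scope ereal_scope.
Context {R : realType} d {T : measurableType d}.
Variable mu : {measure set T -> \bar R}.

Definition cintegral (g : T -> R[i]) : R[i] :=
  ((\int[mu]_x complex.Re (g x)) +i* (\int[mu]_x complex.Im (g x)))%R.

Definition cLnorm (p : \bar R) (g : T -> R[i]) : \bar R :=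
  Lnorm mu p (fun x => (cabs (g x))%:E).

Definition cLfun (p : \bar R) (g : T -> R[i]) : Prop :=
  measurable_fun setT g /\ cLnorm p g < +oo.

End complex_functions.

Section toeplitz.
Context {R : realType} {n : nat}.
Implicit Types (t : R) (f g h k : 'rV[R[i]]_n -> R[i]).

Definition entire h : Prop := forall z, differentiable h z.

Definition L2norm t g : \bar R := cLnorm (gauss_measure t) 2%:E g.

Definition L2inner t g h : R[i] :=
  cintegral (gauss_measure t) (fun z => g z * (h z)^*).

(* H_t^2: an element is represented by its (unique) entire representative. *)
Definition H2 t : set ('rV[R[i]]_n -> R[i]) :=
  [set h | cLfun (gauss_measure t) 2%:E h /\ entire h].

(* The orthogonal projection of L_t^2 onto H_t^2: the element h of H_t^2 such
   that g - h is orthogonal to H_t^2. *)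
Definition H2proj t g : 'rV[R[i]]_n -> R[i] :=
  xget (fun=> 0) [set h | H2 t h /\
    forall k, H2 t k -> L2inner t (fun z => g z - h z) k = 0].

Definition toeplitz t f h : 'rV[R[i]]_n -> R[i] :=
  H2proj t (fun z => f z * h z).

Definition H2_opnorm t (T : ('rV[R[i]]_n -> R[i]) -> ('rV[R[i]]_n -> R[i])) :
  \bar R := ereal_sup [set L2norm t (T h) | h in
    [set h | H2 t h /\ (L2norm t h <= 1)%E]].

Definition heat_transform t f (w : 'rV[R[i]]_n) : R[i] :=
  cintegral (gauss_measure t) (fun z => f (w - z)).

End toeplitz.

(* Main.v *)
(* Hopf's maximal ergodic inequality for the heat semigroup gives a weak (1,1)
   bound for the maximal function of the heat transforms.  Hence the bounded
   functions whose heat transforms converge almost everywhere are closed under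
   bounded pointwise limits; as they include the continuous ones, they are all
   bounded measurable functions, by a monotone class argument.  The operator norm
   of T_f is squeezed between the supremum norms of the heat transform and of f:
   with k_w the normalized reproducing kernel of H_t^2, <T_f k_w, k_w> is the heat
   transform at w, and projections are contractions.  By almost everywhere
   convergence the liminf of the supremum norms of the heat transforms is at
   least that of f.  The reproducing formula is the mean value property of entire
   functions, averaged over the rotations, which preserve the Gaussian. *)
Require Import Defs.
From HB Require Import structures.
From mathcomp Require Import all_boot all_order all_algebra.
From mathcomp Require Import all_classical all_reals all_analysis.
From mathcomp Require Import measurable_realfun ess_sup_inf complex ring lra.

Set Implicit Arguments.
Unset Strict Implicit.
Unset Printing Implicit Defensive.

Import Order.TTheory GRing.Theory Num.Theory numFieldNormedType.Exports.

Local Open Scope classical_set_scope.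
Local Open Scope ring_scope.
Local Open Scope complex_scope.

(** * Complex-valued functions *)

(** The weak (1,1) bound needs integrable data, while the error of a bounded approximation of [f] is
    only bounded. That error is therefore multiplied by the Gaussian density at time 1, after which
    its integral tends to 0 by dominated convergence. Since this weight is continuous, it commutes
    with the heat transform up to a term that vanishes as [t] tends to 0. The lower bound on the
    operator norm needs the projection of [f * k_w] to exist, because [H2proj] is a choice with
    default 0. Existence comes from integrating against the reproducing kernel, and most Gaussian
    estimates on the Fock space serve to show that this integral is entire and square integrable.
    Entire functions are only assumed to be complex differentiable at each point, so the mean value
    property rests on Goursat's bisection, applied to [F \o cexp] on rectangles whose vertical sides
    are mapped to circles. *)

Section complex_modulus.
Context {R : realType}.
Implicit Types (z w : R[i]) (x : R).

Lemma Re_add z w : complex.Re (z + w) = complex.Re z + complex.Re w.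
Proof. by case: z; case: w. Qed.

Lemma Im_add z w : complex.Im (z + w) = complex.Im z + complex.Im w.
Proof. by case: z; case: w. Qed.

Lemma Re_opp z : complex.Re (- z) = - complex.Re z.
Proof. by case: z. Qed.

Lemma Im_opp z : complex.Im (- z) = - complex.Im z.
Proof. by case: z. Qed.

Lemma Re_mul z w :
  complex.Re (z * w) = complex.Re z * complex.Re w - complex.Im z * complex.Im w.
Proof. by case: z; case: w. Qed.

Lemma Im_mul z w :
  complex.Im (z * w) = complex.Re z * complex.Im w + complex.Im z * complex.Re w.
Proof. by case: z; case: w. Qed.

Lemma Re_conjc z : complex.Re (z^*) = complex.Re z.
Proof. by case: z. Qed.

Lemma Im_conjc z : complex.Im (z^*) = - complex.Im z.
Proof. by case: z. Qed.

Lemma Re_sum I (s : seq I) (P : pred I) (F : I -> R[i]) :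
  complex.Re (\sum_(i <- s | P i) F i) = \sum_(i <- s | P i) complex.Re (F i).
Proof. by elim/big_rec2: _ => // i x y _ <-; rewrite Re_add. Qed.

Lemma Im_sum I (s : seq I) (P : pred I) (F : I -> R[i]) :
  complex.Im (\sum_(i <- s | P i) F i) = \sum_(i <- s | P i) complex.Im (F i).
Proof. by elim/big_rec2: _ => // i x y _ <-; rewrite Im_add. Qed.

Definition ReImE := (Re_add, Im_add, Re_opp, Im_opp, Re_mul, Im_mul, Re_conjc, Im_conjc).

Lemma complex_ext z w :
  complex.Re z = complex.Re w -> complex.Im z = complex.Im w -> z = w.
Proof. by case: z => a b; case: w => c d /= -> ->. Qed.

Lemma norm_cabs z : `|z| = (cabs z)%:C.
Proof. by rewrite cabsE normc_def. Qed.

Lemma cabs_ge0 z : 0 <= cabs z.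
Proof. by rewrite cabsE sqrtr_ge0. Qed.

Lemma cabs_sqr z : cabs z ^+ 2 = complex.Re z ^+ 2 + complex.Im z ^+ 2.
Proof. by rewrite cabsE sqr_sqrtr// addr_ge0// sqr_ge0. Qed.

Lemma cabsM z w : cabs (z * w) = cabs z * cabs w.
Proof. by apply: complexI; rewrite -norm_cabs normrM !norm_cabs rmorphM. Qed.

Lemma cabs_add z w : cabs (z + w) <= cabs z + cabs w.
Proof. by rewrite -lecR rmorphD /= -!norm_cabs ler_normD. Qed.

Lemma cabsN z : cabs (- z) = cabs z.
Proof. by rewrite !cabsE !ReImE !sqrrN. Qed.

Lemma cabsB z w : cabs (z - w) = cabs (w - z).
Proof. by rewrite -cabsN opprB. Qed.

Lemma cabs_conj z : cabs (z^*) = cabs z.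
Proof. by rewrite !cabsE !ReImE sqrrN. Qed.

Lemma cabs_real x : cabs x%:C = `|x|.
Proof. by rewrite cabsE /= expr0n addr0 sqrtr_sqr. Qed.

Lemma cabs0 : cabs (0 : R[i]) = 0.
Proof. by rewrite cabs_real normr0. Qed.

Lemma cabs_eq0 z : (cabs z == 0) = (z == 0).
Proof.
apply/eqP/eqP => [h|->]; last exact: cabs0.
by apply/normr0_eq0; rewrite norm_cabs h.
Qed.

Lemma cabs_sum I (s : seq I) (P : pred I) (F : I -> R[i]) :
  cabs (\sum_(i <- s | P i) F i) <= \sum_(i <- s | P i) cabs (F i).
Proof.
elim/big_rec2: _ => [|i x y _ h]; first by rewrite cabs0.
by rewrite (le_trans (cabs_add _ _))// lerD2l.
Qed.

Lemma Re_le_cabs z : `|complex.Re z| <= cabs z.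
Proof. by rewrite cabsE -sqrtr_sqr ler_wsqrtr// lerDl sqr_ge0. Qed.

Lemma Im_le_cabs z : `|complex.Im z| <= cabs z.
Proof. by rewrite cabsE -sqrtr_sqr ler_wsqrtr// lerDr sqr_ge0. Qed.

Lemma cabs_le_ReIm z : cabs z <= `|complex.Re z| + `|complex.Im z|.
Proof.
rewrite cabsE -[leRHS]ger0_norm ?addr_ge0// -sqrtr_sqr ler_wsqrtr//.
rewrite sqrrD !real_normK ?num_real// lerD2r lerDl.
by rewrite mulrn_wge0// mulr_ge0.
Qed.

Lemma mul_conj z : z * z^* = (cabs z ^+ 2)%:C.
Proof.
by apply: complex_ext; rewrite !ReImE /= ?cabs_sqr; ring.
Qed.

End complex_modulus.

Section measurable_complex_valued.
Context {R : realType} d (T : measurableType d).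
Implicit Types f g : T -> R[i].

Lemma measurable_complexP f : measurable_fun setT f <->
  measurable_fun setT (@complex.Re R \o f) /\ measurable_fun setT (@complex.Im R \o f).
Proof.
split=> [mf|[mRe mIm]].
  split; first exact: measurableT_comp measurable_Re mf.
  exact: measurableT_comp measurable_Im mf.
rewrite (_ : f = pair_complex \o (fun x => (complex.Re (f x), complex.Im (f x)))).
  apply: measurableT_comp; first exact: measurable_pair_complex.
  exact/measurable_fun_pairP.
by apply/funext => x /=; case: (f x).
Qed.

Lemma measurable_Re_comp f :
  measurable_fun setT f -> measurable_fun setT (fun x => complex.Re (f x)).
Proof. by move=> /measurable_complexP[]. Qed.

Lemma measurable_Im_comp f :
  measurable_fun setT f -> measurable_fun setT (fun x => complex.Im (f x)).
Proof. by move=> /measurable_complexP[]. Qed.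

Lemma measurable_cabs_comp f :
  measurable_fun setT f -> measurable_fun setT (fun x => cabs (f x)).
Proof. exact: measurableT_comp measurable_cabs. Qed.

Lemma measurable_complexD f g : measurable_fun setT f -> measurable_fun setT g ->
  measurable_fun setT (fun x => f x + g x).
Proof.
move=> /measurable_complexP[f1 f2] /measurable_complexP[g1 g2].
apply/measurable_complexP; split.
  rewrite (_ : _ \o _ = fun x => complex.Re (f x) + complex.Re (g x)).
    exact: measurable_funD.
  by apply/funext => x /=; rewrite Re_add.
rewrite (_ : _ \o _ = fun x => complex.Im (f x) + complex.Im (g x)).
  exact: measurable_funD.
by apply/funext => x /=; rewrite Im_add.
Qed.

Lemma measurable_complexN f : measurable_fun setT f ->
  measurable_fun setT (fun x => - f x).
Proof.
move=> /measurable_complexP[f1 f2]; apply/measurable_complexP; split.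
  rewrite (_ : _ \o _ = fun x => - complex.Re (f x)); first exact: measurable_funN.
  by apply/funext => x /=; rewrite Re_opp.
rewrite (_ : _ \o _ = fun x => - complex.Im (f x)); first exact: measurable_funN.
by apply/funext => x /=; rewrite Im_opp.
Qed.

Lemma measurable_complexB f g : measurable_fun setT f -> measurable_fun setT g ->
  measurable_fun setT (fun x => f x - g x).
Proof. by move=> mf mg; apply: measurable_complexD => //; exact: measurable_complexN. Qed.

Lemma measurable_complexM f g : measurable_fun setT f -> measurable_fun setT g ->
  measurable_fun setT (fun x => f x * g x).
Proof.
move=> /measurable_complexP[f1 f2] /measurable_complexP[g1 g2].
apply/measurable_complexP; split.
  rewrite (_ : _ \o _ = fun x => complex.Re (f x) * complex.Re (g x)
    - complex.Im (f x) * complex.Im (g x)).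
    by apply: measurable_funB; exact: measurable_funM.
  by apply/funext => x /=; rewrite Re_mul.
rewrite (_ : _ \o _ = fun x => complex.Re (f x) * complex.Im (g x)
  + complex.Im (f x) * complex.Re (g x)).
  by apply: measurable_funD; exact: measurable_funM.
by apply/funext => x /=; rewrite Im_mul.
Qed.

Lemma measurable_conj f : measurable_fun setT f ->
  measurable_fun setT (fun x => (f x)^*).
Proof.
move=> /measurable_complexP[f1 f2]; apply/measurable_complexP; split.
  rewrite (_ : _ \o _ = fun x => complex.Re (f x))//.
  by apply/funext => x /=; rewrite Re_conjc.
rewrite (_ : _ \o _ = fun x => - complex.Im (f x)); first exact: measurable_funN.
by apply/funext => x /=; rewrite Im_conjc.
Qed.

Lemma measurable_real_complex (f : T -> R) : measurable_fun setT f ->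
  measurable_fun setT (fun x => (f x)%:C).
Proof. by move=> mf; apply/measurable_complexP; split => //=; exact: measurable_cst. Qed.

Lemma measurable_complex_sum I (s : seq I) (F : I -> T -> R[i]) :
  (forall i, measurable_fun setT (F i)) ->
  measurable_fun setT (fun x => \sum_(i <- s) F i x).
Proof.
move=> mF; elim: s => [|i s ih].
  rewrite (_ : (fun _ => _) = cst 0); first exact: measurable_cst.
  by apply/funext => x; rewrite big_nil.
rewrite (_ : (fun _ => _) = fun x => F i x + \sum_(j <- s) F j x).
  exact: measurable_complexD.
by apply/funext => x; rewrite big_cons.
Qed.

End measurable_complex_valued.

Section measurable_rV_valued.
Context {R : realType} {n : nat} d (T : measurableType d).
Implicit Types f g : T -> 'rV[R[i]]_n.

Lemma measurable_coord_comp f j : measurable_fun setT f ->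
  measurable_fun setT (fun x => f x ord0 j).
Proof. exact: measurableT_comp (measurable_rV_coord j). Qed.

Lemma measurable_rVD f g : measurable_fun setT f -> measurable_fun setT g ->
  measurable_fun setT (fun x => f x + g x).
Proof.
move=> mf mg; apply: measurable_fun_rVP => j.
rewrite (_ : _ \o _ = fun x => f x ord0 j + g x ord0 j).
  by apply: measurable_complexD; exact: measurable_coord_comp.
by apply/funext => x /=; rewrite /rV_coord mxE.
Qed.

Lemma measurable_rVZ (c : T -> R[i]) g : measurable_fun setT c ->
  measurable_fun setT g -> measurable_fun setT (fun x => c x *: g x).
Proof.
move=> mf mg; apply: measurable_fun_rVP => j.
rewrite (_ : _ \o _ = fun x => c x * g x ord0 j).
  by apply: measurable_complexM => //; exact: measurable_coord_comp.
by apply/funext => x /=; rewrite /rV_coord mxE.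
Qed.

Lemma measurable_rVB f g : measurable_fun setT f -> measurable_fun setT g ->
  measurable_fun setT (fun x => f x - g x).
Proof.
move=> mf mg; rewrite (_ : (fun _ => _) = fun x => f x + (-1) *: g x); last first.
  by apply/funext => x; rewrite scaleN1r.
by apply: measurable_rVD => //; apply: measurable_rVZ => //; exact: measurable_cst.
Qed.

End measurable_rV_valued.

(** * Invariance of the Lebesgue measure of C^n *)

Section invariance.
Local Open Scope ereal_scope.

(** Invariance is phrased with integrals of nonnegative functions, not with measures of sets, so
    that it composes and can be used inside the iterated integrals given by Tonelli's theorem. *)
Definition preserves_integral d (T : measurableType d) (R : realType)
    (mu : set T -> \bar R) (phi : T -> T) :=
  measurable_fun setT phi /\
  forall F : T -> \bar R, measurable_fun setT F -> (forall x, 0 <= F x) ->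
    \int[mu]_x F (phi x) = \int[mu]_x F x.

Lemma preserves_integral_comp d (T : measurableType d) (R : realType)
    (mu : set T -> \bar R) (phi psi : T -> T) :
  preserves_integral mu phi -> preserves_integral mu psi ->
  preserves_integral mu (phi \o psi).
Proof.
move=> [mphi phiE] [mpsi psiE]; split; first exact: measurableT_comp.
move=> F mF F0; rewrite -[RHS]phiE// -[RHS]psiE//.
exact: measurableT_comp.
Qed.

Context {R : realType}.

(** The translated measure gives half-open intervals their length, which characterizes Lebesgue
    measure. *)
Lemma lebesgue_translation (a : R) :
  preserves_integral (@lebesgue_measure R) (fun x => x + a)%R.
Proof.
have ma : measurable_fun setT
    ((fun x => x + a)%R : measurableTypeR R -> measurableTypeR R).
  by apply: measurable_funD => //; exact: measurable_cst.
split=> // F mF F0.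
rewrite -(@ge0_integral_pushforward _ _ _ _ _ _ ma lebesgue_measure setT F)//.
apply: eq_measure_integral => //= A mA _.
apply/esym/lebesgue_measure_unique => //= _ [[b c]] _ <-.
rewrite /pushforward (_ : _ @^-1` _ = `]b - a, c - a]%classic)%R; last first.
  by apply/seteqP; split => x /=; rewrite !in_itv/= ltrBlDr lerBrDr.
rewrite !lebesgue_measure_itv/= !lte_fin ltrD2r.
by case: ifP => // _; rewrite -!EFinB opprD addrACA opprK addNr addr0.
Qed.

Lemma integral_product_image d1 d2 d3 (T1 : measurableType d1)
    (T2 : measurableType d2) (T3 : measurableType d3)
    (m1 : {sigma_finite_measure set T1 -> \bar R})
    (m2 : {sigma_finite_measure set T2 -> \bar R})
    (f : T1 * T2 -> T3) (g : T3 -> T1 * T2)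
    (mf : measurable_fun setT f) (mg : measurable_fun setT g)
    (fK : cancel f g) (F : T3 -> \bar R) :
  measurable_fun setT F -> (forall x, 0 <= F x) ->
  \int[product_image m1 m2 mf mg fK]_z F z =
    \int[m1]_x \int[m2]_y F (f (x, y)).
Proof.
move=> mF F0.
have := @ge0_integral_pushforward _ _ _ _ _ _ mf (m1 \x m2) setT F measurableT mF.
rewrite preimage_setT => -> //.
rewrite (fubini_tonelli1 (F \o f))//=.
exact: (measurableT_comp mF mf).
Qed.

Lemma integral_lebesgue_C (F : R[i] -> \bar R) :
  measurable_fun setT F -> (forall x, 0 <= F x) ->
  \int[lebesgue_C]_z F z =
  \int[@lebesgue_measure R]_x \int[@lebesgue_measure R]_y F (x +i* y)%C.
Proof. exact: integral_product_image. Qed.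

Lemma integral_lebesgue_CnS n (F : 'rV[R[i]]_n.+1 -> \bar R) :
  measurable_fun setT F -> (forall x, 0 <= F x) ->
  \int[lebesgue_Cn n.+1]_z F z =
  \int[lebesgue_C]_x \int[lebesgue_Cn n]_v F (rV_cons (x, v)).
Proof. exact: integral_product_image. Qed.

Lemma measurable_complex2 (F : R[i] -> \bar R) : measurable_fun setT F ->
  measurable_fun setT
    (fun p : measurableTypeR R * measurableTypeR R => F (p.1 +i* p.2)%C).
Proof. by move=> mF; apply: measurableT_comp mF measurable_pair_complex. Qed.

Lemma lebesgue_C_translation (a : R[i]) :
  preserves_integral lebesgue_C (fun z => z + a)%R.
Proof.
have ma : measurable_fun setT (fun z : R[i] => z + a)%R.
  by apply: measurable_complexD => //; exact: measurable_cst.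
split => // F mF F0.
rewrite !integral_lebesgue_C//; last exact: measurableT_comp.
rewrite -(proj2 (lebesgue_translation (complex.Re a))
  (fun x => \int[_]_y F (x +i* y)%C)); last 2 first.
- exact: (measurable_fun_fubini_tonelli_F _ (measurable_complex2 mF)).
- by move=> x; exact: integral_ge0.
apply: eq_integral => x _.
rewrite -(proj2 (lebesgue_translation (complex.Im a))
  (fun y => F ((x + complex.Re a)%R +i* y)%C))//; last first.
  exact: (measurableT_comp (measurable_complex2 mF) (measurable_pair1 _)).
by apply: eq_integral => y _; case: a {ma}.
Qed.

(** On each horizontal line the shear is a translation, so Tonelli's theorem is used to integrate
    along these lines first. *)
Lemma lebesgue_C_shear1 (s : R) : preserves_integral lebesgue_C
  (fun z => (complex.Re z + s * complex.Im z) +i* complex.Im z)%R.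
Proof.
have ms : measurable_fun setT
    (fun z : R[i] => ((complex.Re z + s * complex.Im z) +i* complex.Im z)%R).
  apply/measurable_complexP; split; last exact: measurable_Im.
  apply: measurable_funD; first exact: measurable_Re.
  by apply: measurable_funM; [exact: measurable_cst|exact: measurable_Im].
split => // F mF F0.
rewrite !integral_lebesgue_C//=; last exact: measurableT_comp.
have mF2 := measurable_complex2 (measurableT_comp mF ms).
rewrite (fubini_tonelli _ mF2)//=.
rewrite (fubini_tonelli _ (measurable_complex2 mF))//=.
apply: eq_integral => y _.
rewrite -(proj2 (lebesgue_translation (s * y)) (fun x => F (x +i* y)%C))//.
exact: (measurableT_comp (measurable_complex2 mF) (measurable_pair2 _)).
Qed.

Lemma lebesgue_C_shear2 (s : R) : preserves_integral lebesgue_C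
  (fun z => complex.Re z +i* (complex.Im z + s * complex.Re z))%R.
Proof.
have ms : measurable_fun setT
    (fun z : R[i] => (complex.Re z +i* (complex.Im z + s * complex.Re z))%R).
  apply/measurable_complexP; split; first exact: measurable_Re.
  apply: measurable_funD; first exact: measurable_Im.
  by apply: measurable_funM; [exact: measurable_cst|exact: measurable_Re].
split => // F mF F0.
rewrite !integral_lebesgue_C//=; last exact: measurableT_comp.
apply: eq_integral => x _.
rewrite -(proj2 (lebesgue_translation (s * x)) (fun y => F (x +i* y)%C))//.
exact: (measurableT_comp (measurable_complex2 mF) (measurable_pair1 _)).
Qed.

(* A rotation that is not a half-turn is a product of three shears; a half-turn
   is the square of a quarter-turn. *)
Lemma lebesgue_C_rotation (c : R[i]) : cabs c = 1%R ->
  preserves_integral lebesgue_C (fun z => c * z)%R.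
Proof.
have main (d : R[i]) : cabs d = 1%R -> complex.Re d != (-1)%R ->
    preserves_integral lebesgue_C (fun z => d * z)%R.
  move=> d1 dN1; have d2 := cabs_sqr d; rewrite d1 expr1n in d2.
  have q0 : (1 + complex.Re d != 0)%R by rewrite addrC addr_eq0.
  (* For the rotation by an angle [a] this is [- tan (a / 2)], the factor of the horizontal shears;
     the vertical one has factor [sin a]. Excluding the half-turn keeps the denominator nonzero. *)
  pose s := (- complex.Im d / (1 + complex.Re d))%R.
  rewrite (_ : (fun z => d * z)%R =
    (fun z => (complex.Re z + s * complex.Im z) +i* complex.Im z)%R \o
    ((fun z => complex.Re z +i* (complex.Im z + complex.Im d * complex.Re z))%R \o
    (fun z => (complex.Re z + s * complex.Im z) +i* complex.Im z)%R)).
    apply: preserves_integral_comp; first exact: lebesgue_C_shear1.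
    by apply: preserves_integral_comp;
      [exact: lebesgue_C_shear2|exact: lebesgue_C_shear1].
  have e : (complex.Im d ^+ 2 = (1 - complex.Re d) * (1 + complex.Re d))%R.
    by rewrite -subr_sqr expr1n d2 addrAC subrr add0r.
  have e2 : (complex.Re d = 1 + s * complex.Im d)%R.
    by rewrite /s !mulNr mulrAC -expr2 e mulfK//; ring.
  have e3 : (complex.Im d = - (s * (2 + s * complex.Im d)))%R.
    rewrite (_ : (2 + s * complex.Im d = 1 + complex.Re d)%R); last first.
      by rewrite e2; ring.
    by rewrite /s divfK// opprK.
  apply/funext => z; apply: complex_ext; rewrite ?ReImE/=.
    have -> : (complex.Re d * complex.Re z = (1 + s * complex.Im d) * complex.Re z)%R.
      by rewrite -e2.
    have -> : (complex.Im d * complex.Im z =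
        - (s * (2 + s * complex.Im d)) * complex.Im z)%R by rewrite -e3.
    by ring.
  by rewrite e2; ring.
move=> c1; have [cN1|] := eqVneq (complex.Re c) (-1)%R; last exact: main.
have c2 := cabs_sqr c; rewrite c1 expr1n cN1 sqrrN expr1n in c2.
have -> : c = (('i : R[i]) * 'i)%R.
  apply: complex_ext; rewrite ?ReImE/= ?cN1 ?mulr0 ?mul0r ?addr0 ?mulr1 ?sub0r//.
  by apply/eqP; rewrite -sqrf_eq0; apply/eqP; lra.
rewrite (_ : (fun z => _) = (fun z => 'i * z)%R \o (fun z => 'i * z)%R); last first.
  by apply/funext => z /=; rewrite mulrA.
have i1 : preserves_integral lebesgue_C (fun z : R[i] => 'i * z)%R.
  apply: main; last by rewrite /= eq_sym oppr_eq0 oner_eq0.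
  by rewrite cabsE /= expr0n expr1n add0r sqrtr1.
exact: preserves_integral_comp.
Qed.

(** Induction on the dimension: Tonelli's theorem separates the first coordinate from the others, to
    which the induction hypothesis applies. *)
Lemma lebesgue_Cn_coordwise n (phi : 'I_n -> R[i] -> R[i]) :
  (forall j, preserves_integral lebesgue_C (phi j)) ->
  preserves_integral (lebesgue_Cn n) (fun z => \row_j phi j (z ord0 j)).
Proof.
elim: n phi => [phi _|n ih phi phiP].
  have -> : (fun z : 'rV[R[i]]_0 => \row_j phi j (z ord0 j)) = id.
    by apply/funext => z; apply/rowP => -[].
  by split; [exact: measurable_id|].
have mP m (psi : 'I_m -> R[i] -> R[i]) :
    (forall j, preserves_integral lebesgue_C (psi j)) ->
    measurable_fun setT (fun z : 'rV[R[i]]_m => \row_j psi j (z ord0 j)).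
  move=> psiP; apply: measurable_fun_rVP => j.
  rewrite (_ : _ \o _ = psi j \o rV_coord j); last first.
    by apply/funext => z /=; rewrite /rV_coord mxE.
  by apply: measurableT_comp (measurable_rV_coord j); case: (psiP j).
split; first exact: mP.
move=> F mF F0; rewrite !integral_lebesgue_CnS//; last first.
  exact: measurableT_comp mF (mP _ _ phiP).
have mF2 : measurable_fun setT (F \o @rV_cons R n).
  exact: measurableT_comp mF (@measurable_rV_cons R n).
rewrite -[RHS](proj2 (phiP ord0)
  (fun x => \int[lebesgue_Cn n]_v F (rV_cons (x, v)))); last 2 first.
- exact: (measurable_fun_fubini_tonelli_F _ mF2 (fun p => F0 (rV_cons p))).
- by move=> x; exact: integral_ge0.
apply: eq_integral => x _.
rewrite -[RHS](proj2 (ih (fun j => phi (lift ord0 j)) _)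
  (fun v => F (rV_cons (phi ord0 x, v))))//; last first.
  exact: (measurableT_comp mF2 (measurable_pair1 _)).
apply: eq_integral => v _; congr F; apply/rowP => j; rewrite mxE.
case: (unliftP ord0 j) => [k|] ->; first by rewrite !rV_consS mxE.
by rewrite !rV_cons0.
Qed.

Lemma lebesgue_Cn_translation n (a : 'rV[R[i]]_n) :
  preserves_integral (lebesgue_Cn n) (fun z => z + a)%R.
Proof.
rewrite (_ : (fun _ => _) = fun z : 'rV[R[i]]_n => \row_j (z ord0 j + a ord0 j)%R).
  apply: (@lebesgue_Cn_coordwise n (fun j x => x + a ord0 j)%R) => j.
  exact: lebesgue_C_translation.
by apply/funext => z; apply/rowP => j; rewrite !mxE.
Qed.

Lemma lebesgue_Cn_rotation n (c : R[i]) : cabs c = 1%R ->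
  preserves_integral (lebesgue_Cn n) (fun z => c *: z)%R.
Proof.
move=> c1; rewrite (_ : (fun _ => _) = fun z : 'rV[R[i]]_n => \row_j (c * z ord0 j)%R).
  apply: (@lebesgue_Cn_coordwise n (fun=> *%R c)) => j.
  exact: lebesgue_C_rotation.
by apply/funext => z; apply/rowP => j; rewrite !mxE.
Qed.

Lemma lebesgue_Cn_reflection n (w : 'rV[R[i]]_n) :
  preserves_integral (lebesgue_Cn n) (fun z => w - z)%R.
Proof.
rewrite (_ : (fun z => w - z)%R =
  (fun z => z + w)%R \o (fun z : 'rV[R[i]]_n => (-1 : R[i]) *: z)%R); last first.
  by apply/funext => z /=; rewrite scaleN1r addrC.
apply: preserves_integral_comp; first exact: lebesgue_Cn_translation.
by apply: lebesgue_Cn_rotation; rewrite cabsN cabs_real normr1.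
Qed.

End invariance.

(** * Gaussian densities *)

Section integral_density.
Local Open Scope ereal_scope.
Context d (T : measurableType d) (R : realType).
Variables (mu nu : {measure set T -> \bar R}) (p : T -> R).
Hypotheses (mp : measurable_fun setT p) (p0 : forall x, (0 <= p x)%R).
Hypothesis nuE : forall A, measurable A -> nu A = \int[mu]_(x in A) (p x)%:E.

Import HBNNSimple.

Let density_indic E : measurable E ->
  \int[nu]_x (\1_E x)%:E = \int[mu]_x ((\1_E x)%:E * (p x)%:E).
Proof.
move=> mE; rewrite integral_indic// setIT nuE// integral_mkcond/=.
apply: eq_integral => x _; rewrite patchE indicE.
by case: ifPn; rewrite ?mul1e ?mul0e.
Qed.

Let density_nnsfun (f : {nnsfun T >-> R}) :
  \int[nu]_x (f x)%:E = \int[mu]_x ((f x)%:E * (p x)%:E).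
Proof.
under [LHS]eq_integral do rewrite fimfunE -fsumEFin//.
rewrite [LHS]ge0_integral_fsum//; last 2 first.
  - by move=> r; exact/measurable_EFinP/measurableT_comp.
  - by move=> n x _; rewrite EFinM nnfun_muleindic_ge0.
under [RHS]eq_integral.
  move=> x xD; rewrite fimfunE -fsumEFin// ge0_mule_fsuml; last first.
    by move=> r; rewrite EFinM nnfun_muleindic_ge0.
  over.
rewrite [RHS]ge0_integral_fsum//; last 2 first.
  - move=> r; under eq_fun do rewrite -EFinM.
    apply/measurable_EFinP; apply: measurable_funM => //.
    by apply: measurable_funM => //; exact: measurable_indic.
  - move=> n x _; apply: mule_ge0; last by rewrite lee_fin.
    by rewrite EFinM nnfun_muleindic_ge0.
apply: eq_fsbigr => r _; rewrite integralZl_indic_nnsfun// density_indic//.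
(* A negative [r] is no value of [f], so its preimage is empty and both sides vanish. *)
have [r0|r0] := leP 0%R r.
  rewrite -ge0_integralZl//.
  - by apply: eq_integral => x _; rewrite EFinM muleA.
  - under eq_fun do rewrite -EFinM; apply/measurable_EFinP.
    by apply: measurable_funM => //; exact: measurable_indic.
  - by move=> x _; rewrite mule_ge0 ?lee_fin.
rewrite preimage_nnfun0//; under eq_integral do rewrite indicE in_set0 mul0e.
rewrite integral0 mule0; under eq_integral do rewrite indicE in_set0 mulr0 mul0e.
by rewrite integral0.
Qed.

Lemma ge0_integral_density (f : T -> \bar R) :
  measurable_fun setT f -> (forall x, 0 <= f x) ->
  \int[nu]_x f x = \int[mu]_x (f x * (p x)%:E).
Proof.
move=> mf f0; pose f_ := nnsfun_approx measurableT mf.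
transitivity (lim (\int[nu]_x (f_ n x)%:E @[n --> \oo])).
  rewrite -monotone_convergence//=.
  - apply: eq_integral => ? /[!inE] xD; apply/esym/cvg_lim => //=.
    exact: cvg_nnsfun_approx.
  - by move=> n; exact/measurable_EFinP/measurable_funTS.
  - by move=> n ? _; rewrite lee_fin.
  - by move=> ? _ ? ? mn; rewrite lee_fin; exact/lefP/nd_nnsfun_approx.
transitivity (lim (\int[mu]_x ((f_ n x)%:E * (p x)%:E) @[n --> \oo])).
  by apply: congr_lim; apply/funext => n /=; exact: density_nnsfun.
rewrite -monotone_convergence//=.
- apply: eq_integral => x _; apply/cvg_lim => //.
  by apply: cvgeZr => //; exact: cvg_nnsfun_approx.
- move=> n; under eq_fun do rewrite -EFinM; apply/measurable_EFinP.
  exact: measurable_funM.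
- by move=> n x _; rewrite mule_ge0 ?lee_fin.
- move=> x _ m n mn; rewrite lee_wpmul2r ?lee_fin//.
  exact/lefP/nd_nnsfun_approx.
Qed.

End integral_density.

(** * Hermitian form and squared norm on C^n *)

Section hermitian_dot.
Context {R : realType} {n : nat}.
Implicit Types (z w u : 'rV[R[i]]_n) (r : R) (c : R[i]).

Definition hdot z w : R[i] := \sum_(j < n) z ord0 j * (w ord0 j)^*.

Lemma sqnorm_ge0 z : 0 <= sqnorm z.
Proof. by apply: sumr_ge0 => j _; rewrite sqr_ge0. Qed.

Lemma sqnorm0 : sqnorm (0 : 'rV[R[i]]_n) = 0.
Proof. by rewrite /sqnorm big1// => j _; rewrite mxE cabs0 expr0n. Qed.

Lemma sqnormZ c z : sqnorm (c *: z) = cabs c ^+ 2 * sqnorm z.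
Proof.
by rewrite /sqnorm mulr_sumr; apply: eq_bigr => j _; rewrite mxE cabsM exprMn.
Qed.

Lemma sqnormN z : sqnorm (- z) = sqnorm z.
Proof. by rewrite -scaleN1r sqnormZ cabsN cabs_real normr1 expr1n mul1r. Qed.

Lemma sqnormB z w : sqnorm (z - w) = sqnorm (w - z).
Proof. by rewrite -sqnormN opprB. Qed.

Lemma sqnormD z w :
  sqnorm (z + w) = sqnorm z + sqnorm w + 2 * complex.Re (hdot z w).
Proof.
rewrite /sqnorm /hdot Re_sum mulr_sumr -!big_split/=; apply: eq_bigr => j _.
by rewrite mxE !cabs_sqr !ReImE; ring.
Qed.

Lemma hdotDl z w u : hdot (z + w) u = hdot z u + hdot w u.
Proof. by rewrite /hdot -big_split/=; apply: eq_bigr => j _; rewrite mxE mulrDl. Qed.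

Lemma hdotZl c z u : hdot (c *: z) u = c * hdot z u.
Proof. by rewrite /hdot mulr_sumr; apply: eq_bigr => j _; rewrite mxE mulrA. Qed.

Lemma hdotNl z u : hdot (- z) u = - hdot z u.
Proof. by rewrite -scaleN1r hdotZl mulN1r. Qed.

Lemma hdot_conj z u : (hdot z u)^* = hdot u z.
Proof.
apply: complex_ext.
  rewrite Re_conjc /hdot !Re_sum; apply: eq_bigr => j _; rewrite !ReImE; ring.
rewrite Im_conjc /hdot !Im_sum -sumrN; apply: eq_bigr => j _; rewrite !ReImE; ring.
Qed.

Lemma hdotDr z w u : hdot z (w + u) = hdot z w + hdot z u.
Proof. by rewrite -hdot_conj hdotDl rmorphD/= !hdot_conj. Qed.

Lemma hdotZr c z u : hdot z (c *: u) = c^* * hdot z u.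
Proof. by rewrite -hdot_conj hdotZl rmorphM/= !hdot_conj. Qed.

Lemma hdotNr z u : hdot z (- u) = - hdot z u.
Proof. by rewrite -hdot_conj hdotNl rmorphN/= !hdot_conj. Qed.

Lemma hdot0l z : hdot 0 z = 0.
Proof. by rewrite -(scale0r 0) hdotZl mul0r. Qed.

Lemma hdotzz z : hdot z z = (sqnorm z)%:C.
Proof.
rewrite /hdot /sqnorm rmorph_sum/=; apply: eq_bigr => j _.
exact: mul_conj.
Qed.

Lemma sqnormBZ u w r : sqnorm (u - r%:C *: w) =
  sqnorm u + r ^+ 2 * sqnorm w - 2 * r * complex.Re (hdot u w).
Proof.
rewrite sqnormD sqnormN sqnormZ cabs_real real_normK ?num_real//.
by rewrite hdotNr hdotZr !ReImE/=; ring.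
Qed.

Lemma sqnormBE u w : sqnorm (u - w) =
  sqnorm u + sqnorm w - 2 * complex.Re (hdot u w).
Proof. by rewrite sqnormD sqnormN hdotNr Re_opp mulrN. Qed.

Lemma cabs_hdot_le z w : 2 * cabs (hdot z w) <= sqnorm z + sqnorm w.
Proof.
rewrite (le_trans (ler_wpM2l _ (cabs_sum _ _ _)))// mulr_sumr -big_split/=.
apply: ler_sum => j _; rewrite cabsM cabs_conj -subr_ge0.
rewrite (_ : _ - _ = (cabs (z ord0 j) - cabs (w ord0 j)) ^+ 2) ?sqr_ge0//.
by ring.
Qed.

Lemma measurable_hdot d (T : measurableType d) (f g : T -> 'rV[R[i]]_n) :
  measurable_fun setT f -> measurable_fun setT g ->
  measurable_fun setT (fun x => hdot (f x) (g x)).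
Proof.
move=> mf mg; apply: measurable_complex_sum => j; apply: measurable_complexM.
  exact: measurable_coord_comp.
by apply: measurable_conj; exact: measurable_coord_comp.
Qed.

End hermitian_dot.

(** * Gaussian integrals, convolution and doubling *)

Section gauss.
Local Open Scope ereal_scope.
Context {R : realType}.
Implicit Types t s : R.

Lemma gauss_densityE n t (z : 'rV[R[i]]_n) : (0 < t)%R -> gauss_density t z =
  (((4 * pi * t) ^+ n)^-1 * expR (- sqnorm z / (4 * t)))%R.
Proof. by rewrite /gauss_density => ->. Qed.

Lemma measurable_expR_sqr t :
  measurable_fun setT (fun x : R => (expR (- x ^+ 2 / (4 * t)))%:E).
Proof.
apply/measurable_EFinP; apply: measurableT_comp => //.
apply: measurable_funM => //; apply: measurable_funN.
exact: measurable_funX.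
Qed.

Lemma integral_expR_sqr t : (0 < t)%R ->
  \int[@lebesgue_measure R]_x (expR (- x ^+ 2 / (4 * t)))%:E =
  (Num.sqrt (4 * pi * t))%:E.
Proof.
(* The real Gaussian at time [t] is a multiple of the normal density of variance [2 * t]. *)
move=> t0; pose s := Num.sqrt (2 * t).
have s2 : (s ^+ 2 = 2 * t)%R by rewrite /s sqr_sqrtr// mulr_ge0// ltW.
have s0 : (s != 0)%R by rewrite /s gt_eqF// sqrtr_gt0 mulr_gt0.
have pt : (0 < 4 * pi * t)%R by rewrite !mulr_gt0// pi_gt0.
have := integral_normal_pdf 0%R s.
rewrite (_ : (fun x => _) =
    (fun x => ((Num.sqrt (4 * pi * t))^-1)%:E * (expR (- x ^+ 2 / (4 * t)))%:E)).
  rewrite ge0_integralZl; [|by []|exact: measurable_expR_sqr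
    |by move=> x _; rewrite lee_fin expR_ge0|by rewrite lee_fin invr_ge0 sqrtr_ge0].
  move=> /(congr1 (fun x => (Num.sqrt (4 * pi * t))%:E * x)).
  by rewrite muleA -EFinM divff ?mul1e ?mule1// gt_eqF// sqrtr_gt0.
apply/funext => x; rewrite normal_pdfE// -EFinM; congr EFin.
rewrite /normal_peak /normal_fun s2 subr0; congr ((Num.sqrt _)^-1 * expR (_ / _))%R.
  by ring.
by ring.
Qed.

Lemma sqnorm_rV_cons n (p : R[i] * 'rV[R[i]]_n) :
  sqnorm (rV_cons p) = (cabs p.1 ^+ 2 + sqnorm p.2)%R.
Proof.
rewrite /sqnorm big_ord_recl rV_cons0; congr (_ + _)%R.
by apply: eq_bigr => j _; rewrite rV_consS.
Qed.

(** Each complex coordinate contributes two real Gaussian integrals, hence one factor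
    [4 * pi * t]. *)
Lemma integral_expR_sqnorm n t : (0 < t)%R ->
  \int[lebesgue_Cn n]_z (expR (- sqnorm z / (4 * t)))%:E =
  ((4 * pi * t) ^+ n)%:E.
Proof.
move=> t0; have pt : (0 <= 4 * pi * t)%R by rewrite !mulr_ge0// ?pi_ge0// ltW.
have mexp (m : nat) : measurable_fun setT
    (fun z : 'rV[R[i]]_m => (expR (- sqnorm z / (4 * t)))%:E).
  apply/measurable_EFinP; apply: measurableT_comp => //.
  apply: measurable_funM => //; apply: measurable_funN.
  exact: measurable_sqnorm.
elim: n => [|n ih].
  by rewrite (integral_dirac (0%R : 'rV[R[i]]_0) measurableT (mexp 0%N)) diracT mul1e
    sqnorm0 oppr0 mul0r expR0 expr0.
rewrite (integral_lebesgue_CnS (mexp n.+1)); last by move=> z; rewrite lee_fin expR_ge0.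
have mC : measurable_fun setT (fun z : R[i] => (expR (- cabs z ^+ 2 / (4 * t)))%:E).
  apply/measurable_EFinP; apply: measurableT_comp => //.
  apply: measurable_funM => //; apply: measurable_funN.
  by apply: measurable_funX; exact: measurable_cabs.
transitivity (\int[lebesgue_C]_x
    (((4 * pi * t) ^+ n)%:E * (expR (- cabs x ^+ 2 / (4 * t)))%:E)).
  apply: eq_integral => x _; rewrite muleC -ih -ge0_integralZl; [|by []|exact: mexp
      |by move=> v _; rewrite lee_fin expR_ge0|by rewrite lee_fin expR_ge0].
    apply: eq_integral => v _; rewrite -EFinM -expRD -mulrDl -opprD.
    by rewrite sqnorm_rV_cons.
rewrite ge0_integralZl; [|by []|exact: mC
  |by move=> x _; rewrite lee_fin expR_ge0|by rewrite lee_fin exprn_ge0].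
rewrite exprSr EFinM; congr (_ * _).
rewrite (integral_lebesgue_C mC); last by move=> x; rewrite lee_fin expR_ge0.
transitivity (\int[@lebesgue_measure R]_x
    ((Num.sqrt (4 * pi * t))%:E * (expR (- x ^+ 2 / (4 * t)))%:E)).
  apply: eq_integral => x _; rewrite muleC -(integral_expR_sqr t0) -ge0_integralZl; [|by []
      |exact: measurable_expR_sqr|by move=> y _; rewrite lee_fin expR_ge0
      |by rewrite lee_fin expR_ge0].
    apply: eq_integral => y _; rewrite -EFinM -expRD -mulrDl -opprD.
    by rewrite cabs_sqr.
rewrite ge0_integralZl; [|by []|exact: measurable_expR_sqr
  |by move=> x _; rewrite lee_fin expR_ge0|by rewrite lee_fin sqrtr_ge0].
by rewrite integral_expR_sqr// -EFinM -expr2 sqr_sqrtr.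
Qed.

Context {n : nat}.
Implicit Types z w u : 'rV[R[i]]_n.

Lemma integral_gauss_density t : (0 < t)%R ->
  \int[lebesgue_Cn n]_z (gauss_density t z)%:E = 1.
Proof.
move=> t0; under eq_integral do rewrite gauss_densityE// EFinM.
have pt : (0 < 4 * pi * t)%R by rewrite !mulr_gt0// pi_gt0.
have mexp : measurable_fun setT
    (fun z : 'rV[R[i]]_n => (expR (- sqnorm z / (4 * t)))%:E).
  apply/measurable_EFinP; apply: measurableT_comp => //.
  apply: measurable_funM => //; apply: measurable_funN.
  exact: measurable_sqnorm.
rewrite ge0_integralZl; [|by []|exact: mexp
  |by move=> z _; rewrite lee_fin expR_ge0
  |by rewrite lee_fin invr_ge0 exprn_ge0// ltW].
by rewrite integral_expR_sqnorm// -EFinM mulVf// expf_neq0// gt_eqF.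
Qed.

Lemma gauss_measureT t : (0 < t)%R ->
  gauss_measure t [set: 'rV[R[i]]_n] = 1.
Proof. exact: integral_gauss_density. Qed.

Lemma integral_gauss_measure t (F : 'rV[R[i]]_n -> \bar R) :
  measurable_fun setT F -> (forall z, 0 <= F z) ->
  \int[gauss_measure t]_z F z =
  \int[lebesgue_Cn n]_z (F z * (gauss_density t z)%:E).
Proof.
move=> mF F0; apply: ge0_integral_density => //.
- exact: measurable_gauss_density.
- by move=> z; exact: gauss_density_ge0.
Qed.

Let gauss_measure_fin t : fin_num_fun (gauss_measure t : set 'rV[R[i]]_n -> \bar R).
Proof.
apply: lty_fin_num_fun; have [t0|t0] := ltP 0%R t.
  by rewrite /= gauss_measureT// ltry.
rewrite /= /gauss_measure; under eq_integral do rewrite /gauss_density ltNge t0/=.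
by rewrite integral0.
Qed.

HB.instance Definition _ t := @Measure_isFinite.Build _ _ _
  (gauss_measure t : set 'rV[R[i]]_n -> \bar R) (gauss_measure_fin t).

Lemma gauss_density_gt0 t z : (0 < t)%R -> (0 < gauss_density t z)%R.
Proof.
move=> t0; rewrite gauss_densityE// mulr_gt0 ?expR_gt0// invr_gt0 exprn_gt0//.
by rewrite !mulr_gt0// pi_gt0.
Qed.

Lemma gauss_densityN t z : gauss_density t (- z) = gauss_density t z.
Proof. by rewrite /gauss_density sqnormN. Qed.

Lemma gauss_densityB t z w : gauss_density t (z - w) = gauss_density t (w - z).
Proof. by rewrite -gauss_densityN opprB. Qed.

(* Completing the square in u. *)
Lemma gauss_densityM s t w u : (0 < s)%R -> (0 < t)%R ->
  (gauss_density s (w - u) * gauss_density t u = gauss_density (s + t) w *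
     gauss_density (s * t / (s + t)) (u - (t / (s + t))%:C *: w))%R.
Proof.
move=> s0 t0; have st0 : (0 < s + t)%R by rewrite addr_gt0.
rewrite !gauss_densityE ?divr_gt0 ?mulr_gt0//.
rewrite mulrACA -expRD [RHS]mulrACA -expRD -!invfM -!exprMn; congr ((_ ^+ _)^-1 * expR _)%R.
  by field; rewrite gt_eqF.
rewrite sqnormB sqnormBE sqnormBZ; field.
by rewrite !gt_eqF.
Qed.

(** After completing the square, the integrand is a constant times a translated Gaussian, whose
    integral is 1. *)
Lemma gauss_density_semigroup s t w : (0 < s)%R -> (0 < t)%R ->
  \int[lebesgue_Cn n]_u (gauss_density s (w - u) * gauss_density t u)%:E =
  (gauss_density (s + t) w)%:E.
Proof.
move=> s0 t0; under eq_integral do rewrite gauss_densityM// EFinM.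
have st0 : (0 < s + t)%R by rewrite addr_gt0.
have mg r a : measurable_fun setT
    (fun u : 'rV[R[i]]_n => (gauss_density r (u - a))%:E).
  apply/measurable_EFinP; apply: measurableT_comp; first exact: measurable_gauss_density.
  by apply: measurable_rVB; [exact: measurable_id|exact: measurable_cst].
rewrite ge0_integralZl; [|by []|exact: mg
  |by move=> u _; rewrite lee_fin gauss_density_ge0
  |by rewrite lee_fin gauss_density_ge0].
rewrite (proj2 (lebesgue_Cn_translation _)
  (fun u => (gauss_density (s * t / (s + t)) u)%:E))//.
- by rewrite integral_gauss_density ?mule1// divr_gt0// mulr_gt0.
- by apply/measurable_EFinP; exact: measurable_gauss_density.
- by move=> u; rewrite lee_fin gauss_density_ge0.
Qed.

(** The exponential factor increases with time, and the normalizing factor drops by at most [2 ^+ n]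
    while time doubles. This replaces monotonicity in time, which the kernel does not have. *)
Lemma gauss_density_doubling s t z : (0 < t)%R -> (t <= s)%R -> (s <= 2 * t)%R ->
  (gauss_density t z <= 2 ^+ n * gauss_density s z)%R.
Proof.
move=> t0 ts st; have s0 : (0 < s)%R by rewrite (lt_le_trans t0).
have pi0 := pi_gt0 R.
rewrite !gauss_densityE// mulrA ler_pM ?expR_ge0//.
- by rewrite invr_ge0 exprn_ge0// !mulr_ge0// ltW.
- rewrite -exprVn -exprVn -exprMn lerXn2r ?nnegrE ?mulr_ge0 ?invr_ge0 ?mulr_ge0//; try lra.
  rewrite -[leLHS]mul1r ler_pdivrMr ?mulr_gt0// mulrAC ler_pdivlMr ?mulr_gt0//.
  by nra.
- rewrite ler_expR !mulNr lerN2 ler_wpM2l ?sqnorm_ge0// lef_pV2 ?posrE ?mulr_gt0//.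
  by rewrite ler_wpM2l.
Qed.

End gauss.

(** * Maximal inequality for the heat semigroup *)

Section hopf.
Local Open Scope ereal_scope.
Context d (T : measurableType d) (R : realType).
Variables (mu : {measure set T -> \bar R}) (P : (T -> \bar R) -> T -> \bar R).
Implicit Types (f g : T -> \bar R) (l : R).

Let nnm f := measurable_fun setT f /\ forall x, 0 <= f x.

Hypothesis P_measurable : forall f, measurable_fun setT f ->
  (forall x, 0 <= f x) -> measurable_fun setT (P f).
Hypothesis P_ge0 : forall f, (forall x, 0 <= f x) -> forall x, 0 <= P f x.
Hypothesis P_le : forall f g, nnm f -> nnm g -> (forall x, f x <= g x) ->
  forall x, P f x <= P g x.
Hypothesis PD : forall f g, nnm f -> nnm g ->
  forall x, P (fun y => f y + g y) x = P f x + P g x.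
Hypothesis P_cst : forall c : R, (0 <= c)%R -> forall x, P (cst c%:E) x = c%:E.
Hypothesis P_integral : forall f, nnm f -> \int[mu]_x P f x <= \int[mu]_x f x.

Section fix_f.
Variables (f : T -> \bar R) (l : R).
Hypotheses (mf : measurable_fun setT f) (f0 : forall x, 0 <= f x).
Hypothesis foo : \int[mu]_x f x < +oo.
Hypothesis l0 : (0 < l)%R.

Let M := fix M k : T -> \bar R :=
  if k is j.+1 then fun x => maxe 0 (f x + P (M j) x - l%:E) else cst 0.

Let nnM k : nnm (M k).
Proof.
elim: k => [|k [ih1 ih2]]; first by split => //; exact: measurable_cst.
split=> [|x]; last by rewrite /= le_max lexx.
apply: measurable_maxe; first exact: measurable_cst.
apply: emeasurable_funB; last exact: measurable_cst.
by apply: emeasurable_funD => //; exact: P_measurable.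
Qed.

Let Mstep k x : f x + P (M k) x <= M k.+1 x + l%:E.
Proof. by rewrite -leeBlDr//= le_max lexx orbT. Qed.

Let M_le k x : M k x <= M k.+1 x.
Proof.
elim: k x => [|k ih] x; first by rewrite /= le_max lexx.
rewrite /= ge_max !le_max lexx/=; apply/orP; right.
apply: leeD => //; apply: leeD => //.
exact: (P_le (nnM k) (nnM k.+1) ih).
Qed.

Let M_homo j k x : (j <= k)%N -> M j x <= M k x.
Proof.
move=> /subnKC <-; elim: (k - j)%N => [|m ih]; first by rewrite addn0.
by rewrite addnS (le_trans ih).
Qed.

Let E k := [set x | 0 < M k x].

Let mE k : measurable (E k).
Proof.
by rewrite -[E k]setTI; apply: emeasurable_fun_o_infty => //; case: (nnM k).
Qed.

(** Where [M k.+1] is positive, the maximum is its second argument and equality holds; elsewhere the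
    left side is at most 0 and the right side is nonnegative. *)
Let Mkey k x : M k.+1 x + l%:E * (\1_(E k.+1) x)%:E <= f x + P (M k) x.
Proof.
rewrite indicE; case: (boolP (x \in E k.+1)) => [|].
  rewrite inE mule1 => Mgt0.
  have -> : M k.+1 x = f x + P (M k) x - l%:E.
    rewrite [LHS](_ : _ = maxe 0 (f x + P (M k) x - l%:E))//.
    apply/max_idPr; rewrite leNgt; apply/negP => h; move: Mgt0.
    by rewrite /E/= (max_idPl (ltW h)) ltxx.
  by rewrite subeK.
rewrite notin_setE /E /= mule0 adde0 => /negP; rewrite -leNgt => M0.
rewrite (le_trans M0)// adde_ge0// P_ge0//.
by case: (nnM k).
Qed.

Let M_integral k : \int[mu]_x M k.+1 x + l%:E * mu (E k.+1) <=
  \int[mu]_x f x + \int[mu]_x M k x.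
Proof.
have mM := (nnM k.+1).1; have M0 := (nnM k.+1).2.
have m1 : measurable_fun setT (fun x => l%:E * (\1_(E k.+1) x)%:E).
  by under eq_fun do rewrite -EFinM; apply/measurable_EFinP;
    apply: measurable_funM => //; exact: measurable_indic.
have p1 x : 0 <= l%:E * (\1_(E k.+1) x)%:E by rewrite mule_ge0// lee_fin ltW.
rewrite (_ : l%:E * mu _ = \int[mu]_x (l%:E * (\1_(E k.+1) x)%:E)); last first.
  rewrite ge0_integralZl//; last by rewrite lee_fin ltW.
    by rewrite integral_indic// setIT.
  by apply/measurable_EFinP; exact: measurable_indic.
rewrite -ge0_integralD//.
have mPM : measurable_fun setT (P (M k)) by apply: P_measurable; case: (nnM k).
have PM0 : forall x, 0 <= P (M k) x by apply: P_ge0; case: (nnM k).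
apply: (@le_trans _ _ (\int[mu]_x (f x + P (M k) x))).
  apply: ge0_le_integral => //.
  - by move=> x _; rewrite adde_ge0.
  - exact: emeasurable_funD.
  - exact: emeasurable_funD.
by rewrite ge0_integralD// leeD2l// P_integral.
Qed.

Let M_finite k : \int[mu]_x M k x < +oo.
Proof.
elim: k => [|k ih]; first by rewrite /= integral0 ltry.
apply: le_lt_trans (lte_add_pinfty foo ih).
by rewrite (le_trans _ (M_integral k))// leeDl// mule_ge0// lee_fin ltW.
Qed.

(** [M_integral] has an extra integral of [M k.+1] on the left and of [M k] on the right. As [M]
    increases with [k], the former absorbs the latter, and [M_finite] allows the cancellation. *)
Let E_bound k : l%:E * mu (E k) <= \int[mu]_x f x.
Proof.
case: k => [|k].
  rewrite (_ : E 0%N = set0) ?measure0 ?mule0 ?integral_ge0//.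
  by apply/seteqP; split => x //=; rewrite /E/= ltxx.
have Mfin : \int[mu]_x M k.+1 x \is a fin_num.
  by rewrite ge0_fin_numE// integral_ge0// => x _; case: (nnM k.+1).
rewrite -(leeD2lE _ _ Mfin) (le_trans (M_integral k))// addeC leeD2r//.
by apply: ge0_le_integral => //; (case: (nnM k) + case: (nnM k.+1)).
Qed.

Let iterP j : nnm (iter j P f).
Proof.
elim: j => [//|j [h1 h2]]; split; first exact: P_measurable.
by move=> x; exact: P_ge0.
Qed.

Let sum_nnm k : nnm (fun x => \sum_(j < k) iter j P f x).
Proof.
split=> [|x]; last by rewrite sume_ge0// => j _; case: (iterP j).
by apply: emeasurable_sum => j; case: (iterP j).
Qed.

Let P_sum k x : P (fun y => \sum_(j < k) iter j P f y) x =
  \sum_(j < k) iter j.+1 P f x.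
Proof.
elim: k x => [|k ih] x.
  rewrite big_ord0; transitivity (P (cst 0) x); last exact: P_cst.
  by congr (P _ x); apply/funext => y; rewrite big_ord0.
rewrite big_ord_recr/= -ih -PD//; congr (P _ x).
by apply/funext => y; rewrite big_ord_recr.
Qed.

(** Apply [P] to the bound for [k]: it preserves the constant [k * l] and turns [M k] into
    [P (M k)]. Adding [f] then costs one more [l], the amount that the recursion subtracts. *)
Let sum_le k x : \sum_(j < k) iter j P f x <= M k x + (k%:R * l)%:E.
Proof.
elim: k x => [|k ih] x; first by rewrite big_ord0 mul0r adde0.
rewrite big_ord_recl/= -P_sum.
rewrite (_ : (k.+1%:R * l)%:E = l%:E + (k%:R * l)%:E); last first.
  by rewrite -EFinD -addn1 natrD mulrDl mul1r addrC.
rewrite addeA.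
apply: (@le_trans _ _ (f x + P (M k) x + (k%:R * l)%:E)); last first.
  by rewrite leeD2r// Mstep.
rewrite -addeA leeD2l//.
have kl0 : (0 <= k%:R * l)%R by rewrite mulr_ge0// ltW.
have nnc : nnm (cst (k%:R * l)%:E).
  by split => [|y]; [exact: measurable_cst|rewrite /= lee_fin].
rewrite -[leRHS](_ : P (fun y => M k y + cst (k%:R * l)%:E y) x = _).
  apply: P_le => //; split=> [|y]; last by rewrite adde_ge0 ?lee_fin//; case: (nnM k).
  by apply: emeasurable_funD; [case: (nnM k)|exact: measurable_cst].
by rewrite PD// P_cst.
Qed.

(* Garsia's argument for the maximal ergodic inequality, with
   M_{k+1} = max 0 (f + P M_k - l) in place of the maximum of partial sums. *)
Lemma hopf_maximal N : exists G, [/\ measurable G,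
  l%:E * mu G <= \int[mu]_x f x &
  forall x, ~ G x -> forall k, (k <= N)%N ->
    \sum_(j < k) iter j P f x <= (k%:R * l)%:E].
Proof.
exists (E N); split => // x /negP; rewrite -leNgt => Mx k kN.
rewrite (le_trans (sum_le k x))// -[leRHS]add0e leeD2r//.
by rewrite (le_trans _ Mx)// M_homo.
Qed.

End fix_f.
End hopf.

(** * The heat semigroup and its maximal function *)

Section heat_semigroup.
Local Open Scope ereal_scope.
Context {R : realType} {n : nat}.
Implicit Types (s t : R) (f g : 'rV[R[i]]_n -> \bar R) (w z u : 'rV[R[i]]_n).

(** The maximal inequality and Tonelli's theorem want extended nonnegative functions and a kernel
    against Lebesgue measure; [heat_heatE] ties this form to the heat transform. *)
Definition heatE t f w : \bar R :=
  \int[lebesgue_Cn n]_z ((gauss_density t (w - z))%:E * f z).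

Lemma measurable_gauss_densityB t d (T : measurableType d)
    (a b : T -> 'rV[R[i]]_n) : measurable_fun setT a -> measurable_fun setT b ->
  measurable_fun setT (fun x => (gauss_density t (a x - b x))%:E).
Proof.
move=> ma mb; apply/measurable_EFinP.
apply: measurableT_comp; first exact: measurable_gauss_density.
exact: measurable_rVB.
Qed.

Lemma gauss_densityE_ge0 t z : 0 <= (gauss_density t z)%:E.
Proof. by rewrite lee_fin gauss_density_ge0. Qed.

Let mker t w : measurable_fun setT (fun z => (gauss_density t (w - z))%:E).
Proof.
by apply: measurable_gauss_densityB; [exact: measurable_cst|exact: measurable_id].
Qed.

Let mker2 t : measurable_fun setT (fun p : 'rV[R[i]]_n * 'rV[R[i]]_n =>
  (gauss_density t (p.1 - p.2))%:E).
Proof. exact: measurable_gauss_densityB. Qed.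

Let mkerf t f : measurable_fun setT f ->
  measurable_fun setT (fun p : 'rV[R[i]]_n * 'rV[R[i]]_n =>
    (gauss_density t (p.1 - p.2))%:E * f p.2).
Proof. by move=> mf; apply: emeasurable_funM => //; exact: measurableT_comp. Qed.

Lemma integral_gauss_densityB t w : (0 < t)%R ->
  \int[lebesgue_Cn n]_z (gauss_density t (w - z))%:E = 1.
Proof.
move=> t0; rewrite (proj2 (lebesgue_Cn_reflection w)
  (fun z => (gauss_density t z)%:E)).
- exact: integral_gauss_density.
- by apply/measurable_EFinP; exact: measurable_gauss_density.
- exact: gauss_densityE_ge0.
Qed.

Lemma heatE_ge0 t f w : (forall z, 0 <= f z) -> 0 <= heatE t f w.
Proof.
by move=> f0; apply: integral_ge0 => z _; rewrite mule_ge0// gauss_densityE_ge0.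
Qed.

Lemma measurable_heatE t f : measurable_fun setT f -> (forall z, 0 <= f z) ->
  measurable_fun setT (heatE t f).
Proof.
move=> mf f0; apply: (measurable_fun_fubini_tonelli_F _ (mkerf t mf)).
by move=> p; rewrite mule_ge0// gauss_densityE_ge0.
Qed.

Lemma le_heatE t f g w : measurable_fun setT f -> (forall z, 0 <= f z) ->
  measurable_fun setT g ->
  (forall z, f z <= g z) -> heatE t f w <= heatE t g w.
Proof.
move=> mf f0 mg fg; apply: ge0_le_integral => //.
- by move=> z _; rewrite mule_ge0// gauss_densityE_ge0.
- exact: emeasurable_funM.
- exact: emeasurable_funM.
- by move=> z _; rewrite lee_wpmul2l// gauss_densityE_ge0.
Qed.

Lemma heatED t f g w : measurable_fun setT f -> (forall z, 0 <= f z) ->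
  measurable_fun setT g -> (forall z, 0 <= g z) ->
  heatE t (fun z => f z + g z) w = heatE t f w + heatE t g w.
Proof.
move=> mf f0 mg g0; rewrite -ge0_integralD//.
- by apply: eq_integral => z _; rewrite ge0_muleDr.
- by move=> z _; rewrite mule_ge0// gauss_densityE_ge0.
- exact: emeasurable_funM.
- by move=> z _; rewrite mule_ge0// gauss_densityE_ge0.
- exact: emeasurable_funM.
Qed.

Lemma heatE_cst t (c : R) w : (0 < t)%R -> (0 <= c)%R ->
  heatE t (cst c%:E) w = c%:E.
Proof.
move=> t0 c0; rewrite /heatE; under eq_integral do rewrite muleC.
rewrite ge0_integralZl ?lee_fin//; last first.
  by move=> z _; exact: gauss_densityE_ge0.
by rewrite integral_gauss_densityB// mule1.
Qed.

(** The kernel is symmetric in its two points, so its integral in [w] is 1 as well. *)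
Lemma integral_heatE t f : (0 < t)%R -> measurable_fun setT f ->
  (forall z, 0 <= f z) ->
  \int[lebesgue_Cn n]_w heatE t f w = \int[lebesgue_Cn n]_z f z.
Proof.
move=> t0 mf f0; rewrite /heatE (fubini_tonelli _ (mkerf t mf))/=; last first.
  by move=> p; rewrite mule_ge0// gauss_densityE_ge0.
apply: eq_integral => z _; under eq_integral do rewrite gauss_densityB.
rewrite ge0_integralZr//; last by move=> w _; exact: gauss_densityE_ge0.
by rewrite integral_gauss_densityB// mul1e.
Qed.

Lemma heatE_semigroup s t f w : (0 < s)%R -> (0 < t)%R ->
  measurable_fun setT f -> (forall z, 0 <= f z) ->
  heatE s (heatE t f) w = heatE (s + t) f w.
Proof.
move=> s0 t0 mf f0; pose K (u z : 'rV[R[i]]_n) := (gauss_density s (w - u))%:E *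
  ((gauss_density t (u - z))%:E * f z).
have mK : measurable_fun setT (fun p => K p.1 p.2).
  by apply: emeasurable_funM (mkerf t mf); exact: measurable_gauss_densityB.
transitivity (\int[lebesgue_Cn n]_u \int[lebesgue_Cn n]_z K u z).
  apply: eq_integral => u _; rewrite -ge0_integralZl//.
  - exact: emeasurable_funM.
  - by move=> z _; rewrite mule_ge0// gauss_densityE_ge0.
  - exact: gauss_densityE_ge0.
transitivity (\int[lebesgue_Cn n]_z \int[lebesgue_Cn n]_u K u z).
  apply: (fubini_tonelli (fun p => K p.1 p.2)) => // p.
  by rewrite !mule_ge0// gauss_densityE_ge0.
apply: eq_integral => z _; rewrite /K; under eq_integral do rewrite muleA.
rewrite ge0_integralZr//; last 2 first.
- apply: emeasurable_funM => //.
  by apply: measurable_gauss_densityB; [exact: measurable_id|exact: measurable_cst].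
- by move=> u _; rewrite mule_ge0// gauss_densityE_ge0.
congr (_ * _).
rewrite -(gauss_density_semigroup (w - z) s0 t0).
(* Translating [u] by [- z] turns the integral of the two kernels into the convolution at
   [w - z]. *)
rewrite -(proj2 (lebesgue_Cn_translation (- z)) (fun u =>
  (gauss_density s (w - z - u) * gauss_density t u)%:E)).
- apply: eq_integral => u _; rewrite -EFinM; congr (gauss_density _ _ * _)%:E.
  by rewrite opprB addrA subrK.
- under eq_fun do rewrite EFinM; apply: emeasurable_funM => //.
  by apply/measurable_EFinP; exact: measurable_gauss_density.
- by move=> u; rewrite EFinM mule_ge0// gauss_densityE_ge0.
Qed.

Lemma heatE_doubling s t f w : (0 < t)%R -> (t <= s)%R -> (s <= 2 * t)%R ->
  measurable_fun setT f -> (forall z, 0 <= f z) ->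
  heatE t f w <= (2 ^+ n)%:E * heatE s f w.
Proof.
move=> t0 ts st mf f0; rewrite -ge0_integralZl; [|by []|exact: emeasurable_funM
  |by move=> z _; rewrite mule_ge0// gauss_densityE_ge0
  |by rewrite lee_fin exprn_ge0].
apply: ge0_le_integral => //.
- by move=> z _; rewrite mule_ge0// gauss_densityE_ge0.
- exact: emeasurable_funM.
- by apply: emeasurable_funM => //; exact: emeasurable_funM.
- move=> z _; rewrite muleA lee_wpmul2r// -EFinM lee_fin.
  exact: gauss_density_doubling.
Qed.

Lemma iter_heatE t f j : (0 < t)%R -> measurable_fun setT f ->
  (forall z, 0 <= f z) -> iter j.+1 (heatE t) f = heatE (j.+1%:R * t) f.
Proof.
move=> t0 mf f0; elim: j => [|j ih]; first by rewrite mul1r.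
rewrite iterS ih; apply/funext => w.
have jt0 : (0 < j.+1%:R * t)%R by rewrite mulr_gt0.
rewrite (_ : (j.+2%:R * t)%R = t + j.+1%:R * t)%R; first exact: heatE_semigroup.
by rewrite -addn1 natrD mulrDl mul1r addrC.
Qed.

Let discrete_maximal t f l N : (0 < t)%R -> (0 < l)%R ->
  measurable_fun setT f -> (forall z, 0 <= f z) ->
  \int[lebesgue_Cn n]_z f z < +oo ->
  exists G, [/\ measurable G,
    l%:E * lebesgue_Cn n G <= \int[lebesgue_Cn n]_z f z &
    forall w, ~ G w -> forall k, (k <= N)%N ->
      \sum_(j < k) iter j (heatE t) f w <= (k%:R * l)%:E].
Proof.
move=> t0 l0 mf f0 foo; apply: (hopf_maximal (P := heatE t)) => //.
- exact: measurable_heatE.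
- by move=> g g0 w; exact: heatE_ge0.
- by move=> g h [? ?] [? ?] gh w; exact: le_heatE.
- by move=> g h [? ?] [? ?] w; exact: heatED.
- by move=> c c0 w; exact: heatE_cst.
- by move=> g [? ?]; rewrite integral_heatE.
Qed.

(* Averages of the heat semigroup over [m t, 2 m t] dominate its value at m t
   up to a constant, so the maximal ergodic inequality for the discrete
   semigroup of step t controls all times at least t. *)
Let maximal_from t f l : (0 < t)%R -> (0 < l)%R ->
  measurable_fun setT f -> (forall z, 0 <= f z) ->
  \int[lebesgue_Cn n]_z f z < +oo ->
  exists G, [/\ measurable G,
    l%:E * lebesgue_Cn n G <= \int[lebesgue_Cn n]_z f z &
    forall w, ~ G w -> f w <= l%:E /\
      forall s, (t <= s)%R -> (s <= 1)%R -> heatE s f w <= (2 ^+ (2 * n).+1 * l)%:E].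
Proof.
move=> t0 l0 mf f0 foo.
(* The sums below have [m.*2] terms, and [s <= 1] bounds [m] by [Num.truncn t^-1 + 1]. *)
pose N := ((Num.truncn (t^-1)).+1.*2)%N.
have [G [mG Gl Gsum]] := discrete_maximal N.+2 t0 l0 mf f0 foo.
exists G; split => // w Gw; split.
  by have := Gsum _ Gw 1%N isT; rewrite big_ord1/= mul1r.
move=> s ts s1; have s0 : (0 < s)%R by rewrite (lt_le_trans t0).
(* The first multiple of [t] beyond [s]; it is at most [s + t], hence at most [2 * s]. *)
pose m := (Num.truncn (s / t)).+1.
have st1 : (1 <= s / t)%R by rewrite ler_pdivlMr// mul1r.
have [ms1 ms2] : (s / t < m%:R /\ m%:R <= s / t + 1)%R.
  split; first by rewrite /m truncnS_gt.
  by rewrite /m -addn1 natrD lerD2r truncn_le// (le_trans _ st1).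
have smt : (s <= m%:R * t)%R by rewrite -ler_pdivrMr// ltW.
have mts : (m%:R * t <= 2 * s)%R.
  by rewrite -ler_pdivlMr// -mulrA (le_trans ms2)//; lra.
have m0 : (0 < m%:R :> R)%R by rewrite ltr0n.
have mN : (m.*2 <= N.+2)%N.
  apply: (@leq_trans N); last exact: leqW (leqnSn N).
  rewrite /N leq_double ltnS; apply: Num.Theory.le_truncn.
  by rewrite -[leRHS]mul1r ler_wpM2r// invr_ge0 ltW.
rewrite (le_trans (heatE_doubling w s0 smt mts mf f0))//.
have it0 k v : 0 <= iter k (heatE t) f v.
  by elim: k v => //= k ih v; exact: heatE_ge0.
(* Only the terms of index [m] to [2 * m - 1] are kept; each dominates [heatE (m * t) f w] up to the
   doubling constant. *)
have key : m%:R%:E * heatE (m%:R * t) f w <=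
    (2 ^+ n)%:E * \sum_(j < m.*2) iter j (heatE t) f w.
  apply: (@le_trans _ _ ((2 ^+ n)%:E * \sum_(j < m) iter (m + j) (heatE t) f w)).
    rewrite ge0_sume_distrr; last by move=> j _; exact: it0.
    apply: (@le_trans _ _ (\sum_(j < m) heatE (m%:R * t) f w)).
      by rewrite sumr_const card_ord mule_natl.
    apply: lee_sum => j _.
    rewrite (_ : iter (m + j) (heatE t) f w = heatE ((m + j)%:R * t) f w).
      apply: heatE_doubling => //.
      - by rewrite mulr_gt0.
      - by rewrite ler_pM2r// ler_nat leq_addr.
      - rewrite mulrA ler_pM2r// -natrM ler_nat mul2n -addnn leq_add2l.
        exact: ltnW.
    by rewrite /m addSn iter_heatE.
  rewrite lee_wpmul2l ?lee_fin ?exprn_ge0// -addnn big_split_ord/= leeDr//.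
  by rewrite sume_ge0.
have c0 : 0 <= (2 ^+ n)%:E :> \bar R by rewrite lee_fin exprn_ge0.
(* The sum of [2 * m] terms is at most [2 * m * l], hence the factor [2 ^+ n.+1]; passing from time
   [s] to time [m * t] costs another [2 ^+ n]. *)
have {key} : m%:R%:E * heatE (m%:R * t) f w <= m%:R%:E * (2 ^+ n.+1 * l)%:E.
  rewrite (le_trans key)// (le_trans (lee_wpmul2l c0 (Gsum _ Gw _ mN)))//.
  rewrite -!EFinM lee_fin -muln2 natrM exprS.
  by rewrite le_eqVlt; apply/orP; left; apply/eqP; ring.
rewrite lee_pmul2l ?lte_fin// => h.
rewrite (le_trans (lee_wpmul2l c0 h))// -EFinM lee_fin.
by rewrite mulrA -exprD mul2n -addnn addnS.
Qed.

Lemma heat_maximal f l : (0 < l)%R ->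
  measurable_fun setT f -> (forall z, 0 <= f z) ->
  \int[lebesgue_Cn n]_z f z < +oo ->
  exists G, [/\ measurable G,
    l%:E * lebesgue_Cn n G <= \int[lebesgue_Cn n]_z f z &
    forall w, ~ G w -> f w <= l%:E /\
      forall s, (0 < s)%R -> (s <= 1)%R -> heatE s f w <= (2 ^+ (2 * n).+1 * l)%:E].
Proof.
move=> l0 mf f0 foo.
have /choice[G GP] : forall q : nat, exists G, [/\ measurable G,
    l%:E * lebesgue_Cn n G <= \int[lebesgue_Cn n]_z f z &
    forall w, ~ G w -> f w <= l%:E /\
      forall s, (q.+1%:R^-1 <= s)%R -> (s <= 1)%R ->
      heatE s f w <= (2 ^+ (2 * n).+1 * l)%:E].
  by move=> q; apply: maximal_from.
(* The sets [G p] need not be monotone, so their lower limit is taken: the [H q] increase, and [H q]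
   lies in [G q]. Off the union of the [H q], a point avoids [G p] for arbitrarily large [p], which
   reaches every positive [s]. *)
pose H q := \bigcap_(p in [set p | (q <= p)%N]) G p.
have mH q : measurable (H q).
  by apply: bigcap_measurableType => p _; case: (GP p).
exists (\bigcup_q H q); split; first exact: bigcup_measurable.
- have ndH : nondecreasing_seq H.
    move=> p q pq; apply/subsetPset => w Hw r /= qr; apply: Hw => /=.
    exact: leq_trans qr.
  have cH := nondecreasing_cvg_mu (mu := lebesgue_Cn n) mH
    (bigcup_measurable (fun q _ => mH q)) ndH.
  rewrite -lee_pdivlMl//; apply: (cvge_to_le cH); apply: nearW => q /=.
  rewrite lee_pdivlMl//; have [mG Gl _] := GP q.
  rewrite (le_trans _ Gl)// lee_pmul2l ?lte_fin//.
  by apply: le_measure; rewrite ?inE// => w; apply => /=.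
- move=> w Hw; have {}Hw q : exists2 p, (q <= p)%N & ~ G p w.
    apply: contrapT => h; apply: Hw; exists q => // p /= qp.
    by apply: contrapT => Gp; apply: h; exists p.
  split; first by have [p _ Gp] := Hw 0%N; have [_ _ /(_ w Gp)[]] := GP p.
  move=> s s0 s1; have [p qp Gp] := Hw (Num.truncn s^-1).
  have [_ _ /(_ w Gp)[_]] := GP p; apply => //.
  rewrite invf_ple ?posrE//; rewrite (le_trans (ltW (truncnS_gt _)))//.
  by rewrite ler_nat ltnS.
Qed.

End heat_semigroup.

Lemma cvg0_dominated {R : realType} T (F : set_system T) {FF : Filter F}
    (f g : T -> R) : (forall x, `|f x| <= g x) ->
  g x @[x --> F] --> 0 -> f x @[x --> F] --> 0.
Proof.
move=> fg /cvgr0Pnorm_lt g0; apply/cvgr0Pnorm_lt => e /g0.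
apply: filterS => x; apply: le_lt_trans.
by rewrite (le_trans (fg x))// ler_norm.
Qed.

(** * Almost everywhere convergence of the heat transform *)

Section sqnorm_filter.
Context {R : realType} {n : nat}.
Implicit Types (w z : 'rV[R[i]]_n).

(* The neighbourhoods of 0 in C^n for the Euclidean norm, whose square is
   sqnorm; the library's topology comes from the maximum norm. *)
Definition sqnbhs0 : set_system 'rV[R[i]]_n :=
  [set A | exists2 d : R, 0 < d & [set z | sqnorm z < d] `<=` A].

Global Instance sqnbhs0_filter : ProperFilter sqnbhs0.
Proof.
apply: Build_ProperFilter_ex.
  by move=> A [d d0 dA]; exists 0; apply: dA; rewrite /= sqnorm0.
split; first by exists 1.
  move=> A B [a a0 aA] [b b0 bB]; exists (Num.min a b).
    by rewrite lt_min a0.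
  by move=> z /=; rewrite lt_min => /andP[za zb]; split; [exact: aA|exact: bB].
by move=> A B AB [a a0 aA]; exists a => //; exact: subset_trans AB.
Qed.

Lemma sqnorm_coord_le z j : cabs (z ord0 j) ^+ 2 <= sqnorm z.
Proof.
by rewrite /sqnorm (bigD1 j)//= lerDl sumr_ge0// => k _; rewrite sqr_ge0.
Qed.

Lemma cvg_coord_sqnbhs0 j : cabs (z ord0 j) @[z --> sqnbhs0] --> (0 : R).
Proof.
apply/cvgr0Pnorm_lt => e e0; exists (e ^+ 2); first by rewrite exprn_gt0.
move=> z /= ze; rewrite ger0_norm ?cabs_ge0//.
rewrite -(@ltr_pXn2r _ 2)// ?nnegrE ?cabs_ge0//; last exact: ltW.
exact: le_lt_trans (sqnorm_coord_le z j) ze.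
Qed.

Lemma cvg_Re_coord_sqnbhs0 w j :
  complex.Re ((w - z) ord0 j) @[z --> sqnbhs0] --> complex.Re (w ord0 j).
Proof.
rewrite (_ : (fun z => _) = fun z : 'rV[R[i]]_n =>
  complex.Re (w ord0 j) - complex.Re (z ord0 j)); last first.
  by apply/funext => z; rewrite !mxE !ReImE.
rewrite -[X in _ --> X]subr0.
apply: cvgB; first exact: cvg_cst.
apply: (@cvg0_dominated _ _ _ _ _ (fun z => cabs (z ord0 j)));
  last exact: cvg_coord_sqnbhs0.
by move=> z; exact: Re_le_cabs.
Qed.

Lemma cvg_Im_coord_sqnbhs0 w j :
  complex.Im ((w - z) ord0 j) @[z --> sqnbhs0] --> complex.Im (w ord0 j).
Proof.
rewrite (_ : (fun z => _) = fun z : 'rV[R[i]]_n =>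
  complex.Im (w ord0 j) - complex.Im (z ord0 j)); last first.
  by apply/funext => z; rewrite !mxE !ReImE.
rewrite -[X in _ --> X]subr0.
apply: cvgB; first exact: cvg_cst.
apply: (@cvg0_dominated _ _ _ _ _ (fun z => cabs (z ord0 j)));
  last exact: cvg_coord_sqnbhs0.
by move=> z; exact: Im_le_cabs.
Qed.

(** The increment is subtracted because the heat transform integrates [f (w - z)]. *)
Definition sqcontinuous (g : 'rV[R[i]]_n -> R) :=
  forall w, g (w - z) @[z --> sqnbhs0] --> g w.

Lemma sqcontinuous_sqnorm : sqcontinuous (@sqnorm R n).
Proof.
move=> w; apply: cvg_big => [|j _]; first exact: add_continuous.
rewrite (_ : (fun z => _) = fun z : 'rV[R[i]]_n =>
  complex.Re ((w - z) ord0 j) * complex.Re ((w - z) ord0 j) +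
  complex.Im ((w - z) ord0 j) * complex.Im ((w - z) ord0 j)); last first.
  by apply/funext => z; rewrite cabs_sqr !expr2.
rewrite cabs_sqr !expr2; apply: cvgD.
  by apply: cvgM; exact: cvg_Re_coord_sqnbhs0.
by apply: cvgM; exact: cvg_Im_coord_sqnbhs0.
Qed.

Lemma sqcontinuous_gauss_density t : sqcontinuous (gauss_density t).
Proof.
rewrite /gauss_density; case: (ltP 0 t) => t0; last by move=> w; exact: cvg_cst.
move=> w; apply: cvgM; first exact: cvg_cst.
apply: (cvg_comp (fun z => - sqnorm (w - z) / (4 * t)) expR);
  last exact: continuous_expR.
apply: cvgM; last exact: cvg_cst.
by apply: cvgN; exact: sqcontinuous_sqnorm.
Qed.

Lemma gauss_density_le t z : 0 < t ->
  gauss_density t z <= ((4 * pi * t) ^+ n)^-1.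
Proof.
move=> t0; have pt : 0 < 4 * pi * t by rewrite !mulr_gt0// pi_gt0.
rewrite gauss_densityE// ler_piMr// ?invr_ge0 ?exprn_ge0 ?(ltW pt)//.
rewrite -[leRHS]expR0 ler_expR mulNr oppr_le0 mulr_ge0 ?sqnorm_ge0//.
by rewrite invr_ge0 mulr_ge0// ltW.
Qed.

End sqnorm_filter.

(** * Heat transform of bounded real functions as time tends to 0 *)

Section heat.
Context {R : realType} {n : nat}.
Implicit Types (f g : 'rV[R[i]]_n -> R) (t : R) (w z : 'rV[R[i]]_n).

Definition bounded_measurable f :=
  measurable_fun setT f /\ exists M : R, forall z, `|f z| <= M.

Local Notation bm := bounded_measurable.

Lemma bm_cst c : bm (cst c).
Proof. by split; [exact: measurable_cst|exists `|c|]. Qed.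

Lemma bmD f g : bm f -> bm g -> bm (fun z => f z + g z).
Proof.
move=> [mf [M fM]] [mg [N gN]]; split; first exact: measurable_funD.
by exists (M + N) => z; rewrite (le_trans (ler_normD _ _))// lerD.
Qed.

Lemma bmM f g : bm f -> bm g -> bm (fun z => f z * g z).
Proof.
move=> [mf [M fM]] [mg [N gN]]; split; first exact: measurable_funM.
by exists (M * N) => z; rewrite normrM ler_pM.
Qed.

Lemma bmN f : bm f -> bm (fun z => - f z).
Proof.
move=> [mf [M fM]]; split; first exact: measurable_funN.
by exists M => z; rewrite normrN.
Qed.

Lemma bmB f g : bm f -> bm g -> bm (fun z => f z - g z).
Proof. by move=> bf bg; apply: bmD => //; exact: bmN. Qed.

Lemma bm_norm f : bm f -> bm (fun z => `|f z|).
Proof.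
move=> [mf [M fM]]; split; first exact: measurableT_comp.
by exists M => z; rewrite normr_id.
Qed.

Lemma bm_shift f w : bm f -> bm (fun z => f (w - z)).
Proof.
move=> [mf [M fM]]; split; last by exists M => z; exact: fM.
apply: measurableT_comp mf _; apply: measurable_rVB.
  exact: measurable_cst.
exact: measurable_id.
Qed.

Lemma bm_gauss t : bm (gauss_density t).
Proof.
split; first exact: measurable_gauss_density.
have [t0|t0] := ltP 0 t.
  exists ((4 * pi * t) ^+ n)^-1 => z.
  by rewrite ger0_norm ?gauss_density_ge0// gauss_density_le.
by exists 0 => z; rewrite /gauss_density ltNge t0/= normr0.
Qed.

Lemma bm_integrable f t : bm f -> (gauss_measure t).-integrable setT (EFin \o f).
Proof.
move=> [mf [M fM]]; apply: measurable_bounded_integrable => //.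
  by rewrite -ge0_fin_numE ?fin_num_measure.
exists M; split; first exact: num_real.
by move=> x Mx z _ /=; rewrite (le_trans (fM z))// ltW.
Qed.

Definition heat t f w : R := \int[gauss_measure t]_z f (w - z).

Lemma heatD t f g w : bm f -> bm g ->
  heat t (fun z => f z + g z) w = heat t f w + heat t g w.
Proof.
by move=> bf bg; rewrite /heat RintegralD//; exact/bm_integrable/bm_shift.
Qed.

Lemma heatB t f g w : bm f -> bm g ->
  heat t (fun z => f z - g z) w = heat t f w - heat t g w.
Proof.
by move=> bf bg; rewrite /heat RintegralB//; exact/bm_integrable/bm_shift.
Qed.

Lemma heatZ t c f w : bm f -> heat t (fun z => c * f z) w = c * heat t f w.
Proof.
by move=> bf; rewrite /heat RintegralZl//; exact/bm_integrable/bm_shift.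
Qed.

Lemma heat_cst t c w : 0 < t -> heat t (cst c) w = c.
Proof.
move=> t0; rewrite /heat Rintegral_cst//.
by rewrite /= gauss_measureT//= mulr1.
Qed.

Lemma le_norm_heat t f w : bm f -> `|heat t f w| <= heat t (fun z => `|f z|) w.
Proof.
by move=> bf; rewrite /heat le_normr_Rintegral//; exact/bm_integrable/bm_shift.
Qed.

Lemma heat_heatE t f w : bm f -> (forall z, 0 <= f z) ->
  (heat t f w)%:E = heatE t (EFin \o f) w.
Proof.
move=> bf f0; rewrite /heat /Rintegral fineK; last first.
  by apply: integrable_fin_num => //; exact/bm_integrable/bm_shift.
have [mf _] := bf; have [mfw _] := bm_shift w bf.
rewrite integral_gauss_measure; [|exact/measurable_EFinP|by move=> z; rewrite lee_fin].
rewrite -[RHS](proj2 (lebesgue_Cn_reflection w)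
  (fun z => (gauss_density t (w - z))%:E * (f z)%:E)%E).
- by apply: eq_integral => z _; rewrite subKr muleC.
- apply: emeasurable_funM; last exact/measurable_EFinP.
  by apply: measurable_gauss_densityB; [exact: measurable_cst|exact: measurable_id].
- by move=> z; rewrite mule_ge0// lee_fin ?gauss_density_ge0.
Qed.

Lemma nbhs_right0P (P : R -> Prop) :
  (exists2 d, 0 < d & forall t, 0 < t -> t < d -> P t) -> \forall t \near 0^'+, P t.
Proof.
move=> [d d0 dP]; near=> t; apply: dP; first by near: t; exact: nbhs_right_gt.
by near: t; exact: nbhs_right_lt.
Unshelve. all: by end_near. Qed.

(** Half of the exponent is kept to form the density at time [2 * t]. The exponential of the other
    half is at most [8 * t / d], by [1 + x <= expR x]. *)
Lemma gauss_density_tail t d z : 0 < t -> 0 < d -> d <= sqnorm z ->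
  gauss_density t z <= 2 ^+ n * (8 * t / d) * gauss_density (2 * t) z.
Proof.
move=> t0 d0 dz; have pi0 := pi_gt0 R.
have z0 : 0 < sqnorm z by rewrite (lt_le_trans d0).
rewrite !gauss_densityE ?mulr_gt0//.
rewrite (_ : expR (- sqnorm z / (4 * t)) =
  expR (- sqnorm z / (4 * (2 * t))) * expR (- sqnorm z / (4 * (2 * t)))); last first.
  by rewrite -expRD; congr expR; field; rewrite gt_eqF.
rewrite [leLHS]mulrA [leRHS]mulrA ler_wpM2r ?expR_ge0//.
rewrite [leRHS]mulrAC (_ : 2 ^+ n * _ = ((4 * pi * t) ^+ n)^-1); last first.
  by rewrite (mulrCA _ 2) [X in X^-1]exprMn invfM mulrA divff ?mul1r// expf_neq0.
rewrite ler_wpM2l ?invr_ge0 ?exprn_ge0 ?mulr_ge0 ?(ltW pi0) ?(ltW t0)//.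
rewrite mulNr expRN -[leRHS]invrK lef_pV2 ?posrE ?expR_gt0 ?invr_gt0 ?divr_gt0 ?mulr_gt0//.
rewrite (le_trans _ (expR_ge1Dx _))// invf_div.
rewrite (@le_trans _ _ (sqnorm z / (8 * t)))//.
  by rewrite ler_wpM2r// invr_ge0 mulr_ge0// ltW.
by rewrite mulrA (_ : 4 * 2 = 8 :> R) ?lerDr//; ring.
Qed.

(* The Gaussian mass away from the origin tends to 0, as
   gauss_density t <= C t gauss_density (2 t) there. *)
Lemma gauss_approximate_identity f : bm f ->
  f z @[z --> sqnbhs0] --> 0 -> \int[gauss_measure t]_z f z @[t --> 0^'+] --> 0.
Proof.
move=> bf f0; have [mf [M fM]] := bf; apply/cvgr0Pnorm_le => e e0.
have e20 : 0 < e / 2 by rewrite divr_gt0.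
have /cvgr0Pnorm_le /(_ _ e20)[d d0 df] := f0.
have M0 : 0 <= M by rewrite (le_trans _ (fM 0)).
(* Near 0 the weighted integrand is at most [e / 2] times the density; elsewhere
   [gauss_density_tail] bounds it by [C * t] times the density at time [2 * t]. Both densities have
   integral 1. *)
pose C := M * (2 ^+ n * (8 / d)).
have C0 : 0 <= C by rewrite !mulr_ge0 ?exprn_ge0 ?invr_ge0 ?(ltW d0).
apply: nbhs_right0P; exists (e / 2 / (C + 1)).
  by rewrite !divr_gt0// ltr_wpDl.
move=> t t0 te; have itf := bm_integrable t bf.
have Ct0 : 0 <= C * t by rewrite mulr_ge0// ltW.
rewrite (le_trans (le_normr_Rintegral _ itf))//.
have t20 : 0 < 2 * t by rewrite mulr_gt0.
have mabs : measurable_fun setT (fun z => (`|f z|)%:E).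
  by apply/measurable_EFinP; case: (bm_norm bf).
rewrite -lee_fin /Rintegral fineK; last first.
  by apply: integrable_fin_num => //; exact/bm_integrable/bm_norm.
rewrite integral_gauss_measure; [|exact: mabs|by move=> z; rewrite lee_fin].
have mg s : measurable_fun setT (fun z : 'rV[R[i]]_n => (gauss_density s z)%:E).
  by apply/measurable_EFinP; exact: measurable_gauss_density.
apply: (@le_trans _ _ (\int[lebesgue_Cn n]_z ((e / 2)%:E * (gauss_density t z)%:E +
   (C * t)%:E * (gauss_density (2 * t) z)%:E))%E).
  apply: ge0_le_integral => //.
  - by move=> z _; rewrite mule_ge0// lee_fin gauss_density_ge0.
  - exact: emeasurable_funM.
  - by apply: emeasurable_funD; exact: emeasurable_funM.
  - move=> z _; rewrite -!EFinM -EFinD lee_fin.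
    have [zd|dz] := ltP (sqnorm z) d.
      rewrite (@le_trans _ _ (e / 2 * gauss_density t z))//.
        by rewrite ler_wpM2r ?gauss_density_ge0//; exact: df.
      by rewrite lerDl mulr_ge0 ?gauss_density_ge0.
    rewrite (@le_trans _ _ (C * t * gauss_density (2 * t) z))//; last first.
      by rewrite lerDr mulr_ge0 ?gauss_density_ge0// ltW.
    rewrite (@le_trans _ _ (M * (2 ^+ n * (8 * t / d) * gauss_density (2 * t) z)))//.
      by rewrite ler_pM ?gauss_density_ge0// gauss_density_tail.
    by rewrite le_eqVlt; apply/orP; left; apply/eqP; rewrite /C; field; rewrite gt_eqF.
have gE s z : (0 <= (gauss_density s z)%:E)%E by rewrite lee_fin gauss_density_ge0.
have e2E : (0 <= (e / 2)%:E)%E by rewrite lee_fin ltW.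
rewrite ge0_integralD; [|by []|by move=> z _; rewrite mule_ge0
  |exact: emeasurable_funM|by move=> z _; rewrite mule_ge0
  |exact: emeasurable_funM].
rewrite !ge0_integralZl//.
rewrite !integral_gauss_density// !mule1 -EFinD lee_fin [leRHS]splitr lerD2l.
rewrite (@le_trans _ _ ((C + 1) * t))//; first by rewrite ler_wpM2r ?lerDl// ltW.
by rewrite mulrC -ler_pdivlMr ?ltW// ltr_wpDl.
Qed.

Lemma cvg_heat_sqcontinuous f w : bm f -> sqcontinuous f ->
  heat t f w @[t --> 0^'+] --> f w.
Proof.
move=> bf cf; apply/subr_cvg0 => /=.
have bfw : bm (fun z => f (w - z) - f w).
  by apply: bmB; [exact: bm_shift|exact: bm_cst].
have : \int[gauss_measure t]_z (f (w - z) - f w) @[t --> 0^'+] --> 0.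
  apply: gauss_approximate_identity => //.
  by apply/subr_cvg0; exact: cf.
apply: cvg_trans; apply: near_eq_cvg; apply: nbhs_right0P; exists 1 => // t t0 _.
rewrite RintegralB//; [|exact/bm_integrable/bm_shift|exact: (bm_integrable t (bm_cst (f w)))].
congr (_ - _); exact: (heat_cst (f w) w t0).
Qed.

(** The difference is the Gaussian integral of [f (w - z) * (g w - g (w - z))]. This tends to 0 with
    [z] because [g] is continuous, however irregular [f] is. *)
Lemma cvg_heat_commutator f g w : bm f -> bm g -> sqcontinuous g ->
  heat t f w * g w - heat t (fun z => f z * g z) w @[t --> 0^'+] --> 0.
Proof.
move=> bf bg cg.
have bfw := bm_shift w bf; have bgw := bm_shift w bg.
have b1 : bm (fun z => f (w - z) * (g w - g (w - z))).
  by apply: bmM => //; apply: bmB => //; exact: bm_cst.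
have : \int[gauss_measure t]_z (f (w - z) * (g w - g (w - z))) @[t --> 0^'+] --> 0.
  apply: gauss_approximate_identity => //.
  have [_ [M fM]] := bf.
  have h : M * `|g w - g (w - z)| @[z --> sqnbhs0] --> 0.
    rewrite -[X in _ --> X](mulr0 M); apply: cvgM; first exact: cvg_cst.
    apply/norm_cvg0P; rewrite -[X in _ --> X](subrr (g w)).
    by apply: cvgB; [exact: cvg_cst|exact: cg].
  apply: (@cvg0_dominated _ _ _ _ _ (fun z => M * `|g w - g (w - z)|)) => //.
  by move=> z; rewrite normrM ler_wpM2r.
apply: cvg_trans; apply: near_eq_cvg; apply: nearW => t /=.
under eq_Rintegral do rewrite mulrBr.
rewrite RintegralB//; last 2 first.
- apply/bm_integrable; apply: bmM => //; exact: bm_cst.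
- exact/bm_integrable/bmM.
by rewrite RintegralZr//; exact/bm_integrable.
Qed.

End heat.

(** * Bounded limits and the monotone class argument *)

Section ae_convergence.
Context {R : realType} {n : nat}.
Implicit Types (f g : 'rV[R[i]]_n -> R) (t : R) (w z : 'rV[R[i]]_n).

Local Notation bm := bounded_measurable.

Definition ae_heat_cvg f :=
  {ae lebesgue_Cn n, forall w, heat t f w @[t --> 0^'+] --> f w}.

(** Three errors of size [l] and one maximal bound, added up in [bounded_cvg_ae_heat_cvg]. *)
Let C : R := 3 + 2 ^+ (2 * n).+1.

Let C0 : 0 < C. Proof. by rewrite ltr_wpDr// exprn_ge0. Qed.

Let negligible_inf (A : set 'rV[R[i]]_n) (a : nat -> \bar R) :
  a @ \oo --> 0%E ->
  (forall k, exists G, [/\ measurable G, (lebesgue_Cn n G <= a k)%E & A `<=` G]) ->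
  (lebesgue_Cn n).-negligible A.
Proof.
move=> a0 /choice[G GP]; exists (\bigcap_k G k); split.
- by apply: bigcap_measurable => // k _; case: (GP k).
- apply/eqP; rewrite eq_le measure_ge0 andbT.
  apply: (cvge_to_ge a0); apply: nearW => k; have [mG Ga _] := GP k.
  rewrite (le_trans _ Ga)//; apply: le_measure; rewrite ?inE//.
    by apply: bigcap_measurable => // j _; case: (GP j).
  by move=> w; apply.
- by move=> w Aw k _; have [_ _] := GP k; apply.
Qed.

(** The error [heat t f w - f w] is compared with that of [F k], which vanishes in the limit for
    almost every [w]. The heat transforms of [|F k - f|] that remain are controlled, up to a weight,
    by the maximal inequality, off a set whose measure tends to 0 as [k] grows. *)
Lemma bounded_cvg_ae_heat_cvg (F : nat -> 'rV[R[i]]_n -> R) f (M : R) :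
  (forall k, measurable_fun setT (F k)) -> (forall k z, `|F k z| <= M) ->
  (forall z, F k z @[k --> \oo] --> f z) ->
  (forall k, ae_heat_cvg (F k)) -> bm f /\ ae_heat_cvg f.
Proof.
move=> mF FM Ff aeF.
have bF k : bm (F k) by split => //; exists M.
have fM z : `|f z| <= M.
  have h : `|F k z| @[k --> \oo] --> `|f z| by apply: cvg_norm; exact: Ff.
  rewrite -(cvg_lim _ h)//; apply: limr_le; first exact: cvgP h.
  exact: nearW.
have mf : measurable_fun setT f.
  by apply: (measurable_fun_cvg mF) => z _; exact: Ff.
have bf : bm f by split => //; exists M.
split => //.
(* The errors [e k] below are bounded but need not be integrable; with this weight their integrals
   tend to 0, by dominated convergence in [gauss_measure 1]. *)
pose phi := gauss_density (1 : R) : 'rV[R[i]]_n -> R.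
have phi0 z : 0 < phi z by apply: gauss_density_gt0.
have bphi : bm phi by apply: bm_gauss.
pose e k z := `|F k z - f z|.
have be k : bm (e k) by exact: (bm_norm (bmB (bF k) bf)).
have e0 k z : 0 <= e k z by exact: normr_ge0.
pose r k z := e k z * phi z.
have br k : bm (r k) by exact: (bmM (be k) bphi).
have r0 k z : 0 <= r k z by rewrite mulr_ge0// ltW.
have intr : (\int[lebesgue_Cn n]_z (r k z)%:E)%E @[k --> \oo] --> 0%E.
  have [|||||_ h _] := @dominated_convergence _ _ _ (gauss_measure (1 : R))
    setT measurableT (fun k z => (F k z)%:E) (fun z => (f z)%:E) (cst M%:E).
  - by move=> k; exact/measurable_EFinP.
  - exact/measurable_EFinP.
  - by apply: aeW => z _; apply: cvg_EFin; [exact: nearW|exact: Ff].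
  - by have := bm_integrable 1 (bm_cst M).
  - by apply: aeW => z k _; rewrite /= lee_fin.
  apply: cvg_trans h; apply: near_eq_cvg; apply: nearW => k /=.
  rewrite integral_gauss_measure; [by []| |by move=> z; rewrite lee_fin].
  by apply/measurable_EFinP; case: (be k).
(* For each [k], the bad set is covered by the exceptional set of the maximal inequality for [r k]
   and the null set off which the heat transforms of [F k] converge. The measure of this cover is at
   most the integral of [r k] divided by [l]. *)
have key (l : R) : 0 < l -> (lebesgue_Cn n).-negligible
    [set w | ~ \forall t \near 0^'+, `|heat t f w - f w| * phi w <= C * l].
  move=> l0; apply: (negligible_inf (a := fun k =>
      ((l^-1)%:E * \int[lebesgue_Cn n]_z (r k z)%:E)%E)).
    by rewrite -[X in _ --> X](mule0 (l^-1)%:E); apply: cvgeZl.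
  move=> k.
  have [N [mN N0 subN]] := aeF k.
  have [||||G [mG Gl GP]] := @heat_maximal R n (EFin \o r k) l => //.
    by apply/measurable_EFinP; case: (br k).
    by move=> z; rewrite lee_fin.
    have <- : (\int[gauss_measure (1 : R)]_z (e k z)%:E =
        \int[lebesgue_Cn n]_z (EFin \o r k) z)%E.
      rewrite integral_gauss_measure; [by []| |by move=> z; rewrite lee_fin].
      by apply/measurable_EFinP; case: (be k).
    by apply: integrable_lty => //; exact: (bm_integrable 1 (be k)).
  exists (G `|` N); split; first exact: measurableU.
    rewrite lee_pdivlMl// (le_trans _ Gl)// lee_pmul2l ?lte_fin//.
    by rewrite (le_trans (measureU2 _ _ _))// [X in (_ + X)%E](N0 : lebesgue_Cn n N = 0%E) adde0.
  move=> w /= Bw; apply: contrapT => GN; apply: Bw.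
  have {}/GP[rl rt] : ~ G w by move=> ?; apply: GN; left.
  have cw : heat t (F k) w @[t --> 0^'+] --> F k w.
    by apply: contrapT => h; apply: GN; right; apply: subN.
  have h1 : \forall t \near 0^'+, `|heat t (F k) w - F k w| * phi w <= l.
    have : (heat t (F k) w - F k w) * phi w @[t --> 0^'+] --> 0.
      rewrite -[X in _ --> X](mul0r (phi w)); apply: cvgM; last exact: cvg_cst.
      by apply/subr_cvg0; exact: cw.
    move=> /cvgr0Pnorm_le /(_ _ l0); apply: filterS => t.
    by rewrite normrM (ger0_norm (ltW (phi0 w))).
  (* The commutator moves [phi] inside the heat transform, where the maximal inequality for [r k]
     applies. *)
  have h2 : \forall t \near 0^'+,
      `|heat t (e k) w * phi w - heat t (r k) w| <= l.
    have := cvg_heat_commutator w (be k) bphi (@sqcontinuous_gauss_density R n 1).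
    by move=> /cvgr0Pnorm_le /(_ _ l0).
  have h3 : \forall t \near 0^'+, heat t (r k) w <= 2 ^+ (2 * n).+1 * l.
    apply: nbhs_right0P; exists 1 => // t t0 t1.
    by rewrite -lee_fin heat_heatE// rt// ltW.
  near=> t.
  have t0 : 0 < t by near: t; exact: nbhs_right_gt.
  have g1 : `|heat t (F k) w - F k w| * phi w <= l by near: t.
  have g2 : `|heat t (e k) w * phi w - heat t (r k) w| <= l by near: t.
  have g3 : heat t (r k) w <= 2 ^+ (2 * n).+1 * l by near: t.
  have h4 : e k w * phi w <= l by rewrite -lee_fin.
  have h5 : `|heat t f w - f w| <= `|heat t (F k) w - F k w| + heat t (e k) w + e k w.
    rewrite (_ : heat t f w - f w = (heat t (F k) w - F k w)
      - heat t (fun z => F k z - f z) w + (F k w - f w)); last first.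
      by rewrite heatB//; ring.
    rewrite (le_trans (ler_normD _ _))// lerD// (le_trans (ler_normB _ _))// lerD2l.
    by apply: le_norm_heat; exact: bmB.
  have h6 : heat t (e k) w * phi w <= l + heat t (r k) w.
    by rewrite -lerBlDr (le_trans (ler_norm _)).
  have := ler_wpM2r (ltW (phi0 w)) h5; rewrite !mulrDl => h7.
  rewrite (le_trans h7)// /C; lra.
(* Countably many thresholds suffice: at a fixed [w] the weight [phi w] is a positive constant and
   can be divided out. *)
have : (lebesgue_Cn n).-negligible (\bigcup_m
    [set w | ~ \forall t \near 0^'+, `|heat t f w - f w| * phi w <= C * m.+1%:R^-1]).
  by apply: negligible_bigcup => m; apply: key.
apply: negligibleS => w /= ncv; apply: contrapT => nB; apply: ncv.
apply/subr_cvg0/cvgr0Pnorm_le => d d0.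
have a0 : 0 < d * phi w / C by rewrite divr_gt0// mulr_gt0.
pose m := Num.truncn (d * phi w / C)^-1.
have hm : m.+1%:R^-1 <= d * phi w / C.
  by rewrite invf_ple ?posrE// ltW// truncnS_gt.
have : \forall t \near 0^'+, `|heat t f w - f w| * phi w <= C * m.+1%:R^-1.
  by apply: contrapT => h; apply: nB; exists m.
apply: filterS => t h.
rewrite -(ler_pM2r (phi0 w)) (le_trans h)// mulrC -ler_pdivlMr//.
Unshelve. all: by end_near. Qed.

Lemma ae_heat_cvg_sqcontinuous f : bm f -> sqcontinuous f -> ae_heat_cvg f.
Proof. by move=> bf cf; apply: aeW => w; exact: cvg_heat_sqcontinuous. Qed.

Lemma ae_heat_cvgD f g : bm f -> bm g -> ae_heat_cvg f -> ae_heat_cvg g ->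
  ae_heat_cvg (fun z => f z + g z).
Proof.
move=> bf bg af ag; apply: filterS2 af ag => w hf hg.
rewrite (_ : (fun t => _) = fun t => heat t f w + heat t g w); first exact: cvgD.
by apply/funext => t; rewrite heatD.
Qed.

Lemma ae_heat_cvgZ c f : bm f -> ae_heat_cvg f -> ae_heat_cvg (fun z => c * f z).
Proof.
move=> bf; apply: filterS => w hf.
rewrite (_ : (fun t => _) = fun t => c * heat t f w).
  by apply: cvgM => //; exact: cvg_cst.
by apply/funext => t; rewrite heatZ.
Qed.

Let bm_indic (A : set 'rV[R[i]]_n) : measurable A -> bm (\1_A).
Proof.
move=> mA; split; first exact: measurable_indic.
by exists 1 => z; rewrite indicE; case: (_ \in _); rewrite ?normr0 ?normr1.
Qed.

Let sqcontinuous_min f g : sqcontinuous f -> sqcontinuous g ->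
  sqcontinuous (fun z => Num.min (f z) (g z)).
Proof.
move=> cf cg w; rewrite minr_absE (_ : (fun z => _) = fun z =>
  (f (w - z) + g (w - z) - `|f (w - z) - g (w - z)|) / 2); last first.
  by apply/funext => z; rewrite minr_absE.
apply: cvgM; last exact: cvg_cst.
apply: cvgB; first by apply: cvgD; [exact: cf|exact: cg].
by apply: cvg_norm; apply: cvgB; [exact: cf|exact: cg].
Qed.

Let sqcontinuous_max0 f : sqcontinuous f ->
  sqcontinuous (fun z => Num.max (f z) 0).
Proof.
move=> cf w; rewrite maxr_absE (_ : (fun z => _) = fun z =>
  (f (w - z) + 0 + `|f (w - z) - 0|) / 2); last first.
  by apply/funext => z; rewrite maxr_absE.
apply: cvgM; last exact: cvg_cst.
apply: cvgD; first by apply: cvgD; [exact: cf|exact: cvg_cst].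
by apply: cvg_norm; apply: cvgB; [exact: cf|exact: cvg_cst].
Qed.

(** These sets play the role of open sets: minima give their intersections, and the indicator of
    such a set is the increasing limit of the continuous functions [min 1 (k * max g 0)]. *)
Let pos_set : set (set 'rV[R[i]]_n) :=
  [set A | exists g, [/\ measurable_fun setT g, sqcontinuous g & A = [set z | 0 < g z]]].

Let pos_setI : setI_closed pos_set.
Proof.
move=> A B [g [mg cg ->]] [h [mh ch ->]]; exists (fun z => Num.min (g z) (h z)); split.
- exact: measurable_minr.
- exact: sqcontinuous_min.
- apply/seteqP; split => z /=; first by move=> [? ?]; rewrite lt_min; apply/andP.
  by rewrite lt_min => /andP.
Qed.

Let pos_set_ae A : pos_set A -> measurable A /\ ae_heat_cvg \1_A.
Proof.
move=> [g [mg cg ->]]; set A0 := [set z | 0 < g z].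
have mA : measurable A0.
  rewrite -[A0]setTI (_ : A0 = g @^-1` `]0, +oo[); first exact: mg.
  by apply/seteqP; split => z /=; rewrite in_itv/= andbT.
split => //.
pose F (k : nat) z := Num.min 1 (k%:R * Num.max (g z) 0).
have F01 k z : 0 <= F k z <= 1.
  by rewrite /F le_min ge_min lexx ler01/= mulr_ge0// le_max lexx orbT.
have mF k : measurable_fun setT (F k).
  apply: measurable_minr; first exact: measurable_cst.
  apply: measurable_funM; first exact: measurable_cst.
  by apply: measurable_maxr => //; exact: measurable_cst.
have [] := @bounded_cvg_ae_heat_cvg F \1_A0 1 => //.
- by move=> k z; have /andP[? ?] := F01 k z; rewrite ger0_norm.
- move=> z; rewrite indicE; have [|] := boolP (z \in A0).
    rewrite inE /A0 /= => gz; apply: cvg_near_cst.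
    exists (Num.truncn (g z)^-1).+1 => // k /= hk.
    rewrite /F; apply/min_idPl; rewrite (max_idPl (ltW gz)).
    rewrite -ler_pdivrMr// div1r (le_trans (ltW (truncnS_gt _)))//.
    by rewrite ler_nat.
  rewrite notin_setE /A0 /= => /negP; rewrite -leNgt => gz.
  apply: cvg_near_cst; apply: nearW => k.
  by rewrite /F (max_idPr gz) mulr0 (min_idPr ler01).
- move=> k; apply: ae_heat_cvg_sqcontinuous.
    by split => //; exists 1 => z; have /andP[? ?] := F01 k z; rewrite ger0_norm.
  apply: sqcontinuous_min; first by move=> w; exact: cvg_cst.
  move=> w; apply: cvgM; first exact: cvg_cst.
  exact: sqcontinuous_max0.
Qed.

(** It suffices that the identity is measurable from the generated sigma-algebra, hence that the
    real and imaginary parts of the coordinates are. These are continuous, so their superlevel sets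
    belong to [pos_set]. *)
Let pos_set_generates (A : set 'rV[R[i]]_n) :
  measurable A -> <<s pos_set >> A.
Proof.
pose T := g_sigma_algebraType pos_set.
suff mid : measurable_fun [set: T] (id : T -> 'rV[R[i]]_n).
  by move=> mA; have := mid measurableT _ mA; rewrite setTI.
have msc g : measurable_fun setT g -> sqcontinuous g ->
    measurable_fun [set: T] (g : T -> R).
  move=> mg cg; apply: (measurability _ (RGenOInfty.measurableE R)).
  move=> _ [_ [a ->] <-]; rewrite setTI; apply: sub_gen_smallest.
  exists (fun z => g z - a); split.
  - by apply: measurable_funB => //; exact: measurable_cst.
  - by move=> w; apply: cvgB; [exact: cg|exact: cvg_cst].
  - by apply/seteqP; split => z /=; rewrite in_itv/= andbT subr_gt0.
apply: measurable_fun_rVP => j; apply/measurable_complexP; split.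
  apply: (msc (fun z => complex.Re (z ord0 j))).
    by apply: measurable_Re_comp; exact: measurable_rV_coord.
  by move=> w; exact: cvg_Re_coord_sqnbhs0.
apply: (msc (fun z => complex.Im (z ord0 j))).
  by apply: measurable_Im_comp; exact: measurable_rV_coord.
by move=> w; exact: cvg_Im_coord_sqnbhs0.
Qed.

(** Dynkin's theorem: proper differences follow from linearity, increasing unions from
    [bounded_cvg_ae_heat_cvg]. *)
Lemma ae_heat_cvg_indic (A : set 'rV[R[i]]_n) : measurable A -> ae_heat_cvg \1_A.
Proof.
suff H : <<s pos_set >> `<=` [set A | measurable A /\ ae_heat_cvg \1_A].
  by move=> /pos_set_generates/H[].
apply: lambda_system_subset => //; split => //=.
- split; first exact: measurableT.
  rewrite (_ : \1_setT = cst 1); last by apply/funext => z; rewrite indicT.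
  by apply: ae_heat_cvg_sqcontinuous; [exact: bm_cst|move=> w; exact: cvg_cst].
- move=> X Y YX [mX aX] [mY aY]; split; first exact: measurableD.
  rewrite (_ : \1_(X `\` Y) = fun z => \1_X z + (- 1) * \1_Y z); last first.
    apply/funext => z; rewrite !indicE in_setD; have [zB|zB] := boolP (z \in Y).
      rewrite (_ : z \in X) ?andbF ?mulN1r ?subrr//.
      by move: zB; rewrite !inE; exact: YX.
    by rewrite andbT mulr0 addr0.
  apply: ae_heat_cvgD => //; first exact: bm_indic.
    by apply: bmM; [exact: bm_cst|exact: bm_indic].
  by apply: ae_heat_cvgZ => //; exact: bm_indic.
- move=> F ndF FP; split; first by apply: bigcup_measurable => k _; case: (FP k).
  have [] := @bounded_cvg_ae_heat_cvg (fun k => \1_(F k)) \1_(\bigcup_k F k) 1 => //.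
  + by move=> k; apply: measurable_indic; case: (FP k).
  + by move=> k z; rewrite indicE; case: (_ \in _); rewrite ?normr0 ?normr1.
  + move=> z; rewrite indicE; have [|] := boolP (z \in \bigcup_k F k).
      rewrite inE => -[k _ Fkz]; apply: cvg_near_cst; exists k => // j /= kj.
      by rewrite indicE mem_set//; move/subsetPset : (ndF _ _ kj); apply.
    rewrite notin_setE => nF; apply: cvg_near_cst; apply: nearW => k.
    by rewrite indicE memNset// => Fkz; apply: nF; exists k.
  + by move=> k; case: (FP k).
Qed.

Import HBNNSimple.

Let ae_heat_cvg_nnsfun (h : {nnsfun 'rV[R[i]]_n >-> R}) : bm h /\ ae_heat_cvg h.
Proof.
have [s hs] : exists s : seq R,
    forall z, h z = \sum_(y <- s) y * \1_(h @^-1` [set y]) z.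
  eexists => z; rewrite fimfunE fsbig_finite; [reflexivity|exact: fimfunP].
rewrite (_ : (h : _ -> R) = fun z => \sum_(y <- s) y * \1_(h @^-1` [set y]) z);
  last exact/funext.
elim: s {hs} => [|y s [ih1 ih2]].
  rewrite (_ : (fun z => _) = cst 0); last by apply/funext => z; rewrite big_nil.
  split; first exact: bm_cst.
  by apply: ae_heat_cvg_sqcontinuous; [exact: bm_cst|move=> w; exact: cvg_cst].
rewrite (_ : (fun z => _) = fun z => y * \1_(h @^-1` [set y]) z +
  \sum_(y <- s) y * \1_(h @^-1` [set y]) z); last first.
  by apply/funext => z; rewrite big_cons.
have b1 : bm (\1_(h @^-1` [set y])) by exact: bm_indic.
have b2 : bm (fun z => y * \1_(h @^-1` [set y]) z).
  by apply: bmM => //; exact: bm_cst.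
split; first exact: bmD.
by apply: ae_heat_cvgD => //; apply: ae_heat_cvgZ => //; exact: ae_heat_cvg_indic.
Qed.

Theorem bounded_ae_heat_cvg f : bm f -> ae_heat_cvg f.
Proof.
have nonneg g : bm g -> (forall z, 0 <= g z) -> ae_heat_cvg g.
  move=> [mg [M gM]] g0.
  have mg' : measurable_fun setT (EFin \o g) by exact/measurable_EFinP.
  pose h := nnsfun_approx measurableT mg'.
  have hcv z : h k z @[k --> \oo] --> g z.
    have := @cvg_nnsfun_approx _ _ _ _ measurableT _ mg' _ z I.
    by move=> /(_ _)/fine_cvg; apply => // x _; rewrite lee_fin.
  have hg k z : h k z <= g z.
    rewrite -(cvg_lim _ (hcv z))//; apply: nondecreasing_cvgn_le.
      by move=> i j ij; exact/lefP/nd_nnsfun_approx.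
    exact: cvgP (hcv z).
  have [] := @bounded_cvg_ae_heat_cvg (fun k => h k) g M => //.
  - by move=> k z; rewrite ger0_norm// (le_trans (hg k z))// (le_trans (ler_norm _)).
  - by move=> k; case: (ae_heat_cvg_nnsfun (h k)).
move=> bf; have [mf [M fM]] := bf.
have M0 : 0 <= M by rewrite (le_trans _ (fM 0)).
(* Adding its bound makes [f] nonnegative, a limit of increasing simple functions. *)
have b1 : bm (fun z => f z + M) by apply: bmD => //; exact: bm_cst.
rewrite (_ : f = fun z => (f z + M) + cst (- M) z); last first.
  by apply/funext => z; rewrite addrK.
apply: ae_heat_cvgD => //; first exact: bm_cst.
  by apply: nonneg => // z; rewrite -lerBlDr sub0r; have := fM z; rewrite ler_norml => /andP[].
by apply: ae_heat_cvg_sqcontinuous; [exact: bm_cst|move=> w; exact: cvg_cst].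
Qed.

End ae_convergence.

(** * Holomorphic functions *)

Section complex_topology.
Context {R : realType}.
Implicit Types (z w : R[i]) (A : set R[i]).

(** The norm of [R[i]], and with it the radii of balls, takes values in [R[i]]; a positive element
    there is real, so real radii can replace them. *)
Lemma nbhs_cabsP z A :
  nbhs z A <-> exists2 d : R, 0 < d & forall w, cabs (w - z) < d -> A w.
Proof.
split.
  move=> /nbhs_normP[e /= e0 eA]; exists (complex.Re e).
    by move: e0; rewrite ltcE => /andP[].
  move=> w wz; apply: eA => /=.
  have -> : e = (complex.Re e)%:C.
    by apply: complex_ext => //=; move: e0; rewrite ltcE => /andP[/eqP->].
  by rewrite distrC norm_cabs ltcR.
move=> [d d0 dA]; apply/nbhs_normP; exists d%:C => /=; first by rewrite ltcR.
by move=> w /=; rewrite distrC norm_cabs ltcR => /dA.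
Qed.

Lemma cvg_cabsP T (F : set_system T) {FF : Filter F} (f : T -> R[i]) (l : R[i]) :
  f @ F --> l <-> forall e : R, 0 < e -> \forall x \near F, cabs (f x - l) <= e.
Proof.
split.
  move=> /cvgrPdist_le fl e e0; have e0' : 0 < e%:C by rewrite ltcR.
  apply: filterS (fl _ e0') => x; by rewrite distrC norm_cabs lecR.
move=> fl; apply/cvgrPdist_le => e e0.
have eE : e = (complex.Re e)%:C.
  by apply: complex_ext => //=; move: e0; rewrite ltcE => /andP[/eqP->].
have : 0 < complex.Re e by move: e0; rewrite ltcE => /andP[].
move=> /fl; apply: filterS => x; by rewrite distrC norm_cabs eE lecR.
Qed.

Lemma cvg_complexP T (F : set_system T) {FF : Filter F} (f : T -> R[i]) (l : R[i]) :
  f @ F --> l <-> complex.Re (f x) @[x --> F] --> complex.Re l /\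
                  complex.Im (f x) @[x --> F] --> complex.Im l.
Proof.
split.
  move=> /cvg_cabsP fl; split; apply/cvgrPdist_le => e /fl; apply: filterS => x.
    by apply: le_trans; rewrite distrC -Re_opp -Re_add Re_le_cabs.
  by apply: le_trans; rewrite distrC -Im_opp -Im_add Im_le_cabs.
move=> [/cvgrPdist_le fR /cvgrPdist_le fI]; apply/cvg_cabsP => e e0.
have e20 : 0 < e / 2 by rewrite divr_gt0.
near=> x; rewrite (le_trans (cabs_le_ReIm _))// [leRHS]splitr !ReImE lerD//.
  by rewrite distrC; near: x; exact: fR.
by rewrite distrC; near: x; exact: fI.
Unshelve. all: by end_near. Qed.

Lemma derivable_cabs (V : normedModType R[i]) (h : V -> R[i]) a v :
  derivable h a v ->
  exists c : R[i], forall e : R, 0 < e -> exists2 d : R, 0 < d &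
    forall x : R[i], cabs x < d ->
      cabs (h (a + x *: v) - h a - c * x) <= e * cabs x.
Proof.
move=> /cvg_ex[c /cvg_cabsP hc]; exists c => e /hc /nbhs_cabsP[d d0 dP].
exists d => // x xd; have [->|x0] := eqVneq x 0.
  by rewrite scale0r addr0 subrr mulr0 subr0 cabs0 mulr0.
have := dP x; rewrite subr0 => /(_ xd x0) /= => h1.
rewrite (_ : h (a + x *: v) - h a - c * x =
  (x^-1 *: (h (x *: v + a) - h a) - c) * x); last first.
  by rewrite mulrBl /GRing.scale/= mulrAC mulVf// mul1r (addrC a).
by rewrite cabsM ler_wpM2r// cabs_ge0.
Qed.

Lemma derivable_remainder (F : R[i] -> R[i]) a c (K : R) :
  (forall x, cabs x <= 1 -> cabs (F (a + x) - F a - c * x) <= K * cabs x ^+ 2) ->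
  derivable F a 1.
Proof.
move=> hK; apply/cvg_ex; exists c; apply/cvg_cabsP => e e0.
have K10 : 0 < `|K| + 1 by rewrite ltr_wpDl.
apply/nbhs_cabsP; exists (Num.min 1 (e / (`|K| + 1))).
  by rewrite lt_min ltr01 divr_gt0.
move=> x; rewrite subr0 lt_min => /andP[x1 xe] x0 /=.
have cx0 : 0 < cabs x by rewrite lt0r cabs_eq0 x0 cabs_ge0.
rewrite -(ler_pM2r cx0) -cabsM mulrBl /GRing.scale/= mulrAC mulVf// mul1r mulr1.
rewrite (addrC x) (le_trans (hK _ (ltW x1)))// expr2 mulrA ler_wpM2r ?cabs_ge0//.
rewrite (@le_trans _ _ ((`|K| + 1) * cabs x))//.
  by rewrite ler_wpM2r ?cabs_ge0// (le_trans (ler_norm K))// lerDl.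
by rewrite mulrC -ler_pdivlMr// ltW.
Qed.

Section differentiable_remainder.
Context {n : nat}.
Implicit Types u c : 'rV[R[i]]_n.

(** The Hermitian form is linear in its first argument only; the swap lets a partial application be
    declared linear. *)
Definition hdotl c u : R[i] := hdot u c.

Let hdotl_linear c : linear (hdotl c).
Proof. by move=> a u v; rewrite /hdotl hdotDl hdotZl. Qed.

HB.instance Definition _ c := GRing.isLinear.Build R[i] 'rV[R[i]]_n R[i] _
  (hdotl c) (hdotl_linear c).

Lemma sqnorm_le_norm u : sqnorm u <= n%:R * complex.Re `|u| ^+ 2.
Proof.
rewrite /sqnorm mulr_natl -[X in _ *+ X]card_ord -sumr_const.
apply: ler_sum => j _; rewrite lerXn2r ?nnegrE ?cabs_ge0//.
  by have : 0 <= `|u| by []; rewrite lecE => /andP[].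
have : `|u ord0 j| <= `|u|.
  rewrite [leRHS]/Num.norm/= mx_normE -[leLHS]nngE num_le.
  exact: (le_bigmax _ (fun ij : 'I_1 * 'I_n => `|u ij.1 ij.2|%:nng) (ord0, j)).
by rewrite norm_cabs lecE => /andP[].
Qed.

Lemma continuous_hdotl c : continuous (hdotl c).
Proof.
move=> u; rewrite /hdotl /hdot.
apply: (@cvg_big _ _ +%R 0 predT _ _ (nbhs u)) => [|j _].
  exact: add_continuous.
apply: cvgM; last exact: cvg_cst.
exact: coord_continuous.
Qed.

(** Turns quadratic bounds in the Euclidean norm, as obtained under the integral sign, into Fréchet
    differentiability for the maximum norm. *)
Lemma differentiable_remainder (h : 'rV[R[i]]_n -> R[i]) (z : 'rV[R[i]]_n) c (K : R) :
  (forall u, sqnorm u <= 1 ->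
    cabs (h (z + u) - h z - hdot u c) <= K * sqnorm u) ->
  differentiable h z.
Proof.
move=> hK.
have K0 : 0 <= `|K| by [].
have main (e : R[i]) : 0 < e -> \forall u \near (0 : 'rV[R[i]]_n),
    `|h (u + z) - (h z + hdotl c u)| <= e * `|u|.
  move=> e0.
  have eE : e = (complex.Re e)%:C.
    by apply: complex_ext => //=; move: e0; rewrite ltcE => /andP[/eqP->].
  have {}e0 : 0 < complex.Re e by move: e0; rewrite ltcE => /andP[].
  (* Since [sqnorm u] is at most [n + 1] times the squared maximum norm, the first bound gives
     [sqnorm u <= 1] and the second brings the remainder below [e] times the norm. The added 1 keeps
     the denominators positive for [n = 0] and [K = 0]. *)
  pose d := Num.min (n%:R + 1)^-1 (complex.Re e / ((`|K| + 1) * (n%:R + 1))).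
  have n0 : 0 < n%:R + 1 :> R by rewrite ltr_wpDl.
  have K10 : 0 < `|K| + 1 by rewrite ltr_wpDl.
  have d0 : 0 < d by rewrite lt_min invr_gt0 n0 divr_gt0// mulr_gt0.
  apply/nbhs_normP; exists d%:C => /=; first by rewrite ltcR.
  move=> u /=; rewrite sub0r normrN => ud.
  have nuE : `|u| = (complex.Re `|u|)%:C.
    apply: complex_ext => //=; have : 0 <= `|u| by [].
    by rewrite lecE => /andP[/eqP->].
  have nu0 : 0 <= complex.Re `|u| by have : 0 <= `|u| by []; rewrite lecE => /andP[].
  move: ud; rewrite nuE ltcR lt_min => /andP[ud1 ud2].
  have su : sqnorm u <= (n%:R + 1) * complex.Re `|u| ^+ 2.
    by rewrite (le_trans (sqnorm_le_norm u))// ler_wpM2r ?sqr_ge0// lerDl.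
  rewrite norm_cabs eE -rmorphM lecR /hdotl.
  rewrite opprD addrA (addrC u z).
  have nu1 : (n%:R + 1) * complex.Re `|u| <= 1.
    by rewrite mulrC -ler_pdivlMr// div1r ltW.
  have nu2 : complex.Re `|u| <= 1.
    by rewrite (le_trans _ nu1)// ler_peMl// lerDr.
  rewrite (le_trans (hK u _))//.
    by rewrite (le_trans su)// expr2 mulrA -[leRHS]mulr1 ler_pM// mulr_ge0// ltW.
  rewrite (@le_trans _ _ ((`|K| + 1) * sqnorm u))//.
    by rewrite ler_wpM2r ?sqnorm_ge0// (le_trans (ler_norm K))// lerDl.
  rewrite (le_trans (ler_wpM2l (ltW K10) su))// expr2 !mulrA ler_wpM2r//.
  by rewrite mulrC -ler_pdivlMr ?mulr_gt0// ltW.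
have {}main := (@eqaddoP R[i] 'rV[R[i]]_n R[i] 'rV[R[i]]_n (nbhs_filter_on (0 : 'rV[R[i]]_n))
  (h \o shift z) (cst (h z) + hdotl c) id).2 main.
apply/diff_locallyP; rewrite (diff_unique (@continuous_hdotl c) main).
by split => //; exact: continuous_hdotl.
Qed.

End differentiable_remainder.

End complex_topology.

(** * The complex exponential and its quadratic remainder *)

Section complex_exponential.
Context {R : realType}.
Implicit Types (z w b : R[i]) (x y : R).

Definition cexp z : R[i] :=
  (expR (complex.Re z) * cos (complex.Im z)) +i*
  (expR (complex.Re z) * sin (complex.Im z)).

Lemma Re_cexp z : complex.Re (cexp z) = expR (complex.Re z) * cos (complex.Im z).
Proof. by []. Qed.

Lemma Im_cexp z : complex.Im (cexp z) = expR (complex.Re z) * sin (complex.Im z).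
Proof. by []. Qed.

Lemma cexpD z w : cexp (z + w) = cexp z * cexp w.
Proof.
by apply: complex_ext; rewrite !ReImE !Re_cexp !Im_cexp !ReImE expRD ?cosD ?sinD; ring.
Qed.

Lemma cexp0 : cexp 0 = 1.
Proof.
by apply: complex_ext; rewrite ?Re_cexp ?Im_cexp/= expR0 ?cos0 ?sin0 ?mulr1 ?mulr0.
Qed.

Lemma cexp_conj z : (cexp z)^* = cexp (z^*).
Proof.
apply: complex_ext; rewrite !ReImE ?Re_cexp ?Im_cexp !ReImE ?cosN ?sinN//.
by rewrite mulrN.
Qed.

Lemma cabs_cexp z : cabs (cexp z) = expR (complex.Re z).
Proof.
rewrite cabsE Re_cexp Im_cexp !exprMn -mulrDr cos2Dsin2 mulr1.
by rewrite sqrtr_sqr ger0_norm// expR_ge0.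
Qed.

Lemma cexp_real x : cexp x%:C = (expR x)%:C.
Proof.
by apply: complex_ext; rewrite ?Re_cexp ?Im_cexp/= ?cos0 ?sin0 ?mulr1 ?mulr0.
Qed.

Lemma measurable_cexp d (T : measurableType d) (f : T -> R[i]) :
  measurable_fun setT f -> measurable_fun setT (fun s => cexp (f s)).
Proof.
move=> mf; have mRe := measurable_Re_comp mf; have mIm := measurable_Im_comp mf.
have mexp : measurable_fun setT (@expR R) by [].
have mcos : measurable_fun setT (@cos R).
  by apply: continuous_measurable_fun; exact: continuous_cos.
have msin : measurable_fun setT (@sin R).
  by apply: continuous_measurable_fun; exact: continuous_sin.
apply/measurable_complexP; split.
  rewrite (_ : _ \o _ = fun s => expR (complex.Re (f s)) * cos (complex.Im (f s))).
    by apply: measurable_funM; exact: measurableT_comp.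
  by [].

rewrite (_ : _ \o _ = fun s => expR (complex.Re (f s)) * sin (complex.Im (f s))).
  by apply: measurable_funM; exact: measurableT_comp.
by [].
Qed.

Lemma MVT_is_derive (f df : R -> R) (a b : R) : a <= b ->
  (forall x, is_derive x (1 : R) f (df x)) ->
  exists2 c, a <= c <= b & f b - f a = df c * (b - a).
Proof.
move=> ab fdf; have [] := @MVT_segment R f df a b ab.
- apply: continuous_subspaceT => x; apply/differentiable_continuous/derivable1_diffP.
  exact: (@ex_derive _ _ _ _ _ _ _ (fdf x)).
- by move=> c; rewrite in_itv/= => hc he; exists c.
Qed.

Let MVT0 (f df : R -> R) y : (forall x, is_derive x (1 : R) f (df x)) ->
  exists2 c, `|c| <= `|y| & f y - f 0 = df c * y.
Proof.
move=> fdf; have [y0|y0] := leP 0 y.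
  have [c /andP[c0 cy] ->] := MVT_is_derive y0 fdf.
  by exists c; rewrite ?subr0// !ger0_norm.
have [c /andP[yc c0] e] := MVT_is_derive (ltW y0) fdf.
exists c; first by rewrite !ler0_norm ?lerN2// ltW.
by rewrite -opprB e sub0r mulrN opprK.
Qed.

Let sin_le y : `|sin y| <= `|y|.
Proof.
have [c _] := MVT0 y (fun x => is_derive_sin x).
by rewrite sin0 subr0 => ->; rewrite normrM ler_piMl// cos_max.
Qed.

Let cosB1_le y : `|cos y - 1| <= `|y| /\ `|cos y - 1| <= y ^+ 2.
Proof.
have [c cy] := MVT0 y (fun x => is_derive_cos x).
rewrite cos0 => ->; rewrite normrM normrN -[y ^+ 2]real_normK ?num_real// expr2.
by rewrite ler_piMl ?sin_max// ler_pM// (le_trans (sin_le c)).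
Qed.

Let sinBid_le y : `|sin y - y| <= y ^+ 2.
Proof.
have d (s : R) : is_derive s (1 : R) (fun x => sin x - x) (cos s - 1).
  by apply: is_deriveB.
have [c cy] := MVT0 y d; rewrite sin0 !subr0 => ->.
rewrite normrM -[leRHS]real_normK ?num_real// expr2 ler_wpM2r//.
by rewrite (le_trans (cosB1_le c).1).
Qed.

Let expRB1_le x : `|expR x - 1| <= `|x| * expR `|x|.
Proof.
have [c cx] := MVT0 x (fun x => is_derive_expR x).
rewrite expR0 => ->; rewrite normrM mulrC ler_wpM2l// ger0_norm ?expR_ge0//.
by rewrite ler_expR (le_trans (ler_norm _)).
Qed.

Let expRB1Bid_le x : `|expR x - 1 - x| <= x ^+ 2 * expR `|x|.
Proof.
have d y : is_derive y (1 : R) (fun x => expR x - 1 - x) (expR y - 1).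
  rewrite -[X in is_derive _ _ _ (X - _)]subr0.
  by apply: is_deriveB.
have [c cx] := MVT0 x d; rewrite expR0 subrr !subr0 => ->.
rewrite normrM mulrC -[x ^+ 2]real_normK ?num_real// expr2 -mulrA ler_wpM2l//.
rewrite (le_trans (expRB1_le c))// ler_pM ?expR_ge0//.
by rewrite ler_expR.
Qed.

(** The real and imaginary parts are split into two terms each, and the mean value theorem bounds
    every term by [cabs b ^+ 2 * expR (cabs b)]. A bound explicit in [b] is what differentiation
    under a Gaussian integral requires. *)
Lemma cexp_remainder b :
  cabs (cexp b - 1 - b) <= 4 * cabs b ^+ 2 * expR (cabs b).
Proof.
set x := complex.Re b; set y := complex.Im b; set r := cabs b.
have xr : `|x| <= r by exact: Re_le_cabs.
have yr : `|y| <= r by exact: Im_le_cabs.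
have r0 : 0 <= r by exact: cabs_ge0.
have er0 : 0 <= expR r by exact: expR_ge0.
have exr : expR x <= expR r by rewrite ler_expR (le_trans (ler_norm x)).
have eaxr : expR `|x| <= expR r by rewrite ler_expR.
have y2 : y ^+ 2 <= r ^+ 2 by rewrite -[y ^+ 2]real_normK ?num_real// lerXn2r ?nnegrE.
have x2 : x ^+ 2 <= r ^+ 2 by rewrite -[x ^+ 2]real_normK ?num_real// lerXn2r ?nnegrE.
rewrite (le_trans (cabs_le_ReIm _))//.
have -> : complex.Re (cexp b - 1 - b) = expR x * (cos y - 1) + (expR x - 1 - x).
  by rewrite !ReImE Re_cexp/= -/x -/y; ring.
have -> : complex.Im (cexp b - 1 - b) = expR x * (sin y - y) + y * (expR x - 1).
  by rewrite !ReImE Im_cexp/= -/x -/y; ring.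
have h1 : `|expR x * (cos y - 1)| <= r ^+ 2 * expR r.
  rewrite normrM mulrC [X in _ * X]ger0_norm ?expR_ge0//.
  by apply: ler_pM => //; exact: le_trans (cosB1_le y).2 y2.
have h2 : `|expR x - 1 - x| <= r ^+ 2 * expR r.
  apply: (le_trans (expRB1Bid_le x)).
  by apply: ler_pM; rewrite ?sqr_ge0 ?expR_ge0.
have h3 : `|expR x * (sin y - y)| <= r ^+ 2 * expR r.
  rewrite normrM mulrC [X in _ * X]ger0_norm ?expR_ge0//.
  by apply: ler_pM => //; exact: le_trans (sinBid_le y) y2.
have h4 : `|y * (expR x - 1)| <= r ^+ 2 * expR r.
  rewrite normrM expr2 -mulrA; apply: ler_pM => //.
  by apply: (le_trans (expRB1_le x)); apply: ler_pM; rewrite ?expR_ge0.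
rewrite (_ : 4 * _ * _ = (r ^+ 2 * expR r + r ^+ 2 * expR r)
  + (r ^+ 2 * expR r + r ^+ 2 * expR r)); last by ring.
by rewrite lerD// (le_trans (ler_normD _ _))// lerD.
Qed.

Lemma derivable_cexpZ c z : derivable (fun w => cexp (c * w)) z 1.
Proof.
apply: (@derivable_remainder _ _ _ (cexp (c * z) * c)
  (cabs (cexp (c * z)) * (4 * cabs c ^+ 2 * expR (cabs c)))) => x x1.
rewrite mulrDr cexpD (_ : _ - _ - _ = cexp (c * z) * (cexp (c * x) - 1 - c * x)); last by ring.
rewrite cabsM -!mulrA ler_wpM2l ?cabs_ge0//.
rewrite (le_trans (cexp_remainder _))// cabsM exprMn.
rewrite [leRHS](_ : _ = 4 * (cabs c ^+ 2 * cabs x ^+ 2) * expR (cabs c)); last by ring.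
apply: ler_wpM2l; first by rewrite !mulr_ge0 ?cabs_ge0.
by rewrite ler_expR ler_piMr ?cabs_ge0.
Qed.

Lemma derivable_cexp z : derivable cexp z 1.
Proof.
rewrite (_ : cexp = fun w => cexp (1 * w)); first exact: derivable_cexpZ.
by apply/funext => w; rewrite mul1r.
Qed.

End complex_exponential.

(** * Cauchy's theorem on rectangles *)

Section goursat.
Context {R : realType}.

Lemma MVT_gt (f df : R -> R) (a0 a b : R) : a0 < a -> a <= b ->
  (forall x, a0 < x -> is_derive x (1 : R) f (df x)) ->
  exists2 c, a <= c <= b & f b - f a = df c * (b - a).
Proof.
move=> a0a ab fdf; have := @MVT_segment R f df a b ab.
case.
- by move=> x; rewrite in_itv/= => /andP[ax _]; apply: fdf; exact: lt_trans ax.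
- apply: derivable_within_continuous => x; rewrite in_itv/= => /andP[ax _].
  exact: (@ex_derive _ _ _ _ _ _ _ (fdf x (lt_le_trans a0a ax))).
- by move=> c; rewrite in_itv/= => hc he; exists c.
Qed.

(** The point is the supremum of the left ends, which every right end bounds from above. *)
Lemma nested_point (a : nat -> R) (w : R) : 0 <= w ->
  (forall k, a k <= a k.+1 /\ a k.+1 + w / 2 ^+ k.+1 <= a k + w / 2 ^+ k) ->
  exists x, forall k, a k <= x <= a k + w / 2 ^+ k.
Proof.
move=> w0 ha.
have le_a j k : (j <= k)%N -> a j <= a k.
  move=> /subnKC <-; elim: (k - j)%N => [|m ih]; first by rewrite addn0.
  by rewrite addnS (le_trans ih)// (ha _).1.
have le_b j k : (j <= k)%N -> a k + w / 2 ^+ k <= a j + w / 2 ^+ j.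
  move=> /subnKC <-; elim: (k - j)%N => [|m ih]; first by rewrite addn0.
  by rewrite addnS (le_trans _ ih)// (ha _).2.
have wk k : 0 <= w / 2 ^+ k by rewrite divr_ge0// exprn_ge0.
have ab j k : a j <= a k + w / 2 ^+ k.
  rewrite (@le_trans _ _ (a (maxn j k)))//; first by rewrite le_a// leq_maxl.
  rewrite (@le_trans _ _ (a (maxn j k) + w / 2 ^+ (maxn j k)))//; first by rewrite lerDl.
  by rewrite le_b// leq_maxr.
exists (sup (range a)) => k; apply/andP; split.
  apply: ub_le_sup; last by exists k.
  by exists (a 0%N + w / 2 ^+ 0%N) => _ [j _ <-].
by apply: ge_sup; [exists (a 0%N), 0%N|move=> _ [j _ <-]].
Qed.

(** For [W = A - B], with [A] an antiderivative in [y] of the real part of a function and [B] one in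
    [x] of its imaginary part, this is the imaginary part of its contour integral around the
    rectangle. *)
Definition rect_diff (W : R -> R -> R) (a b c d : R) : R :=
  W b d - W b c - W a d + W a c.

(* An additive rectangle function that is o(diam^2) at every point vanishes:
   Goursat's bisection. *)
Lemma rect_diff_eq0 (W : R -> R -> R) (a b c d : R) : a <= b -> c <= d ->
  (forall x0 y0 e, a <= x0 <= b -> c <= y0 <= d -> 0 < e ->
    exists2 m, 0 < m & forall a' b' c' d', a <= a' -> a' <= x0 <= b' ->
      c <= c' -> c' <= y0 <= d' -> b' - a' + (d' - c') < m ->
      `|rect_diff W a' b' c' d'| <= e * (b' - a' + (d' - c')) ^+ 2) ->
  rect_diff W a b c d = 0.
Proof.
move=> ab cd hloc; apply/eqP; rewrite -normr_eq0 eq_le normr_ge0 andbT leNgt.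
apply/negP => K0; set K := `|_| in K0.
pose w := b - a; pose h := d - c.
have w0 : 0 <= w by rewrite subr_ge0.
have h0 : 0 <= h by rewrite subr_ge0.
(* The rectangle of generation [k] with lower left corner [p] keeps at least its share of the
   supposedly nonzero value. *)
pose bad (p : R * R) k := K / 4 ^+ k <=
  `|rect_diff W p.1 (p.1 + w / 2 ^+ k) p.2 (p.2 + h / 2 ^+ k)|.
pose nest (u : R) (x x' : R) k := x <= x' /\
  x' + u / 2 ^+ k.+1 <= x + u / 2 ^+ k.
have half u k : u / 2 ^+ k = u / 2 ^+ k.+1 + u / 2 ^+ k.+1 :> R.
  by rewrite exprS; field; rewrite expf_neq0.
(* If all four quarters were below [K / 4 ^+ k.+1], their sum would be below [K / 4 ^+ k]. The
   premise sits under the existential so that choice yields a total function. *)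
have step p k : exists q, bad p k ->
    [/\ bad q k.+1, nest w p.1 q.1 k & nest h p.2 q.2 k].
  case: (pselect (bad p k)) => [badp|nb]; last by exists p.
  set w' := w / 2 ^+ k.+1; set h' := h / 2 ^+ k.+1.
  have w'0 : 0 <= w' by rewrite divr_ge0// exprn_ge0.
  have h'0 : 0 <= h' by rewrite divr_ge0// exprn_ge0.
  have nw0 x : nest w x x k.
    by split => //; rewrite (half w k) -/w' addrA lerDl.
  have nw1 x : nest w x (x + w') k.
    by split; rewrite ?lerDl// (half w k) -/w' addrA.
  have nh0 x : nest h x x k.
    by split => //; rewrite (half h k) -/h' addrA lerDl.
  have nh1 x : nest h x (x + h') k.
    by split; rewrite ?lerDl// (half h k) -/h' addrA.
  case: (pselect (bad p k.+1)) => [b1|b1]; first by exists p.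
  case: (pselect (bad (p.1 + w', p.2) k.+1)) => [b2|b2]; first by exists (p.1 + w', p.2).
  case: (pselect (bad (p.1, p.2 + h') k.+1)) => [b3|b3]; first by exists (p.1, p.2 + h').
  case: (pselect (bad (p.1 + w', p.2 + h') k.+1)) => [b4|b4].
    by exists (p.1 + w', p.2 + h').
  exfalso; move: badp b1 b2 b3 b4; rewrite /bad/= -/w' -/h' => badp.
  move=> /negP; rewrite -ltNge => b1 /negP; rewrite -ltNge => b2.
  move=> /negP; rewrite -ltNge => b3 /negP; rewrite -ltNge => b4.
  move: badp; apply/negP; rewrite -ltNge (half w k) (half h k) -/w' -/h' !addrA.
  have -> : rect_diff W p.1 (p.1 + w' + w') p.2 (p.2 + h' + h') =
      (rect_diff W p.1 (p.1 + w') p.2 (p.2 + h') +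
       rect_diff W (p.1 + w') (p.1 + w' + w') p.2 (p.2 + h')) +
      (rect_diff W p.1 (p.1 + w') (p.2 + h') (p.2 + h' + h') +
       rect_diff W (p.1 + w') (p.1 + w' + w') (p.2 + h') (p.2 + h' + h')).
    by rewrite /rect_diff; ring.
  have -> : K / 4 ^+ k = (K / 4 ^+ k.+1 + K / 4 ^+ k.+1) + (K / 4 ^+ k.+1 + K / 4 ^+ k.+1).
    by rewrite exprS; field; rewrite expf_neq0.
  rewrite (le_lt_trans (ler_normD _ _))// ltrD// (le_lt_trans (ler_normD _ _))// ltrD//.
have /choice[nxt nxtP] : forall pk : (R * R) * nat, exists q, bad pk.1 pk.2 ->
    [/\ bad q pk.2.+1, nest w pk.1.1 q.1 pk.2 & nest h pk.1.2 q.2 pk.2].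
  by case=> p k; exact: step.
pose s := fix s k : R * R := if k is j.+1 then nxt (s j, j) else (a, c).
have bads k : bad (s k) k.
  elim: k => [|k ih]; last by have [] := nxtP (s k, k) ih.
  by rewrite /bad/= !expr0 !divr1 /w /h !subrKC.
have [x0 x0P] := @nested_point (fun k => (s k).1) w w0
  (fun k => let: And3 _ H _ := nxtP (s k, k) (bads k) in H).
have [y0 y0P] := @nested_point (fun k => (s k).2) h h0
  (fun k => let: And3 _ _ H := nxtP (s k, k) (bads k) in H).
have sa k : a <= (s k).1.
  by elim: k => [//|k ih]; have [_ [+ _] _] := nxtP (s k, k) (bads k); exact: le_trans.
have sc k : c <= (s k).2.
  by elim: k => [//|k ih]; have [_ _ [+ _]] := nxtP (s k, k) (bads k); exact: le_trans.
pose L := w + h.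
have L0 : 0 <= L by rewrite addr_ge0.
(* A rectangle of generation [k] has half-perimeter [L / 2 ^+ k], so with this value the local bound
   at the limit point falls below [K / 4 ^+ k]. *)
have e0 : 0 < K / 2 / (L ^+ 2 + 1) by rewrite !divr_gt0// ltr_wpDl// sqr_ge0.
have x0ab : a <= x0 <= b.
  by have := x0P 0%N; rewrite /= expr0 divr1 /w subrKC.
have y0cd : c <= y0 <= d.
  by have := y0P 0%N; rewrite /= expr0 divr1 /h subrKC.
have [m m0 hm] := hloc _ _ _ x0ab y0cd e0.
have [k kP] : exists k, L / 2 ^+ k < m.
  exists (Num.truncn (L / m)).+1; rewrite ltr_pdivrMr ?exprn_gt0// mulrC -ltr_pdivrMr//.
  rewrite (lt_le_trans (truncnS_gt _))//.
  by rewrite -natrX ler_nat ltnW// ltn_expl.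
have := hm _ _ _ _ (sa k) (x0P k) (sc k) (y0P k).
rewrite !(addrC (_ k).1) !(addrC (_ k).2) !addrK -mulrDl -/L => /(_ kP).
rewrite (addrC _ (s k).1) (addrC _ (s k).2) => h1.
have := le_trans (bads k) h1; apply/negP; rewrite -ltNge.
rewrite expr_div_n -exprM mulnC exprM (_ : 2 ^+ 2 = 4 :> R); last by ring.
rewrite mulrA ltr_pM2r ?invr_gt0 ?exprn_gt0//.
rewrite mulrAC ltr_pdivrMr; last by rewrite ltr_wpDl// sqr_ge0.
have := sqr_ge0 L; nra.
Qed.

(** The first-order expansion of [G], with derivative [l], contributes [Re l] times the area to both
    [A] and [B], as in the Cauchy-Riemann equations, and cancels in [A - B]. The mean value theorem
    reduces the rest to the remainder at four points. The numbers [a0] and [c0] are the base points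
    of the antiderivatives, whose derivatives are known strictly beyond them. *)
Lemma rect_diff_holomorphic (G : R[i] -> R[i]) (A B : R -> R -> R) (a0 c0 a b c d : R) :
  (forall z, derivable G z 1) ->
  (forall x y, c0 < y -> is_derive y (1 : R) (A x) (complex.Re (G (x +i* y)))) ->
  (forall x y, a0 < x -> is_derive x (1 : R) (B ^~ y) (complex.Im (G (x +i* y)))) ->
  a0 < a -> a <= b -> c0 < c -> c <= d ->
  rect_diff (fun x y => A x y - B x y) a b c d = 0.
Proof.
move=> dG dA dB a0a ab c0c cd; apply: rect_diff_eq0 => // x0 y0 e /andP[ax0 _] /andP[cy0 _] e0.
have [l hl] := derivable_cabs (dG (x0 +i* y0)).
(* The four remainders, each at most [e / 4 * L], are paired on opposite sides and add up to at most
   [e / 2 * L ^+ 2]. *)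
have e20 : 0 < e / 4 by rewrite divr_gt0.
have [m m0 hm] := hl _ e20; exists m => // a' b' c' d' aa' /andP[a'x xb'] cc' /andP[c'y yd'] lm.
set L := b' - a' + (d' - c') in lm *.
have err x y : a' <= x <= b' -> c' <= y <= d' ->
    cabs (G (x +i* y) - G (x0 +i* y0) - l * ((x - x0) +i* (y - y0))) <= e / 4 * L.
  move=> /andP[h1 h2] /andP[h3 h4].
  have cl : cabs ((x - x0) +i* (y - y0)) <= L.
    rewrite (le_trans (cabs_le_ReIm _))//= lerD// ler_norml; lra.
  have := hm ((x - x0) +i* (y - y0)) (le_lt_trans cl lm).
  rewrite (_ : _ + _ *: 1 = x +i* y); last first.
    by rewrite /GRing.scale/= mulr1; apply: complex_ext => /=; ring.
  by move=> h; rewrite (le_trans h)// ler_wpM2l// ltW.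
have a'b' : a' <= b' by exact: le_trans xb'.
have c'd' : c' <= d' by exact: le_trans yd'.
have L0 : 0 <= L by rewrite addr_ge0// subr_ge0.
have a'in : a' <= a' <= b' by rewrite lexx.
have b'in : a' <= b' <= b' by rewrite lexx andbT.
have c'in : c' <= c' <= d' by rewrite lexx.
have d'in : c' <= d' <= d' by rewrite lexx andbT.
have [y yin eA] := @MVT_gt (fun v => A b' v - A a' v)
  (fun v => complex.Re (G (b' +i* v)) - complex.Re (G (a' +i* v))) c0 c' d'
  (lt_le_trans c0c cc') c'd' (fun v vc => is_deriveB (dA b' v vc) (dA a' v vc)).
have [x xin eB] := @MVT_gt (fun v => B v d' - B v c')
  (fun v => complex.Im (G (v +i* d')) - complex.Im (G (v +i* c'))) a0 a' b'
  (lt_le_trans a0a aa') a'b' (fun v vc => is_deriveB (dB v d' vc) (dB v c' vc)).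
have -> : rect_diff (fun x y => A x y - B x y) a' b' c' d' =
    (A b' d' - A a' d' - (A b' c' - A a' c')) - (B b' d' - B b' c' - (B a' d' - B a' c')).
  by rewrite /rect_diff; ring.
rewrite eA eB.
pose E x y := G (x +i* y) - G (x0 +i* y0) - l * ((x - x0) +i* (y - y0)).
have h1 : complex.Re (G (b' +i* y)) - complex.Re (G (a' +i* y)) =
    complex.Re l * (b' - a') + complex.Re (E b' y) - complex.Re (E a' y).
  by rewrite /E !ReImE/=; ring.
have h2 : complex.Im (G (x +i* d')) - complex.Im (G (x +i* c')) =
    complex.Re l * (d' - c') + complex.Im (E x d') - complex.Im (E x c').
  by rewrite /E !ReImE/=; ring.
rewrite h1 h2.
have e1 := le_trans (Re_le_cabs _) (err _ _ b'in yin).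
have e2 := le_trans (Re_le_cabs _) (err _ _ a'in yin).
have e3 := le_trans (Im_le_cabs _) (err _ _ xin d'in).
have e4 := le_trans (Im_le_cabs _) (err _ _ xin c'in).
rewrite -/(E b' y) in e1; rewrite -/(E a' y) in e2.
rewrite -/(E x d') in e3; rewrite -/(E x c') in e4.
rewrite (_ : _ - _ = (complex.Re (E b' y) - complex.Re (E a' y)) * (d' - c') -
   (complex.Im (E x d') - complex.Im (E x c')) * (b' - a')); last by ring.
rewrite (le_trans (ler_normB _ _))// !normrM.
have dc0 : 0 <= d' - c' by rewrite subr_ge0.
have ba0 : 0 <= b' - a' by rewrite subr_ge0.
rewrite (ger0_norm dc0) (ger0_norm ba0).
have f1 : `|complex.Re (E b' y) - complex.Re (E a' y)| <= e / 2 * L.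
  by rewrite (le_trans (ler_normB _ _))//; lra.
have f2 : `|complex.Im (E x d') - complex.Im (E x c')| <= e / 2 * L.
  by rewrite (le_trans (ler_normB _ _))//; lra.
rewrite (@le_trans _ _ (e / 2 * L * (d' - c') + e / 2 * L * (b' - a')))//.
  by rewrite lerD// ler_wpM2r.
rewrite -mulrDr (addrC (d' - c')) -/L expr2 mulrA ler_wpM2r// ler_wpM2r//.
by rewrite ler_pdivrMr// ler_peMr ?ltW//; lra.
Qed.

End goursat.

(** * Mean value property over the unit circle *)

Section mean_value.
Context {R : realType}.

Lemma continuous_antiderivative (f : R -> R) (a x : R) : continuous f -> a < x ->
  is_derive x (1 : R) (fun y => \int[lebesgue_measure]_(s in `[a, y]) f s) (f x).
Proof.
move=> cf ax; have x1 : x < x + 1 by rewrite ltrDl.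
have ix : lebesgue_measure.-integrable `[a, x + 1] (EFin \o f).
  apply: continuous_compact_integrable; first exact: segment_compact.
  exact: continuous_subspaceT.
have [dF F'] := continuous_FTC1_closed x1 ix ax (cf x).
by apply: DeriveDef => //; rewrite -derive1E.
Qed.

Lemma derivable_continuous_C (G : R[i] -> R[i]) z : derivable G z 1 ->
  {for z, continuous G}.
Proof. by move=> /derivable1_diffP/differentiable_continuous. Qed.

Lemma continuous_complex_pair (f g : R -> R) x :
  {for x, continuous f} -> {for x, continuous g} ->
  {for x, continuous (fun y => f y +i* g y)}.
Proof. by move=> cf cg; apply/cvg_complexP; split. Qed.

(** Under [cexp], the vertical segment of height [2 * pi] at abscissa [X] becomes the circle of
    radius [e^X]. Cauchy's theorem for [F \o cexp], with horizontal sides cancelling by periodicity,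
    makes the integral over it independent of [X], and the circles shrink to 0 as [X] tends to minus
    infinity. *)
Lemma circle_mean_value (F : R[i] -> R[i]) : (forall z, derivable F z 1) ->
  (\int[lebesgue_measure]_(s in `[0%R, (2 * pi)%R])
    (complex.Re (F (cexp (0 +i* s)%R)))%:E)%E = (2 * pi * complex.Re (F 0))%:E.
Proof.
move=> dF; pose G := F \o cexp.
have dG z : derivable G z 1.
  apply/derivable1_diffP; apply: differentiable_comp; apply/derivable1_diffP.
    exact: derivable_cexp.
  exact: dF.
have cG z : {for z, continuous G} by exact: derivable_continuous_C.
have cGy x : continuous (fun y => G (x +i* y)).
  move=> y; apply: continuous_comp; last exact: cG.
  by apply: continuous_complex_pair; [exact: cst_continuous|exact: cvg_id].
have cGx y : continuous (fun x => G (x +i* y)).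
  move=> x; apply: continuous_comp; last exact: cG.
  by apply: continuous_complex_pair; [exact: cvg_id|exact: cst_continuous].
have cRe x : continuous (fun y => complex.Re (G (x +i* y))).
  by move=> y; have /cvg_complexP[] := cGy x y.
have cIm y : continuous (fun x => complex.Im (G (x +i* y))).
  by move=> x; have /cvg_complexP[] := cGx y x.
(* The base point -1 lies strictly below the segment from 0 to [2 * pi], so that [A x] is
   differentiable at 0 too. *)
pose A (x y : R) : R := \int[lebesgue_measure]_(s in `[-1, y]) complex.Re (G (x +i* s)).
have dA (x y : R) : -1 < y -> is_derive y (1 : R) (A x) (complex.Re (G (x +i* y))).
  by move=> y1; exact: continuous_antiderivative.
have pi0 := pi_gt0 R.
have N10 : -1 < 0 :> R by rewrite oppr_lt0.
have pi20 : 0 <= 2 * pi :> R by rewrite mulr_ge0// ltW.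
have -> : (\int[lebesgue_measure]_(s in `[0%R, (2 * pi)%R])
    (complex.Re (F (cexp (0 +i* s)%R)))%:E)%E = (A 0 (2 * pi) - A 0 0)%:E.
  rewrite (@continuous_FTC2 _ _ (A 0)) ?mulr_gt0//.
  - by apply: continuous_subspaceT; exact: (cRe 0).
  - have dA0 (y : R) : -1 < y -> derivable (A 0) y 1.
      by move=> /(dA 0 y) h; exact: (@ex_derive _ _ _ _ _ _ _ h).
    have cA0 (y : R) : -1 < y -> {for y, continuous (A 0)}.
      by move=> /dA0 /derivable1_diffP/differentiable_continuous.
    split.
    + by move=> y; rewrite in_itv/= => /andP[y0 _]; apply: dA0; exact: lt_trans y0.
    + by apply: cvg_at_right_filter; exact: cA0.
    + by apply: cvg_at_left_filter; apply: cA0; exact: lt_le_trans pi20.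
  - move=> y; rewrite in_itv/= => /andP[y0 _].
    rewrite derive1E; have h := dA 0 y (lt_trans N10 y0).
    by rewrite (@derive_val _ _ _ _ _ _ _ h).

have const X : X < 0 -> exists y, A 0 (2 * pi) - A 0 0 =
    2 * pi * complex.Re (F (cexp (X +i* y))).
  move=> X0; pose B (x y : R) : R :=
    \int[lebesgue_measure]_(s in `[X - 1, x]) complex.Im (G (s +i* y)).
  have dB (x y : R) : X - 1 < x -> is_derive x (1 : R) (B ^~ y) (complex.Im (G (x +i* y))).
    by move=> xX; exact: (continuous_antiderivative (cIm y)).
  have Xl : X - 1 < X by rewrite ltrBlDr ltrDl.
  have := rect_diff_holomorphic dG dA dB Xl (ltW X0) N10 pi20.
  have Bper (x : R) : B x (2 * pi) = B x 0.
    apply: eq_Rintegral => s _; congr (complex.Im (F _)).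
    apply: complex_ext; rewrite ?Re_cexp ?Im_cexp/= mulr_natl.
      by rewrite cos2pi cos0.
    by rewrite sin2pi sin0.
  rewrite /rect_diff !Bper => e.
  (* The integral over the circle is [2 * pi] times the real part of [F] at one of its points, which
     avoids estimating an integral in the limit. *)
  have [y _ eA] := MVT_gt N10 pi20 (dA X).
  exists y; rewrite subr0 in eA.
  transitivity (A X (2 * pi) - A X 0); last by rewrite eA mulrC.
  by apply/eqP; rewrite -subr_eq0; apply/eqP; rewrite -[RHS]e; ring.
set I := A 0 (2 * pi) - A 0 0 in const *.
congr EFin; apply/eqP; rewrite -subr_eq0 -normr_eq0 eq_le normr_ge0 andbT leNgt.
apply/negP => K0; set K := `|_| in K0.
have [c hc] := derivable_cabs (dF 0); have [d d0 hd] := hc _ (@ltr01 R).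
pose C := cabs c + 1.
have C0 : 0 < C by rewrite ltr_wpDl// cabs_ge0.
(* A radius within which [F] moves by at most [C] times the distance to 0, below 1 so that [ln m] is
   negative, and small enough to contradict [K]. *)
pose m := Num.min (d / 2) (Num.min (1 / 2) (K / (4 * pi * C))).
have m0 : 0 < m by rewrite !lt_min !divr_gt0//= !mulr_gt0.
have [md m1 mK] : [/\ m < d, m < 1 & 2 * pi * (C * m) < K].
  split.
  - rewrite gt_min; apply/orP; left; lra.
  - by rewrite !gt_min; apply/orP; right; apply/orP; left; lra.
  - have : m <= K / (4 * pi * C) by rewrite !ge_min lexx !orbT.
    rewrite ler_pdivlMr ?mulr_gt0//; lra.
have lm0 : ln m < 0 by rewrite ln_lt0// m0.
have [y eI] := const (ln m) lm0.
set u := cexp (ln m +i* y) in eI.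
have um : cabs u = m by rewrite cabs_cexp/= lnK// posrE.
have := hd u; rewrite um add0r /GRing.scale/= mulr1 mul1r => /(_ md) hu.
have : `|complex.Re (F u) - complex.Re (F 0)| <= C * m.
  rewrite -Re_opp -Re_add (le_trans (Re_le_cabs _))//.
  rewrite -[F u - F 0](subrK (c * u)) (le_trans (cabs_add _ _))//.
  by rewrite cabsM um /C mulrDl mul1r addrC lerD2l.
move=> h; move: mK; apply/negP; rewrite -leNgt /K eI -mulrBr normrM.
by rewrite (ger0_norm pi20) ler_wpM2l.
Qed.

End mean_value.

(** * Complex integrals *)

Section complex_integral.
Context {R : realType} d {T : measurableType d}.
Variable mu : {measure set T -> \bar R}.
Implicit Types (f g : T -> R[i]) (c : R[i]).

Definition cintegrable f :=
  measurable_fun setT f /\ (\int[mu]_x (cabs (f x))%:E < +oo)%E.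

Lemma cintegrable_cabs f : cintegrable f ->
  mu.-integrable setT (fun x => (cabs (f x))%:E).
Proof.
move=> [mf foo]; apply/integrableP; split.
  by apply/measurable_EFinP; exact: measurable_cabs_comp.
by under eq_integral do rewrite gee0_abs ?lee_fin ?cabs_ge0//.
Qed.

Lemma le_cintegrable f (g : T -> R) : measurable_fun setT f ->
  mu.-integrable setT (EFin \o g) -> (forall x, cabs (f x) <= g x) -> cintegrable f.
Proof.
move=> mf ig fg; split => //.
have /integrableP[mg] := ig; apply: le_lt_trans; apply: ge0_le_integral => //.
- by move=> x _; rewrite lee_fin cabs_ge0.
- by apply/measurable_EFinP; exact: measurable_cabs_comp.
- exact: measurableT_comp.
- by move=> x _; rewrite /= lee_fin (le_trans (fg x))// ler_norm.
Qed.

Lemma cintegrable_Re f : cintegrable f ->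
  mu.-integrable setT (EFin \o (fun x => complex.Re (f x))).
Proof.
move=> cf; apply: (le_integrable _ _ _ (cintegrable_cabs cf)) => //.
  by apply/measurable_EFinP/measurable_Re_comp; case: cf.
by move=> x _; rewrite /= lee_fin (ger0_norm (cabs_ge0 _)) Re_le_cabs.
Qed.

Lemma cintegrable_Im f : cintegrable f ->
  mu.-integrable setT (EFin \o (fun x => complex.Im (f x))).
Proof.
move=> cf; apply: (le_integrable _ _ _ (cintegrable_cabs cf)) => //.
  by apply/measurable_EFinP/measurable_Im_comp; case: cf.
by move=> x _; rewrite /= lee_fin (ger0_norm (cabs_ge0 _)) Im_le_cabs.
Qed.

Lemma cintegrableD f g : cintegrable f -> cintegrable g ->
  cintegrable (fun x => f x + g x).
Proof.
move=> cf cg; apply: (@le_cintegrable _ (fun x => cabs (f x) + cabs (g x))).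
- by apply: measurable_complexD; [case: cf|case: cg].
- by have := integrableD measurableT (cintegrable_cabs cf) (cintegrable_cabs cg).
- by move=> x; exact: cabs_add.
Qed.

Lemma cintegrableZ c f : cintegrable f -> cintegrable (fun x => c * f x).
Proof.
move=> cf; apply: (@le_cintegrable _ (fun x => cabs c * cabs (f x))).
- by apply: measurable_complexM; [exact: measurable_cst|case: cf].
- by have := integrableZl measurableT (cabs c) (cintegrable_cabs cf).
- by move=> x; rewrite cabsM.
Qed.

Lemma cintegrable_conj f : cintegrable f -> cintegrable (fun x => (f x)^*).
Proof.
move=> cf; apply: (@le_cintegrable _ (fun x => cabs (f x))).
- by apply: measurable_conj; case: cf.
- exact: cintegrable_cabs.
- by move=> x; rewrite cabs_conj.
Qed.

Lemma cintegrableB f g : cintegrable f -> cintegrable g ->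
  cintegrable (fun x => f x - g x).
Proof.
move=> cf cg; apply: (@le_cintegrable _ (fun x => cabs (f x) + cabs (g x))).
- by apply: measurable_complexB; [case: cf|case: cg].
- by have := integrableD measurableT (cintegrable_cabs cf) (cintegrable_cabs cg).
- by move=> x; rewrite (le_trans (cabs_add _ _))// cabsN.
Qed.

Lemma cintegralD f g : cintegrable f -> cintegrable g ->
  cintegral mu (fun x => f x + g x) = cintegral mu f + cintegral mu g.
Proof.
move=> cf cg; apply: complex_ext; rewrite !ReImE/=.
  under eq_Rintegral do rewrite Re_add.
  by rewrite RintegralD//; exact: cintegrable_Re.
under eq_Rintegral do rewrite Im_add.
by rewrite RintegralD//; exact: cintegrable_Im.
Qed.

Lemma cintegralZ c f : cintegrable f ->
  cintegral mu (fun x => c * f x) = c * cintegral mu f.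
Proof.
move=> cf; have iR := cintegrable_Re cf; have iI := cintegrable_Im cf.
have iZ (a : R) h : mu.-integrable setT (EFin \o h) ->
    mu.-integrable setT (EFin \o (fun x => a * h x)).
  by move=> ih; have := integrableZl measurableT a ih.
apply: complex_ext; rewrite !ReImE/=.
  under eq_Rintegral do rewrite Re_mul.
  by rewrite RintegralB//; [rewrite !RintegralZl|exact: iZ|exact: iZ].
under eq_Rintegral do rewrite Im_mul.
by rewrite RintegralD//; [rewrite !RintegralZl|exact: iZ|exact: iZ].
Qed.

Lemma cintegralB f g : cintegrable f -> cintegrable g ->
  cintegral mu (fun x => f x - g x) = cintegral mu f - cintegral mu g.
Proof.
move=> cf cg; rewrite -mulN1r -cintegralZ// -cintegralD//; last exact: cintegrableZ.
by congr cintegral; apply/funext => x; rewrite mulN1r.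
Qed.

Lemma cintegral_conj f : cintegrable f ->
  cintegral mu (fun x => (f x)^*) = (cintegral mu f)^*.
Proof.
move=> cf; apply: complex_ext; rewrite !ReImE/=.
  by apply: eq_Rintegral => x _; rewrite Re_conjc.
under eq_Rintegral do rewrite Im_conjc -mulN1r.
by rewrite RintegralZl ?mulN1r//; exact: cintegrable_Im.
Qed.

Lemma cintegrable_sum I (s : seq I) (F : I -> T -> R[i]) :
  (forall i, cintegrable (F i)) -> cintegrable (fun x => \sum_(i <- s) F i x).
Proof.
move=> cF; elim: s => [|i s ih].
  rewrite (_ : (fun _ => _) = fun=> 0); last by apply/funext => x; rewrite big_nil.
  split; first exact: measurable_cst.
  by under eq_integral do rewrite cabs0; rewrite integral0 ltry.
rewrite (_ : (fun _ => _) = fun x => F i x + \sum_(j <- s) F j x).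
  exact: cintegrableD.
by apply/funext => x; rewrite big_cons.
Qed.

Lemma cintegral_sum I (s : seq I) (F : I -> T -> R[i]) :
  (forall i, cintegrable (F i)) ->
  cintegral mu (fun x => \sum_(i <- s) F i x) = \sum_(i <- s) cintegral mu (F i).
Proof.
move=> cF; elim: s => [|i s ih].
  rewrite big_nil (_ : (fun _ => _) = fun=> 0); last by apply/funext => x; rewrite big_nil.
  by apply: complex_ext => /=; rewrite /Rintegral integral0.
rewrite (_ : (fun _ => _) = fun x => F i x + \sum_(j <- s) F j x).
  by rewrite cintegralD ?ih ?big_cons//; exact: cintegrable_sum.
by apply/funext => x; rewrite big_cons.
Qed.

(** Multiplying [f] by the unimodular constant that rotates the integral onto its modulus reduces
    the claim to real parts. *)
Lemma cabs_cintegral_le f : cintegrable f ->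
  ((cabs (cintegral mu f))%:E <= \int[mu]_x (cabs (f x))%:E)%E.
Proof.
move=> cf; set I := cintegral mu f; have [I0|I0] := eqVneq I 0.
  by rewrite I0 cabs0 integral_ge0// => x _; rewrite lee_fin cabs_ge0.
have cI0 : cabs I != 0 by rewrite cabs_eq0.
pose c := ((cabs I)^-1)%:C * I^*.
have c1 : cabs c = 1.
  by rewrite cabsM cabs_conj cabs_real ger0_norm ?invr_ge0 ?cabs_ge0// mulVf.
have cI : c * I = (cabs I)%:C.
  by rewrite /c -mulrA (mulrC _ I) mul_conj -rmorphM/= expr2 mulrA mulVf ?mul1r.
have := cintegralZ c cf; rewrite -/I cI => /(congr1 (@complex.Re R))/= => <-.
have icf := cintegrableZ c cf.
rewrite /Rintegral fineK; last by apply: integrable_fin_num => //; exact: cintegrable_Re icf.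
apply: le_integral => //; [exact: cintegrable_Re icf|exact: cintegrable_cabs|].
move=> x _; rewrite lee_fin (le_trans (ler_norm _))// (le_trans (Re_le_cabs _))//.
by rewrite cabsM c1 mul1r.
Qed.

Lemma ae_eq_cintegral f g : measurable_fun setT f -> measurable_fun setT g ->
  {ae mu, forall x, f x = g x} -> cintegral mu f = cintegral mu g.
Proof.
move=> mf mg fg; rewrite /cintegral /Rintegral.
congr (fine _ +i* fine _)%C; apply: ae_eq_integral => //.
- by apply/measurable_EFinP; exact: measurable_Re_comp.
- by apply/measurable_EFinP; exact: measurable_Re_comp.
- by apply: filterS fg => x -> _.
- by apply/measurable_EFinP; exact: measurable_Im_comp.
- by apply/measurable_EFinP; exact: measurable_Im_comp.
- by apply: filterS fg => x -> _.
Qed.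

End complex_integral.

(** * Fubini's theorem for complex functions *)

Section complex_fubini.
Context {R : realType} d1 d2 (T1 : measurableType d1) (T2 : measurableType d2).
Variables (m1 : {sigma_finite_measure set T1 -> \bar R}).
Variables (m2 : {sigma_finite_measure set T2 -> \bar R}).
Variable K : T1 * T2 -> R[i].
Hypothesis mK : measurable_fun setT K.
Hypothesis Koo : (\int[m1]_x \int[m2]_y (cabs (K (x, y)))%:E < +oo)%E.

Let integrable_Re : (m1 \x m2)%E.-integrable setT (fun p => (complex.Re (K p))%:E).
Proof.
apply/integrable12ltyP.
  by apply/measurable_EFinP; exact: measurable_Re_comp.
apply: le_lt_trans Koo; apply: ge0_le_integral => //.
- by move=> x _; exact: integral_ge0.
- apply: (measurable_fun_fubini_tonelli_F (fun p => `|(complex.Re (K p))%:E|%E)) => //.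
  by apply: measurableT_comp => //; apply/measurable_EFinP; exact: measurable_Re_comp.
- apply: (measurable_fun_fubini_tonelli_F (fun p => (cabs (K p))%:E)).
    by apply/measurable_EFinP; exact: measurable_cabs_comp.
  by move=> p; rewrite lee_fin cabs_ge0.
move=> x _; apply: ge0_le_integral => //.
- apply: measurableT_comp => //; apply/measurable_EFinP.
  exact: (measurableT_comp (measurable_Re_comp mK) (measurable_pair1 x)).
- apply/measurable_EFinP.
  exact: (measurableT_comp (measurable_cabs_comp mK) (measurable_pair1 x)).
- by move=> y _; rewrite lee_fin Re_le_cabs.
Qed.

Let integrable_Im : (m1 \x m2)%E.-integrable setT (fun p => (complex.Im (K p))%:E).
Proof.
apply/integrable12ltyP.
  by apply/measurable_EFinP; exact: measurable_Im_comp.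
apply: le_lt_trans Koo; apply: ge0_le_integral => //.
- by move=> x _; exact: integral_ge0.
- apply: (measurable_fun_fubini_tonelli_F (fun p => `|(complex.Im (K p))%:E|%E)) => //.
  by apply: measurableT_comp => //; apply/measurable_EFinP; exact: measurable_Im_comp.
- apply: (measurable_fun_fubini_tonelli_F (fun p => (cabs (K p))%:E)).
    by apply/measurable_EFinP; exact: measurable_cabs_comp.
  by move=> p; rewrite lee_fin cabs_ge0.
move=> x _; apply: ge0_le_integral => //.
- apply: measurableT_comp => //; apply/measurable_EFinP.
  exact: (measurableT_comp (measurable_Im_comp mK) (measurable_pair1 x)).
- apply/measurable_EFinP.
  exact: (measurableT_comp (measurable_cabs_comp mK) (measurable_pair1 x)).
- by move=> y _; rewrite lee_fin Im_le_cabs.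
Qed.

Lemma measurable_cintegral :
  measurable_fun setT (fun x => cintegral m2 (fun y => K (x, y))).
Proof.
apply/measurable_complexP; split.
  exact: (measurableT_comp (fine_measurable measurableT) (measurable_fubini_F integrable_Re)).
exact: (measurableT_comp (fine_measurable measurableT) (measurable_fubini_F integrable_Im)).
Qed.

(** Integrability is asked of every section, not of almost every one, so that [fine] can be removed
    from the inner integrals at every point. *)
Lemma cintegral_fubini : (forall x, cintegrable m2 (fun y => K (x, y))) ->
  (forall y, cintegrable m1 (fun x => K (x, y))) ->
  cintegral m1 (fun x => cintegral m2 (fun y => K (x, y))) =
  cintegral m2 (fun y => cintegral m1 (fun x => K (x, y))).
Proof.
move=> i2 i1; apply: complex_ext => /=; rewrite /Rintegral; congr fine.
  transitivity (\int[m1]_x \int[m2]_y (complex.Re (K (x, y)))%:E)%E.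
    apply: eq_integral => x _; rewrite fineK//; apply: integrable_fin_num => //.
    exact: cintegrable_Re (i2 x).
  rewrite (Fubini integrable_Re); apply: eq_integral => y _; rewrite fineK//.
  by apply: integrable_fin_num => //; exact: cintegrable_Re (i1 y).
transitivity (\int[m1]_x \int[m2]_y (complex.Im (K (x, y)))%:E)%E.
  apply: eq_integral => x _; rewrite fineK//; apply: integrable_fin_num => //.
  exact: cintegrable_Im (i2 x).
rewrite (Fubini integrable_Im); apply: eq_integral => y _; rewrite fineK//.
by apply: integrable_fin_num => //; exact: cintegrable_Im (i1 y).
Qed.

End complex_fubini.

(** * Invariance for signed integrals and rotations of the Gaussian *)

Section signed_invariance.
Local Open Scope ereal_scope.
Context {R : realType}.

Lemma preserves_integral_signed d (T : measurableType d)
    (mu : {measure set T -> \bar R}) (phi : T -> T) (f : T -> \bar R) :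
  preserves_integral mu phi -> measurable_fun setT f ->
  \int[mu]_x f (phi x) = \int[mu]_x f x.
Proof.
move=> [mphi phiE] mf; rewrite integralE [RHS]integralE.
congr (_ - _).
  rewrite -[RHS](phiE (f^\+)).
  - by apply: eq_integral => x _; rewrite !funeposE.
  - exact: measurable_funepos.
  - exact: funepos_ge0.
rewrite -[RHS](phiE (f^\-)).
- by apply: eq_integral => x _; rewrite !funenegE.
- exact: measurable_funeneg.
- exact: funeneg_ge0.
Qed.

Context {n : nat}.

Lemma integral_gauss_measure_signed (t : R) (f : 'rV[R[i]]_n -> R) :
  measurable_fun setT f ->
  \int[gauss_measure t]_z (f z)%:E =
  \int[lebesgue_Cn n]_z (f z * gauss_density t z)%:E.
Proof.
move=> mf; have mf' : measurable_fun setT (EFin \o f) by exact/measurable_EFinP.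
under [RHS]eq_integral do rewrite EFinM muleC.
rewrite [RHS]integralE [LHS]integralE.
congr (_ - _).
  rewrite integral_gauss_measure//; last exact: measurable_funepos.
  by apply: eq_integral => z _; rewrite !funeposE muleC maxe_pMr ?mule0 ?lee_fin ?gauss_density_ge0.
rewrite integral_gauss_measure//; last exact: measurable_funeneg.
apply: eq_integral => z _.
by rewrite !funenegE muleC -muleN maxe_pMr ?mule0 ?lee_fin ?gauss_density_ge0.
Qed.

Lemma gauss_rotation (t : R) (c : R[i]) : cabs c = 1%R ->
  preserves_integral (gauss_measure t) (fun z : 'rV[R[i]]_n => c *: z)%R.
Proof.
move=> c1; have [mc cP] := @lebesgue_Cn_rotation R n c c1; split => // F mF F0.
rewrite !integral_gauss_measure//; last exact: measurableT_comp.
rewrite -[RHS]cP.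
- apply: eq_integral => z _; congr (_ * _%:E).
  by rewrite /gauss_density sqnormZ c1 expr1n mul1r.
- by apply: emeasurable_funM => //; apply/measurable_EFinP; exact: measurable_gauss_density.
- by move=> z; rewrite mule_ge0// lee_fin gauss_density_ge0.
Qed.

End signed_invariance.

(** * The Fock space *)

Section weighted_bounds.
Context {R : realType} {n : nat}.
Implicit Types (z w u : 'rV[R[i]]_n) (t s : R).

Lemma cabs_hdot_weighted s z w : 0 < s ->
  2 * cabs (hdot z w) <= s * sqnorm z + s^-1 * sqnorm w.
Proof.
move=> s0; have r0 : 0 < Num.sqrt s by rewrite sqrtr_gt0.
have := cabs_hdot_le ((Num.sqrt s)%:C *: z) (((Num.sqrt s)^-1)%:C *: w).
rewrite !sqnormZ !cabs_real !real_normK ?num_real// exprVn sqr_sqrtr ?(ltW s0)//.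
rewrite hdotZl hdotZr. rewrite (_ : Num.conj _ = ((Num.sqrt s)^-1)%:C); last first.
  by apply: complex_ext; rewrite /= ?oppr0.
by rewrite mulrA -rmorphM/= divff ?gt_eqF// mul1r.
Qed.

(** Cauchy-Schwarz, by the choice [s = x / a] in [cabs_hdot_weighted]; for [a = 0] the choice
    [(b + 1) / x] rules out [x > 0]. *)
Lemma cabs_hdot_sqr_le z w : cabs (hdot z w) ^+ 2 <= sqnorm z * sqnorm w.
Proof.
set x := cabs _; set a := sqnorm z; set b := sqnorm w.
have x0 : 0 <= x by exact: cabs_ge0.
have a0 : 0 <= a by exact: sqnorm_ge0.
have b0 : 0 <= b by exact: sqnorm_ge0.
have hs s : 0 < s -> 2 * x <= s * a + s^-1 * b by exact: cabs_hdot_weighted.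
move: x0; rewrite le_eqVlt => /predU1P[<-|x0]; first by rewrite expr0n mulr_ge0.
move: a0; rewrite le_eqVlt => /predU1P[az|a0].
  have s0 : 0 < (b + 1) / x by rewrite divr_gt0// ltr_wpDl.
  have := hs _ s0; rewrite -az mulr0 add0r invf_div mulrAC ler_pdivlMr ?ltr_wpDl//.
  nra.
have s0 : 0 < x / a by rewrite divr_gt0.
have := hs _ s0; rewrite divfK ?gt_eqF// invf_div => h.
have : x <= a / x * b by lra.
by rewrite mulrAC ler_pdivlMr// expr2.
Qed.

(** Against the density, the weight leaves a quarter of the exponent, which is a Gaussian at time
    [4 * t]. Growth at most like this weight is the integrability criterion in the estimates
    below. *)
Lemma expR_sqnorm_gauss_density t z : 0 < t ->
  expR (3 / 4 * (4 * t)^-1 * sqnorm z) * gauss_density t z =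
  4 ^+ n * gauss_density (4 * t) z.
Proof.
move=> t0; have t40 : 0 < 4 * t by rewrite mulr_gt0.
rewrite !gauss_densityE// mulrCA -expRD [RHS]mulrA; congr (_ * expR _).
  rewrite [X in _ = _ * (X ^+ _)^-1](_ : _ = 4 * (4 * pi * t)); last by ring.
  rewrite [in RHS]exprMn invfM mulrA divff ?mul1r//.
by field; rewrite gt_eqF.
Qed.

Lemma measurable_expR_Zsqnorm (c : R) :
  measurable_fun setT (fun z : 'rV[R[i]]_n => expR (c * sqnorm z)).
Proof.
apply: measurableT_comp => //; apply: measurable_funM => //.
exact: measurable_sqnorm.
Qed.

Lemma integrable_expR_sqnorm t : 0 < t -> (gauss_measure t).-integrable setT
  (EFin \o (fun z : 'rV[R[i]]_n => expR (3 / 4 * (4 * t)^-1 * sqnorm z))).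
Proof.
move=> t0; have me := measurable_expR_Zsqnorm (3 / 4 * (4 * t)^-1).
apply/integrableP; split; first exact/measurable_EFinP.
under eq_integral do rewrite /= ger0_norm ?expR_ge0//.
rewrite integral_gauss_measure_signed//.
under eq_integral do rewrite expR_sqnorm_gauss_density// EFinM.
have t40 : 0 < 4 * t by rewrite mulr_gt0.
rewrite ge0_integralZl//.
- by rewrite integral_gauss_density// mule1 ltry.
- by apply/measurable_EFinP; exact: measurable_gauss_density.
- by move=> z _; rewrite lee_fin gauss_density_ge0.
Qed.

Lemma integrable_gauss_dominated t (f : 'rV[R[i]]_n -> R) (C : R) : 0 < t ->
  measurable_fun setT f ->
  (forall z, `|f z| <= C * expR (3 / 4 * (4 * t)^-1 * sqnorm z)) ->
  (gauss_measure t).-integrable setT (EFin \o f).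
Proof.
move=> t0 mf fC.
have := integrableZl measurableT C (integrable_expR_sqnorm t0).
apply: le_integrable => //; first exact/measurable_EFinP.
by move=> z _; rewrite /= lee_fin (le_trans (fC z))// ler_norm.
Qed.

Lemma integral_gauss_dominated_lty t (f : 'rV[R[i]]_n -> R) (C : R) : 0 < t ->
  measurable_fun setT f -> (forall z, 0 <= f z) ->
  (forall z, f z <= C * expR (3 / 4 * (4 * t)^-1 * sqnorm z)) ->
  (\int[gauss_measure t]_z (f z)%:E < +oo)%E.
Proof.
move=> t0 mf f0 fC; have /integrableP[_] : (gauss_measure t).-integrable setT (EFin \o f).
  by apply: (@integrable_gauss_dominated _ _ C) => // z; rewrite ger0_norm.
by under eq_integral do rewrite /= ger0_norm//.
Qed.

Lemma L2normE t (g : 'rV[R[i]]_n -> R[i]) :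
  L2norm t g = ((\int[gauss_measure t]_z (cabs (g z) ^+ 2)%:E) `^ 2^-1)%E.
Proof.
rewrite /L2norm /cLnorm unlock; congr (_ `^ _)%E; apply: eq_integral => z _.
by rewrite poweR_EFin ger0_norm ?cabs_ge0// powR_mulrn// cabs_ge0.
Qed.

Lemma cLfun2P t (g : 'rV[R[i]]_n -> R[i]) : cLfun (gauss_measure t) 2%:E g <->
  measurable_fun setT g /\ (\int[gauss_measure t]_z (cabs (g z) ^+ 2)%:E < +oo)%E.
Proof.
have E := L2normE t g; rewrite /L2norm in E; rewrite /cLfun E.
split=> -[mg goo]; split => //; last exact: poweR_lty.
by apply: lty_poweRy goo; rewrite invr_eq0.
Qed.

Lemma H2P t (h : 'rV[R[i]]_n -> R[i]) : H2 t h <->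
  [/\ measurable_fun setT h, (\int[gauss_measure t]_z (cabs (h z) ^+ 2)%:E < +oo)%E
    & entire h].
Proof.
split=> [[/cLfun2P[? ?] ?]//|[? ? ?]].
by split => //; exact/cLfun2P.
Qed.

Lemma L2_integrable_sqr t (f : 'rV[R[i]]_n -> R[i]) : measurable_fun setT f ->
  (\int[gauss_measure t]_z (cabs (f z) ^+ 2)%:E < +oo)%E ->
  (gauss_measure t).-integrable setT (EFin \o (fun z => cabs (f z) ^+ 2)).
Proof.
move=> mf foo; apply/integrableP; split.
  by apply/measurable_EFinP; apply: measurable_funX; exact: measurable_cabs_comp.
by under eq_integral do rewrite /= ger0_norm ?sqr_ge0//.
Qed.

Lemma L2_cintegrableM t (g h : 'rV[R[i]]_n -> R[i]) :
  measurable_fun setT g -> (\int[gauss_measure t]_z (cabs (g z) ^+ 2)%:E < +oo)%E ->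
  measurable_fun setT h -> (\int[gauss_measure t]_z (cabs (h z) ^+ 2)%:E < +oo)%E ->
  cintegrable (gauss_measure t) (fun z => g z * h z).
Proof.
move=> mg goo mh hoo.
apply: (@le_cintegrable _ _ _ _ _ (fun z => cabs (g z) ^+ 2 + cabs (h z) ^+ 2)).
- exact: measurable_complexM.
- by have := integrableD measurableT (L2_integrable_sqr mg goo) (L2_integrable_sqr mh hoo).
- move=> z; rewrite cabsM; have := cabs_ge0 (g z); have := cabs_ge0 (h z); nra.
Qed.

End weighted_bounds.

(** * Gaussian means by averaging over rotations *)

Section rotation_average.
Context {R : realType} {n : nat}.
Implicit Types (z w u : 'rV[R[i]]_n) (t : R).

(** Fubini's theorem for the rotated values of [U], with the angle in [[0, 2 * pi]]: by rotation
    invariance the integral over [z] does not depend on the angle, and the integral over the angle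
    is the circle mean. *)
Lemma rotation_mean_value t (U : 'rV[R[i]]_n -> R) : 0 < t ->
  (gauss_measure t).-integrable setT (EFin \o U) ->
  (forall z, \int[lebesgue_measure]_(s in `[0%R, (2 * pi)%R])
    (U (cexp (0 +i* s)%R *: z))%:E = (2 * pi * U 0)%:E)%E ->
  \int[gauss_measure t]_z U z = U 0.
Proof.
move=> t0 iU UE; have pi0 := pi_gt0 R.
have mU : measurable_fun setT U by have /integrableP[/measurable_EFinP] := iU.
pose D : set R := `[0, 2 * pi]%classic.
have mD : measurable D by exact: measurable_itv.
have mrot : measurable_fun setT (fun p : measurableTypeR R * 'rV[R[i]]_n =>
    cexp (0 +i* p.1) *: p.2).
  apply: measurable_rVZ => //; apply: measurable_cexp.
  by apply/measurable_complexP; split; [exact: measurable_cst|exact: measurable_fst].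
(* The indicator extends the angle to the whole line, so that the product is taken with Lebesgue
   measure itself. *)
pose f (p : measurableTypeR R * 'rV[R[i]]_n) : \bar R :=
  (\1_D p.1 * U (cexp (0 +i* p.1) *: p.2))%:E.
have mind : measurable_fun setT (fun p : measurableTypeR R * 'rV[R[i]]_n => \1_D p.1 : R).
  by apply: measurableT_comp => //; exact: measurable_indic.
have mf : measurable_fun setT f.
  apply/measurable_EFinP; apply: measurable_funM => //.
  exact: measurableT_comp.
have c1 s : cabs (cexp (0 +i* s)) = 1 :> R by rewrite cabs_cexp/= expR0.
have rotE (V : 'rV[R[i]]_n -> R) s : measurable_fun setT V ->
    (\int[gauss_measure t]_z (V (cexp (0 +i* s) *: z))%:E =
     \int[gauss_measure t]_z (V z)%:E)%E.
  move=> mV; apply: (preserves_integral_signed (f := EFin \o V)).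
    exact: (gauss_rotation t (c1 s)).
  exact/measurable_EFinP.
have D_integral (a : R) : (\int[lebesgue_measure]_s (\1_D s * a)%:E = (2 * pi * a)%:E)%E.
  rewrite (_ : (fun s => _) = fun s => a%:E * (\1_D s)%:E)%E; last first.
    by apply/funext => s; rewrite mulrC EFinM.
  rewrite integralZl//; last exact: integrable_indic_itv.
  rewrite integral_indic// setIT.
  transitivity (a%:E * (2 * pi)%:E)%E; last by rewrite -EFinM mulrC.
  congr (_ * _)%E.
  by rewrite [LHS](@lebesgue_measure_itv R `[0, 2 * pi])/= lte_fin mulr_gt0// oppr0 addr0.
have mrotU s : measurable_fun setT (fun z => U (cexp (0 +i* s) *: z)).
  by apply: measurableT_comp => //; apply: measurable_rVZ => //; exact: measurable_cst.
have intf : ((@lebesgue_measure R) \x (gauss_measure t))%E.-integrable setT f.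
  apply/integrable12ltyP => //.
  have -> : (\int[lebesgue_measure]_x \int[gauss_measure t]_y `|f (x, y)| =
      \int[lebesgue_measure]_x (\1_D x * \int[gauss_measure t]_z `|U z|)%:E)%E.
    apply: eq_integral => s _; rewrite EFinM /Rintegral fineK; last first.
      by apply: integrable_fin_num => //; exact: integrable_norm.
    rewrite -(rotE (fun z => `|U z|) s); last exact: measurableT_comp.
    rewrite -ge0_integralZl//.
    - by apply: eq_integral => z _; rewrite /f abse_EFin normrM ger0_norm.
    - by apply/measurable_EFinP; apply: measurableT_comp.
  by rewrite D_integral ltry.
have := Fubini intf.
have -> : (\int[lebesgue_measure]_x \int[gauss_measure t]_y f (x, y) =
    \int[lebesgue_measure]_x (\1_D x * \int[gauss_measure t]_z U z)%:E)%E.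
  apply: eq_integral => s _; rewrite EFinM /Rintegral fineK; last exact: integrable_fin_num.
  rewrite -(rotE U s)// -integralZl//.
  apply/integrableP; split; first exact/measurable_EFinP.
  rewrite (rotE (fun z => `|U z|) s); last exact: measurableT_comp.
  by have /integrableP[] := iU.
have -> : (\int[gauss_measure t]_y \int[lebesgue_measure]_x f (x, y) =
    \int[gauss_measure t]_y (cst (2 * pi * U 0)%:E (y : 'rV[R[i]]_n)))%E.
  apply: eq_integral => z _; rewrite /cst -(UE z) [RHS]integral_mkcond; apply: eq_integral => s _.
  rewrite /f/= patchE indicE; case: ifPn => _; rewrite ?mul1r ?mul0r//.
rewrite D_integral integral_cst//.
rewrite [X in _ = (_ * X)%E -> _](_ : _ = 1%E) ?mule1; last exact: gauss_measureT.
move=> -[].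
by apply: mulfI; rewrite mulf_neq0// gt_eqF.
Qed.

End rotation_average.

(** * The reproducing formula *)

Section reproducing_kernel.
Context {R : realType} {n : nat}.
Implicit Types (z w u : 'rV[R[i]]_n) (t : R).

Lemma gauss_mean_value t (F : 'rV[R[i]]_n -> R[i]) : 0 < t ->
  cintegrable (gauss_measure t) F ->
  (forall u a, derivable (fun b : R[i] => F (b *: u)) a 1) ->
  cintegral (gauss_measure t) F = F 0.
Proof.
move=> t0 iF dF; apply: complex_ext => /=.
  apply: (@rotation_mean_value _ _ _ (fun u => complex.Re (F u))) => //.
    exact: cintegrable_Re.
  by move=> u; rewrite (circle_mean_value (dF u)) scale0r.
apply: (@rotation_mean_value _ _ _ (fun u => complex.Im (F u))) => //.
  exact: cintegrable_Im.
(* The imaginary part of a number is the real part of [-i] times it, and multiplying [F] by [-i]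
   keeps it holomorphic. *)
move=> u; have ReI (a : R[i]) : complex.Im a = complex.Re ((0 -i* 1)%C * a).
  by rewrite Re_mul/=; ring.
under eq_integral do rewrite ReI.
rewrite (@circle_mean_value _ (fun b => (0 -i* 1)%C * F (b *: u))).
  by rewrite -ReI scale0r.
by move=> a; apply: derivableM => //; exact: derivable_cst.
Qed.

Lemma derivable_line (k : 'rV[R[i]]_n -> R[i]) z u (a : R[i]) :
  entire k -> derivable (fun b : R[i] => k (z + b *: u)) a 1.
Proof.
move=> dk; have : derivable k (z + a *: u) u by exact: diff_derivable.
rewrite /derivable.
set f := (X in cvg (X @ _)); set g := (X in _ -> cvg (X @ _)).
suff -> : g = f by [].
apply/funext => h; rewrite /f /g; congr (_ *: (k _ - _)).
by rewrite -[h *: 1]/(h * 1) mulr1 scalerDl addrCA.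
Qed.

Lemma integral_gauss_measure_translate t (F G : 'rV[R[i]]_n -> R) z :
  measurable_fun setT F -> measurable_fun setT G ->
  (forall w, F (w - z) * gauss_density t (w - z) = G w * gauss_density t w) ->
  (\int[gauss_measure t]_u (F u)%:E = \int[gauss_measure t]_u (G u)%:E)%E.
Proof.
move=> mF mG FG; rewrite !integral_gauss_measure_signed//.
under [RHS]eq_integral do rewrite -FG.
rewrite (preserves_integral_signed (f := fun w => (F w * gauss_density t w)%:E)
  (lebesgue_Cn_translation (- z)))//.
by apply/measurable_EFinP; apply: measurable_funM => //; exact: measurable_gauss_density.
Qed.

Lemma cintegral_gauss_measure_translate t (F G : 'rV[R[i]]_n -> R[i]) z :
  measurable_fun setT F -> cintegrable (gauss_measure t) G ->
  (forall w, F (w - z) * (gauss_density t (w - z))%:C = G w * (gauss_density t w)%:C) ->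
  cintegrable (gauss_measure t) F /\
  cintegral (gauss_measure t) F = cintegral (gauss_measure t) G.
Proof.
move=> mF [mG iG] FG; split.
  split => //; rewrite (@integral_gauss_measure_translate _ _ (fun u => cabs (G u)) z)//.
  - exact: measurable_cabs_comp.
  - exact: measurable_cabs_comp.
  - move=> w; have /(congr1 cabs) := FG w.
    by rewrite !cabsM !cabs_real !ger0_norm ?gauss_density_ge0.
apply: complex_ext; rewrite /= /Rintegral; congr fine.
  apply: (@integral_gauss_measure_translate _ _ (fun u => complex.Re (G u)) z).
  - exact: measurable_Re_comp.
  - exact: measurable_Re_comp.
  - by move=> w; have /(congr1 (@complex.Re R)) := FG w; rewrite !Re_mul/= !mulr0 !subr0.
apply: (@integral_gauss_measure_translate _ _ (fun u => complex.Im (G u)) z).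
- exact: measurable_Im_comp.
- exact: measurable_Im_comp.
- by move=> w; have /(congr1 (@complex.Im R)) := FG w; rewrite !Im_mul/= !mulr0 !add0r.
Qed.

Lemma measurable_kernel (c : R[i]) z :
  measurable_fun setT (fun w => cexp (c * hdot z w)).
Proof.
apply: measurable_cexp; apply: measurable_complexM; first exact: measurable_cst.
by apply: measurable_hdot => //; exact: measurable_cst.
Qed.

Lemma kernel_L2 t z : 0 < t ->
  (\int[gauss_measure t]_w (cabs (cexp (((4 * t)^-1)%:C * hdot z w)) ^+ 2)%:E < +oo)%E.
Proof.
move=> t0; set k := (4 * t)^-1; have k0 : 0 < k by rewrite invr_gt0 mulr_gt0.
pose C : R := expR (4 / 3 * k * sqnorm z).
have mk : measurable_fun setT (fun w => cabs (cexp (k%:C * hdot z w)) ^+ 2).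
  by apply: measurable_funX; apply: measurable_cabs_comp; exact: measurable_kernel.
apply: (@integral_gauss_dominated_lty _ _ _ _ C) => // [w|w]; first exact: sqr_ge0.
rewrite cabs_cexp -expRM_natl -expRD ler_expR Re_mul/= mul0r subr0.
(* The weight [4 / 3] leaves its inverse [3 / 4] on [sqnorm w], the admissible growth. *)
have := @cabs_hdot_weighted _ _ (4 / 3) z w; rewrite -/k.
move=> /(_ ltac:(by [])) h; have := Re_le_cabs (hdot z w) => /(le_trans (ler_norm _)) h2.
have : 2 * complex.Re (hdot z w) <= 4 / 3 * sqnorm z + 3 / 4 * sqnorm w.
  by rewrite invf_div in h; lra.
rewrite -mulr_natl; nra.
Qed.

(** Substituting [w = z + u] turns the kernel into [cexp (- kappa * hdot u z)], which is holomorphic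
    in [u]. The integral is then a Gaussian mean and equals the value at [u = 0]. *)
Lemma H2_reproducing t (k : 'rV[R[i]]_n -> R[i]) z : 0 < t -> H2 t k ->
  cintegral (gauss_measure t)
    (fun w => k w * cexp (((4 * t)^-1)%:C * hdot z w)) = k z.
Proof.
move=> t0 /H2P[mk ik dk]; set kappa := (4 * t)^-1.
pose F u := k (z + u) * cexp (- kappa%:C * hdot u z).
pose G w := k w * cexp (kappa%:C * hdot z w).
have mF : measurable_fun setT F.
  apply: measurable_complexM.
    by apply: measurableT_comp => //; apply: measurable_rVD => //; exact: measurable_cst.
  apply: measurable_cexp; apply: measurable_complexM; first exact: measurable_cst.
  by apply: measurable_hdot => //; exact: measurable_cst.
have iG : cintegrable (gauss_measure t) G.
  apply: L2_cintegrableM => //; [exact: measurable_kernel|exact: kernel_L2].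
have [iF <-] : cintegrable (gauss_measure t) F /\
    cintegral (gauss_measure t) F = cintegral (gauss_measure t) G.
  apply: (@cintegral_gauss_measure_translate _ _ _ z) => // w.
  rewrite /F /G addrC subrK !gauss_densityE// !rmorphM/= -!(mulrA (k w)).
  congr (k w * _); rewrite mulrCA [RHS]mulrCA; congr (_ * _).
  rewrite -!cexp_real -!cexpD; congr cexp.
  rewrite hdotDl hdotNl hdotzz sqnormBE !mulNr -/kappa -(hdot_conj w z).
  by apply: complex_ext; rewrite !ReImE/=; ring.
rewrite gauss_mean_value//; first by rewrite /F addr0 hdot0l mulr0 cexp0 mulr1.
move=> u a; apply: derivableM; first exact: derivable_line.
rewrite (_ : (fun _ => _) = fun b => cexp (- kappa%:C * hdot u z * b)).
  exact: derivable_cexpZ.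
by apply/funext => b; rewrite hdotZl mulrA mulrAC.
Qed.

End reproducing_kernel.

(** * Orthogonal projection of functions dominated by a coherent state *)

Section bounded_kernel_projection.
Context {R : realType} {n : nat} (t : R) (w : 'rV[R[i]]_n).
Variables (M : R) (g : 'rV[R[i]]_n -> R[i]).
Hypotheses (t0 : 0 < t) (mg : measurable_fun setT g).

Let k : R := (4 * t)^-1.

Hypothesis gM : forall z, cabs (g z) <= M * expR (k * complex.Re (hdot z w)).

Let k0 : 0 < k.
Proof. by rewrite invr_gt0 mulr_gt0. Qed.

Let M0 : 0 <= M.
Proof.
have := le_trans (cabs_ge0 _) (gM 0).
by rewrite pmulr_lge0// expR_gt0.
Qed.

Let ReC (a b : 'rV[R[i]]_n) : complex.Re (hdot a b) = complex.Re (hdot b a).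
Proof. by rewrite -hdot_conj Re_conjc. Qed.

(** Completing the square moves the centre of the Gaussian to [a / 2] and leaves the factor
    [expR (k / 4 * sqnorm a)]. *)
Lemma integral_expR_hdot (a : 'rV[R[i]]_n) :
  (\int[gauss_measure t]_z (expR (k * complex.Re (hdot z a)))%:E =
   (expR (k / 4 * sqnorm a))%:E)%E.
Proof.
have mh : measurable_fun setT (fun z => expR (k * complex.Re (hdot z a))).
  apply: measurableT_comp => //; apply: measurable_funM => //.
  by apply: measurable_Re_comp; apply: measurable_hdot => //; exact: measurable_cst.
rewrite -(@integral_gauss_measure_translate _ _ _ (cst (expR (k / 4 * sqnorm a))) _
  ((2^-1 : R)%:C *: a))//.
  rewrite [LHS](integral_cst _ measurableT (expR _)%:E).
  by rewrite [X in (_ * X)%E](gauss_measureT t0) mule1.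
move=> z; rewrite !gauss_densityE// mulrCA [RHS]mulrCA; congr (_ * _).
rewrite -!expRD sqnormBZ !mulNr -/k; congr expR; by field.
Qed.

Let ker z a := g a * cexp (k%:C * hdot z a).

(* The orthogonal projection of g; the domination of g by a coherent state makes
   the integral converge absolutely. *)
Definition kernel_transform z : R[i] := cintegral (gauss_measure t) (ker z).

Local Notation h := kernel_transform.

Let cabs_ker z a : cabs (ker z a) <= M * expR (k * complex.Re (hdot a (w + z))).
Proof.
rewrite /ker cabsM cabs_cexp (le_trans (ler_wpM2r (expR_ge0 _) (gM a)))//.
by rewrite -mulrA -expRD hdotDr Re_add mulrDr Re_mul/= mul0r subr0 (ReC z).
Qed.

Let Re_hdot_le (s : R) (a b : 'rV[R[i]]_n) : 0 < s ->
  2 * complex.Re (hdot a b) <= s * sqnorm a + s^-1 * sqnorm b.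
Proof.
move=> s0; apply: le_trans (cabs_hdot_weighted a b s0).
by rewrite ler_wpM2l// (le_trans (ler_norm _))// Re_le_cabs.
Qed.

Let measurable_ker : measurable_fun setT
  (fun p : 'rV[R[i]]_n * 'rV[R[i]]_n => ker p.1 p.2).
Proof.
apply: measurable_complexM; first exact: measurableT_comp.
apply: measurable_cexp; apply: measurable_complexM; first exact: measurable_cst.
by apply: measurable_hdot; [exact: measurable_fst|exact: measurable_snd].
Qed.

Let measurable_ker1 z : measurable_fun setT (ker z).
Proof. exact: (measurableT_comp measurable_ker (measurable_pair1 z)). Qed.

(** The weighted inequality with weight [1 / 2] leaves only a quarter of [k * sqnorm a], so that
    three such factors still fit the admissible growth. *)
Let expR_hdot_le (a b : 'rV[R[i]]_n) : expR (k * complex.Re (hdot a b)) <=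
  expR (k * sqnorm b) * expR (k / 4 * sqnorm a).
Proof.
rewrite -expRD ler_expR.
have := @Re_hdot_le 2^-1 a b (ltac:(by [])); rewrite invrK => hab.
have := k0; nra.
Qed.

Let cintegrable_ker z : cintegrable (gauss_measure t) (ker z).
Proof.
apply: (@le_cintegrable _ _ _ _ _ (fun a => M * expR (k * complex.Re (hdot a (w + z))))) => //.
apply: (@integrable_gauss_dominated _ _ _ _ (M * expR (k * sqnorm (w + z)))) => //.
  apply: measurable_funM => //; apply: measurableT_comp => //; apply: measurable_funM => //.
  by apply: measurable_Re_comp; apply: measurable_hdot => //; exact: measurable_cst.
move=> a; rewrite ger0_norm ?mulr_ge0 ?expR_ge0// -mulrA ler_wpM2l//.
rewrite (le_trans (expR_hdot_le _ _))// ler_wpM2l ?expR_ge0// ler_expR.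
have := sqnorm_ge0 a; have := k0; rewrite -/k; nra.
Qed.

Let integral_cabs_ker z :
  (\int[gauss_measure t]_a (cabs (ker z a))%:E <=
   (M * expR (k / 4 * sqnorm (w + z)))%:E)%E.
Proof.
have mE : measurable_fun setT (fun a => expR (k * complex.Re (hdot a (w + z)))).
  apply: measurableT_comp => //; apply: measurable_funM => //.
  by apply: measurable_Re_comp; apply: measurable_hdot => //; exact: measurable_cst.
rewrite EFinM -integral_expR_hdot -ge0_integralZl//.
- apply: ge0_le_integral => //.
  + by move=> a _; rewrite lee_fin cabs_ge0.
  + by apply/measurable_EFinP; exact: measurable_cabs_comp.
  + by apply/measurable_EFinP; apply: measurable_funM.
  + by move=> a _; rewrite lee_fin cabs_ker.
- exact/measurable_EFinP.
Qed.

(** The exponents come from the weight 2 in [boundE]: the square of this function then grows exactly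
    like the admissible weight [expR (3 / 4 * k * sqnorm z)]. *)
Let bound (z : 'rV[R[i]]_n) : R := M * (expR (3 / 4 * k * sqnorm w) * expR (3 / 8 * k * sqnorm z)).

Let boundE z : M * expR (k / 4 * sqnorm (w + z)) <= bound z.
Proof.
rewrite ler_wpM2l// -expRD ler_expR sqnormD.
have := @Re_hdot_le 2 w z (ltac:(by [])); have := k0; nra.
Qed.

Let cabs_h z : cabs (h z) <= bound z.
Proof.
apply: le_trans (boundE z); rewrite -lee_fin.
exact: le_trans (cabs_cintegral_le (cintegrable_ker z)) (integral_cabs_ker z).
Qed.

Let measurable_bound : measurable_fun setT bound.
Proof.
apply: measurable_funM => //; apply: measurable_funM => //.
exact: measurable_expR_Zsqnorm.
Qed.

Let bound_sqr_lty : (\int[gauss_measure t]_z (bound z ^+ 2)%:E < +oo)%E.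
Proof.
apply: (@integral_gauss_dominated_lty _ _ _ _ (M ^+ 2 * expR (3 / 4 * k * sqnorm w) ^+ 2)) => //.
- exact: measurable_funX.
- by move=> z; exact: sqr_ge0.
move=> z; rewrite /bound !exprMn [leLHS]mulrA.
rewrite ler_wpM2l ?mulr_ge0 ?sqr_ge0// -expRM_natl ler_expR -mulr_natl -/k.
by rewrite le_eqVlt; apply/orP; left; apply/eqP; field.
Qed.

Lemma measurable_kernel_transform : measurable_fun setT h.
Proof.
apply: (@measurable_cintegral _ _ _ _ _ (gauss_measure t) (gauss_measure t)
  (fun p => ker p.1 p.2)) => //=.
apply: (@le_lt_trans _ _ (\int[gauss_measure t]_z (bound z)%:E)%E).
  apply: ge0_le_integral => //.
  - by move=> z _; apply: integral_ge0 => a _; rewrite lee_fin cabs_ge0.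
  - apply: (measurable_fun_fubini_tonelli_F (fun p => (cabs (ker p.1 p.2))%:E)).
      by apply/measurable_EFinP; exact: (measurable_cabs_comp measurable_ker).
    by move=> p; rewrite lee_fin cabs_ge0.
  - exact/measurable_EFinP.
  - by move=> z _; rewrite (le_trans (integral_cabs_ker z))// lee_fin boundE.
apply: (@integral_gauss_dominated_lty _ _ _ _ (M * expR (3 / 4 * k * sqnorm w))) => //.
- by move=> z; rewrite !mulr_ge0 ?expR_ge0.
- move=> z; rewrite /bound mulrA ler_wpM2l ?mulr_ge0 ?expR_ge0// ler_expR -/k.
  have := sqnorm_ge0 z; have := k0; nra.
Qed.

Lemma kernel_transform_L2 :
  (\int[gauss_measure t]_z (cabs (h z) ^+ 2)%:E < +oo)%E.
Proof.
apply: le_lt_trans bound_sqr_lty; apply: ge0_le_integral => //.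
- by move=> z _; rewrite lee_fin sqr_ge0.
- apply/measurable_EFinP; apply: measurable_funX; apply: measurable_cabs_comp.
  exact: measurable_kernel_transform.
- by apply/measurable_EFinP; exact: measurable_funX.
- move=> z _; rewrite lee_fin.
  by rewrite lerXn2r ?nnegrE ?cabs_ge0// (le_trans (cabs_ge0 (h z)))// cabs_h.
Qed.

(* The kernel, |b|^2 and e^|b| each cost a factor e^(k |a|^2 / 4), which adds up
   to the integrable weight e^(3 k |a|^2 / 4). *)
Let remainder_bound z u a : sqnorm u <= 1 ->
  cabs (ker z a * (cexp (k%:C * hdot u a) - 1 - k%:C * hdot u a)) <=
  16 * k * expR k * M * expR (k * sqnorm (w + z)) * sqnorm u *
    expR (3 / 4 * k * sqnorm a).
Proof.
move=> u1; set b := k%:C * _.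
have bk : cabs b = k * cabs (hdot u a) by rewrite /b cabsM cabs_real gtr0_norm.
have b2 : cabs b ^+ 2 <= 4 * k * sqnorm u * expR (k / 4 * sqnorm a).
  rewrite bk exprMn (le_trans (ler_wpM2l _ (cabs_hdot_sqr_le u a)))//.
    by rewrite sqr_ge0.
  have := expR_ge1Dx (k / 4 * sqnorm a) => h1.
  have h2 : k * sqnorm a <= 4 * expR (k / 4 * sqnorm a) by lra.
  have h3 : 0 <= k * sqnorm u by rewrite mulr_ge0// ?sqnorm_ge0// ltW.
  by have := ler_wpM2l h3 h2; lra.
have b1 : expR (cabs b) <= expR k * expR (k / 4 * sqnorm a).
  rewrite -expRD ler_expR bk.
  have := @cabs_hdot_weighted _ _ 2 u a (ltac:(by [])).
  have := k0; nra.
rewrite cabsM (le_trans (ler_pM (cabs_ge0 _) (cabs_ge0 _) (cabs_ker z a) (cexp_remainder b)))//.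
rewrite (le_trans (ler_pM _ _ (ler_wpM2l M0 (expR_hdot_le _ _))
  (ler_pM _ (expR_ge0 _) (ler_wpM2l _ b2) b1)))// ?mulr_ge0 ?expR_ge0 ?sqr_ge0 ?cabs_ge0//.
rewrite (_ : 3 / 4 * k * sqnorm a =
  k / 4 * sqnorm a + k / 4 * sqnorm a + k / 4 * sqnorm a); last by field.
rewrite !expRD le_eqVlt; apply/orP; left; apply/eqP; ring.
Qed.

Let ker_translate z u a : ker (z + u) a = ker z a * cexp (k%:C * hdot u a).
Proof. by rewrite /ker hdotDl mulrDr cexpD mulrA. Qed.

(** These integrals form the derivative of the transform; linear growth in [a] is absorbed by one
    more factor [expR (k / 4 * sqnorm a)]. *)
Let cintegrable_ker_coord z j :
  cintegrable (gauss_measure t) (fun a => ker z a * (k%:C * (a ord0 j)^* )).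
Proof.
pose C := M * expR (k * sqnorm (w + z)) * (k + 4).
apply: (@le_cintegrable _ _ _ _ _ (fun a => C * expR (3 / 4 * k * sqnorm a))).
- apply: measurable_complexM => //; apply: measurable_complexM; first exact: measurable_cst.
  by apply: measurable_conj; exact: measurable_rV_coord.
- by have := integrableZl measurableT C (integrable_expR_sqnorm t0).
move=> a; rewrite cabsM (cabsM k%:C) cabs_conj cabs_real gtr0_norm//.
have h1 : k * cabs (a ord0 j) <= (k + 4) * expR (k / 4 * sqnorm a).
  have := expR_ge1Dx (k / 4 * sqnorm a) => h1.
  have h2 : 1 <= expR (k / 4 * sqnorm a).
    by rewrite -expR0 ler_expR mulr_ge0 ?sqnorm_ge0// ltW// divr_gt0.
  have h3 := sqnorm_coord_le a j; have h4 : cabs (a ord0 j) <= 1 + sqnorm a by nra.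
  have := k0; nra.
rewrite (le_trans (ler_pM (cabs_ge0 _) _
  (le_trans (cabs_ker z a) (ler_wpM2l M0 (expR_hdot_le _ _))) h1))//.
  by rewrite mulr_ge0 ?cabs_ge0// ltW.
rewrite [leLHS](_ : _ = C * expR (k / 2 * sqnorm a)); last first.
  rewrite (_ : k / 2 * sqnorm a = k / 4 * sqnorm a + k / 4 * sqnorm a); last by field.
  by rewrite expRD /C; ring.
rewrite ler_wpM2l//.
  by rewrite !mulr_ge0 ?expR_ge0// addr_ge0// ltW.
rewrite ler_expR; have := sqnorm_ge0 a; have := k0; nra.
Qed.

(** Differentiation under the integral: the linear part of the kernel integrates to [hdot u c],
    where [c] holds conjugates because [hdot] is conjugate linear there, and [remainder_bound] makes
    the rest quadratic in [u]. *)
Lemma kernel_transform_entire : entire h.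
Proof.
move=> z.
pose c := \row_j (cintegral (gauss_measure t) (fun a => ker z a * (k%:C * (a ord0 j)^* )))^*
  : 'rV[R[i]]_n.
pose C := 16 * k * expR k * M * expR (k * sqnorm (w + z)).
have lin u : (fun a => ker z a * (k%:C * hdot u a)) =
    (fun a => \sum_(j < n) u ord0 j * (ker z a * (k%:C * (a ord0 j)^* ))).
  apply/funext => a; rewrite /hdot !mulr_sumr; apply: eq_bigr => j _; ring.
have icoord u (j : 'I_n) : cintegrable (gauss_measure t)
    (fun a => u ord0 j * (ker z a * (k%:C * (a ord0 j)^* ))).
  exact: cintegrableZ.
have ilin u : cintegrable (gauss_measure t) (fun a => ker z a * (k%:C * hdot u a)).
  by rewrite lin; exact: cintegrable_sum.
have hdotE u : hdot u c = cintegral (gauss_measure t) (fun a => ker z a * (k%:C * hdot u a)).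
  rewrite lin cintegral_sum//; apply: eq_bigr => j _.
  by rewrite cintegralZ// mxE; congr (_ * _); exact: conjcK.
have iE := integrable_expR_sqnorm (n := n) t0; rewrite -/k in iE.
apply: (@differentiable_remainder _ _ h z c
  (C * \int[gauss_measure t]_a expR (3 / 4 * k * sqnorm a))) => u u1.
rewrite hdotE /h -!cintegralB//; last exact: cintegrableB.
rewrite (_ : (fun _ => _) = fun a => ker z a * (cexp (k%:C * hdot u a) - 1 - k%:C * hdot u a));
  last by apply/funext => a; rewrite ker_translate; ring.
have irem : cintegrable (gauss_measure t)
    (fun a => ker z a * (cexp (k%:C * hdot u a) - 1 - k%:C * hdot u a)).
  rewrite (_ : (fun _ => _) = fun a => ker (z + u) a - ker z a - ker z a * (k%:C * hdot u a));
    last by apply/funext => a; rewrite ker_translate; ring.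
  by do 2 apply: cintegrableB => //.
rewrite -lee_fin (le_trans (cabs_cintegral_le irem))//.
apply: (@le_trans _ _ (\int[gauss_measure t]_a
    ((C * sqnorm u)%:E * (expR (3 / 4 * k * sqnorm a))%:E))%E).
  apply: ge0_le_integral => //.
  - by move=> a _; rewrite lee_fin cabs_ge0.
  - by apply/measurable_EFinP; apply: measurable_cabs_comp; case: irem.
  - apply/measurable_EFinP; apply: measurable_funM => //; exact: measurable_expR_Zsqnorm.
  - by move=> a _; rewrite -EFinM lee_fin remainder_bound.
rewrite integralZl// -[X in (_ * X <= _)%E]fineK; last exact: integrable_fin_num.
by rewrite -EFinM lee_fin -[leLHS](mulrA C) (mulrC (sqnorm u)) mulrA; exact: lexx.
Qed.

Lemma kernel_transform_H2 : H2 t h.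
Proof.
apply/H2P; split; [exact: measurable_kernel_transform|exact: kernel_transform_L2|].
exact: kernel_transform_entire.
Qed.

Lemma bounded_kernel_L2 : (\int[gauss_measure t]_z (cabs (g z) ^+ 2)%:E < +oo)%E.
Proof.
apply: (@integral_gauss_dominated_lty _ _ _ _ ((M * expR (k * sqnorm w)) ^+ 2)) => //.
- by apply: measurable_funX; exact: measurable_cabs_comp.
- by move=> z; exact: sqr_ge0.
move=> z; have h1 := le_trans (gM z) (ler_wpM2l M0 (expR_hdot_le z w)).
rewrite (@le_trans _ _ ((M * (expR (k * sqnorm w) * expR (k / 4 * sqnorm z))) ^+ 2))//.
  by rewrite lerXn2r ?nnegrE ?cabs_ge0// (le_trans (cabs_ge0 _) h1).
rewrite mulrA exprMn ler_wpM2l ?sqr_ge0// -expRM_natl ler_expR -mulr_natl -/k.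
have := sqnorm_ge0 z; have := k0; nra.
Qed.

(** By Fubini's theorem, the inner product of the transform with [f] is the integral of [g] against
    the conjugate of the reproducing integral of [f], which is [f] itself. *)
Lemma kernel_transform_orthogonal f : H2 t f ->
  L2inner t (fun z => g z - h z) f = 0.
Proof.
move=> Hf; have /H2P[mf foo df] := Hf.
have mfc : measurable_fun setT (fun z => (f z)^* ) by exact: measurable_conj.
have fcoo : (\int[gauss_measure t]_z (cabs (f z)^* ^+ 2)%:E < +oo)%E.
  by under eq_integral do rewrite cabs_conj.
have mh := measurable_kernel_transform; have hoo := kernel_transform_L2.
have igf : cintegrable (gauss_measure t) (fun z => g z * (f z)^* ).
  by apply: L2_cintegrableM => //; exact: bounded_kernel_L2.
have ihf : cintegrable (gauss_measure t) (fun z => h z * (f z)^* ).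
  exact: L2_cintegrableM.
rewrite /L2inner (_ : (fun _ => _) = fun z => g z * (f z)^* - h z * (f z)^* ); last first.
  by apply/funext => z; rewrite mulrBl.
rewrite cintegralB//; apply/eqP; rewrite subr_eq0; apply/eqP/esym.
pose K (p : 'rV[R[i]]_n * 'rV[R[i]]_n) := (f p.1)^* * ker p.1 p.2.
have mK : measurable_fun setT K.
  by apply: measurable_complexM => //; exact: (measurableT_comp mfc measurable_fst).
have iK1 z : cintegrable (gauss_measure t) (fun a => K (z, a)).
  exact: (cintegrableZ (f z)^* (cintegrable_ker z)).
have kerJ z a : K (z, a) = g a * (f z * cexp (k%:C * hdot a z))^*.
  have cexpJ : (cexp (k%:C * hdot a z))^*%R = cexp (k%:C * hdot z a).
    rewrite [LHS]cexp_conj -(hdot_conj a z); congr cexp.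
    by apply: complex_ext; case: (hdot a z) => x y /=; ring.
  transitivity (g a * ((f z)^* * (cexp (k%:C * hdot a z))^* )).
    by rewrite cexpJ /K /ker mulrCA.
  by congr (_ * _); exact/esym/rmorphM.
have iK2 a : cintegrable (gauss_measure t) (fun z => K (z, a)).
  under [X in cintegrable _ X]eq_fun do rewrite kerJ.
  apply: cintegrableZ; apply: cintegrable_conj; apply: L2_cintegrableM => //.
    exact: measurable_kernel.
  exact: kernel_L2.
transitivity (cintegral (gauss_measure t)
    (fun z => cintegral (gauss_measure t) (fun a => K (z, a)))).
  by congr cintegral; apply/funext => z; rewrite /K/= cintegralZ// mulrC.
rewrite cintegral_fubini//.
  congr cintegral; apply/funext => a.
  transitivity (cintegral (gauss_measure t)
      (fun z => g a * (f z * cexp (k%:C * hdot a z))^* )).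
    by congr cintegral; apply/funext => z; exact: kerJ.
  have irep : cintegrable (gauss_measure t) (fun z => f z * cexp (k%:C * hdot a z)).
    by apply: L2_cintegrableM => //; [exact: measurable_kernel|exact: kernel_L2].
  rewrite cintegralZ; last exact: cintegrable_conj.
  by rewrite cintegral_conj// H2_reproducing.
(* Absolute convergence for Fubini: the inner integral is at most [cabs (f z) * bound z], hence at
   most the sum of the two squares. *)
apply: (@le_lt_trans _ _ (\int[gauss_measure t]_z ((cabs (f z) ^+ 2)%:E + (bound z ^+ 2)%:E))%E).
  apply: ge0_le_integral => //.
  - by move=> z _; apply: integral_ge0 => a _; rewrite lee_fin cabs_ge0.
  - apply: (measurable_fun_fubini_tonelli_F (fun p => (cabs (K p))%:E)).
      by apply/measurable_EFinP; exact: measurable_cabs_comp.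
    by move=> p; rewrite lee_fin cabs_ge0.
  - apply: emeasurable_funD; apply/measurable_EFinP; apply: measurable_funX => //.
    exact: measurable_cabs_comp.
  - move=> z _; have -> : (\int[gauss_measure t]_a (cabs (K (z, a)))%:E =
        \int[gauss_measure t]_a ((cabs (f z))%:E * (cabs (ker z a))%:E))%E.
      by apply: eq_integral => a _; rewrite /K cabsM cabs_conj EFinM.
    rewrite ge0_integralZl//.
    + apply: (@le_trans _ _ ((cabs (f z))%:E * (M * expR (k / 4 * sqnorm (w + z)))%:E)%E).
        by apply: lee_wpmul2l => //; rewrite lee_fin cabs_ge0.
      rewrite -EFinM -EFinD lee_fin.
      have := ler_wpM2l (cabs_ge0 (f z)) (boundE z).
      have := sqr_ge0 (cabs (f z) - bound z); nra.
    + by apply/measurable_EFinP; exact: measurable_cabs_comp.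
    + by move=> a _; rewrite lee_fin cabs_ge0.
    + by rewrite lee_fin cabs_ge0.
rewrite ge0_integralD//.
- by rewrite lte_add_pinfty.
- by move=> z _; rewrite lee_fin sqr_ge0.
- by apply/measurable_EFinP; apply: measurable_funX; exact: measurable_cabs_comp.
- by move=> z _; rewrite lee_fin sqr_ge0.
- by apply/measurable_EFinP; apply: measurable_funX.
Qed.

End bounded_kernel_projection.

(** * Coherent states and the heat transform as a matrix coefficient *)

Section coherent_states.
Context {R : realType} {n : nat} (t : R) (w : 'rV[R[i]]_n).
Hypothesis t0 : 0 < t.

Let k : R := (4 * t)^-1.

Let k0 : 0 < k.
Proof. by rewrite invr_gt0 mulr_gt0. Qed.

Definition coherent z : R[i] := cexp (k%:C * hdot z w) * (expR (- (k / 2) * sqnorm w))%:C.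

Lemma measurable_coherent : measurable_fun setT coherent.
Proof.
apply: measurable_complexM; last exact: measurable_cst.
apply: measurable_cexp; apply: measurable_complexM; first exact: measurable_cst.
by apply: measurable_hdot => //; exact: measurable_cst.
Qed.

Lemma cabs_coherent z :
  cabs (coherent z) = expR (k * complex.Re (hdot z w) - k / 2 * sqnorm w).
Proof.
rewrite cabsM cabs_cexp cabs_real ger0_norm ?expR_ge0// -expRD Re_mul/= mul0r subr0.
by rewrite mulNr.
Qed.

(** The squared modulus recentres the Gaussian at [w]; both the norm 1 and the heat transform at [w]
    come from this identity. *)
Lemma cabs_coherent_gauss_density z :
  cabs (coherent z) ^+ 2 * gauss_density t z = gauss_density t (z - w).
Proof.
rewrite cabs_coherent !gauss_densityE// mulrCA -expRM_natl -expRD; congr (_ * expR _).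
by rewrite sqnormBE !mulNr -/k -mulr_natl; field.
Qed.

Lemma integral_cabs_coherent :
  (\int[gauss_measure t]_z (cabs (coherent z) ^+ 2)%:E = 1)%E.
Proof.
rewrite -(@integral_gauss_measure_translate _ _ _ (cst 1) _ w)//.
- by rewrite [LHS](integral_cst _ measurableT 1%E) mul1e; exact: gauss_measureT.
- by apply: measurable_funX; apply: measurable_cabs_comp; exact: measurable_coherent.
- by move=> z; rewrite mul1r cabs_coherent_gauss_density.
Qed.

Lemma entire_coherent : entire coherent.
Proof.
move=> z; pose C := expR (- (k / 2) * sqnorm w).
pose K := cabs (coherent z) * (4 * (k ^+ 2 * sqnorm w) * expR (k / 2 * (1 + sqnorm w))).
apply: (@differentiable_remainder _ _ coherent z ((conjc (coherent z) * k%:C) *: w) K) => u u1.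
rewrite hdotZr (_ : _ - _ - _ =
  coherent z * (cexp (k%:C * hdot u w) - 1 - k%:C * hdot u w)); last first.
  have -> : (conjc (coherent z) * k%:C)^*%R = coherent z * k%:C :> R[i].
    by apply: complex_ext; case: (coherent z) => x y /=; ring.
  rewrite {1}/coherent hdotDl mulrDr cexpD; set b := k%:C * hdot u w.
  by rewrite (_ : coherent z * k%:C * _ = coherent z * b) /coherent ?/b; ring.
rewrite cabsM /K -mulrA ler_wpM2l ?cabs_ge0//.
rewrite (le_trans (cexp_remainder _))// cabsM cabs_real gtr0_norm// exprMn.
rewrite [leRHS]mulrAC; apply: ler_pM.
- by rewrite mulr_ge0// mulr_ge0 ?sqr_ge0.
- exact: expR_ge0.
- by have := ler_wpM2l (sqr_ge0 k) (cabs_hdot_sqr_le u w); lra.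
- rewrite ler_expR; have := cabs_hdot_le u w; have := k0; nra.
Qed.

Lemma H2_coherent : H2 t coherent.
Proof.
apply/H2P; split; [exact: measurable_coherent| |exact: entire_coherent].
by rewrite integral_cabs_coherent ltry.
Qed.

Lemma L2norm_coherent : L2norm t coherent = 1%E.
Proof. by rewrite L2normE integral_cabs_coherent poweR1r. Qed.

Lemma cintegral_coherent (f : 'rV[R[i]]_n -> R[i]) (M : R) :
  measurable_fun setT f -> (forall z, cabs (f z) <= M) ->
  cintegrable (gauss_measure t) (fun z => f z * coherent z * (coherent z)^* ) /\
  cintegral (gauss_measure t) (fun z => f z * coherent z * (coherent z)^* ) =
    heat_transform t f w.
Proof.
move=> mf fM; have mc := measurable_coherent.
have mfc : measurable_fun setT (fun z => f z * coherent z * (coherent z)^* ).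
  by apply: measurable_complexM; [exact: measurable_complexM|exact: measurable_conj].
have ifc : cintegrable (gauss_measure t) (fun z => f z * coherent z * (coherent z)^* ).
  apply: (@le_cintegrable _ _ _ _ _ (fun z => M * cabs (coherent z) ^+ 2)) => //.
  - apply: (integrableZl measurableT M (f := fun z => (cabs (coherent z) ^+ 2)%:E)).
    apply/integrableP; split.
      by apply/measurable_EFinP; apply: measurable_funX; exact: measurable_cabs_comp.
    under eq_integral do rewrite gee0_abs ?lee_fin ?sqr_ge0//.
    by rewrite integral_cabs_coherent ltry.
  - by move=> z; rewrite cabsM cabs_conj (cabsM (f z)) -mulrA -expr2 ler_wpM2r ?sqr_ge0.
split => //.
have mfw : measurable_fun setT (fun z => f (w + z)).
  by apply: measurableT_comp => //; apply: measurable_rVD => //; exact: measurable_cst.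
have [|_ <-] := @cintegral_gauss_measure_translate _ _ t (fun z => f (w + z)) _ w mfw ifc.
  move=> z; rewrite (addrC w) subrK -cabs_coherent_gauss_density rmorphM/= -mul_conj.
  by rewrite !mulrA.
(* The translation produced [f (w + z)], whereas the heat transform has [f (w - z)]. *)
have rot := @gauss_rotation R n t (-1) (ltac:(by rewrite cabsN cabs_real normr1)).
apply: complex_ext; rewrite /= /Rintegral; congr fine.
  rewrite -(preserves_integral_signed rot); last first.
    by apply/measurable_EFinP; exact: measurable_Re_comp.
  by apply: eq_integral => z _; rewrite scaleN1r.
rewrite -(preserves_integral_signed rot); last first.
  by apply/measurable_EFinP; exact: measurable_Im_comp.
by apply: eq_integral => z _; rewrite scaleN1r.
Qed.

End coherent_states.

(** * Norm bounds for projections and Toeplitz operators *)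

Section projection_bounds.
Context {R : realType} {n : nat} (t : R).
Implicit Types (f g h k : 'rV[R[i]]_n -> R[i]).
Hypothesis t0 : 0 < t.

Local Notation mu := (gauss_measure t).
Local Notation sqint g := (\int[mu]_z cabs (g z) ^+ 2).

Lemma L2norm_sqrt g : measurable_fun setT g ->
  (\int[mu]_z (cabs (g z) ^+ 2)%:E < +oo)%E -> L2norm t g = (Num.sqrt (sqint g))%:E.
Proof.
move=> mg goo; rewrite L2normE -[X in (X `^ _)%E]fineK; last first.
  by apply: integrable_fin_num => //; exact: L2_integrable_sqr.
by rewrite poweR_EFin powR12_sqrt// Rintegral_ge0// => z _; exact: sqr_ge0.
Qed.

(** Pointwise, [|g|^2 - |h|^2] is [|g - h|^2] plus twice the real part of [g - h] times the
    conjugate of [h], and the latter integrates to 0. *)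
Lemma sqint_projection_le g h : measurable_fun setT g ->
  (\int[mu]_z (cabs (g z) ^+ 2)%:E < +oo)%E -> H2 t h ->
  L2inner t (fun z => g z - h z) h = 0 -> sqint h <= sqint g.
Proof.
move=> mg goo /H2P[mh hoo _] orth.
have mhc : measurable_fun setT (fun z => (h z)^* ) by exact: measurable_conj.
have hcoo : (\int[mu]_z (cabs (h z)^* ^+ 2)%:E < +oo)%E.
  by under eq_integral do rewrite cabs_conj.
have igh : cintegrable mu (fun z => (g z - h z) * (h z)^* ).
  rewrite (_ : (fun _ => _) = fun z => g z * (h z)^* - h z * (h z)^* ).
    by apply: cintegrableB; exact: L2_cintegrableM.
  by apply/funext => z; rewrite mulrBl.
have Re0 : \int[mu]_z complex.Re ((g z - h z) * (h z)^* ) = 0.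
  by have /(congr1 (@complex.Re R)) := orth.
have ig := L2_integrable_sqr mg goo; have iR := cintegrable_Re igh.
have iZ : mu.-integrable setT (EFin \o (fun z => 2 * complex.Re ((g z - h z) * (h z)^* ))).
  by have := integrableZl measurableT 2 iR.
rewrite (_ : sqint g = sqint g - 2 * \int[mu]_z complex.Re ((g z - h z) * (h z)^* )); last first.
  by rewrite Re0 mulr0 subr0.
rewrite -RintegralZl// -RintegralB//; apply: le_Rintegral => //.
- exact: L2_integrable_sqr.
- by have := integrableB measurableT ig iZ.
move=> z _; rewrite !cabs_sqr !ReImE.
have := sqr_ge0 (complex.Re (g z) - complex.Re (h z)).
have := sqr_ge0 (complex.Im (g z) - complex.Im (h z)).
nra.
Qed.

(** Cauchy-Schwarz for a unit vector [k]: integrate [|h - c k|^2 >= 0], where [c] is the inner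
    product. *)
Lemma cabs_L2inner_sqr_le h k : H2 t h -> H2 t k -> sqint k = 1 ->
  cabs (L2inner t h k) ^+ 2 <= sqint h.
Proof.
move=> /H2P[mh hoo _] /H2P[mk koo _] k1; set c := L2inner t h k.
have mkc : measurable_fun setT (fun z => (k z)^* ) by exact: measurable_conj.
have kcoo : (\int[mu]_z (cabs (k z)^* ^+ 2)%:E < +oo)%E.
  by under eq_integral do rewrite cabs_conj.
have ihk : cintegrable mu (fun z => h z * (k z)^* ) by exact: L2_cintegrableM.
have ich := cintegrableZ c^* ihk.
have iR := cintegrable_Re ich; have ik := L2_integrable_sqr mk koo.
have iZ : mu.-integrable setT (EFin \o (fun z => cabs c ^+ 2 * cabs (k z) ^+ 2)).
  by have := integrableZl measurableT (cabs c ^+ 2) ik.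
have i2 : mu.-integrable setT (EFin \o (fun z => 2 * complex.Re (c^* * (h z * (k z)^* )))).
  by have := integrableZl measurableT 2 iR.
have Rc : \int[mu]_z complex.Re (c^* * (h z * (k z)^* )) = cabs c ^+ 2.
  transitivity (complex.Re (cintegral mu (fun z => c^* * (h z * (k z)^* )))) => //.
  by rewrite cintegralZ// mulrC -[X in X * _]/c mul_conj.
rewrite (_ : cabs c ^+ 2 = 2 * \int[mu]_z complex.Re (c^* * (h z * (k z)^* )) -
   cabs c ^+ 2 * sqint k); last by rewrite Rc k1; ring.
rewrite -!RintegralZl// -RintegralB//; apply: le_Rintegral => //.
- by have := integrableB measurableT i2 iZ.
- exact: L2_integrable_sqr.
move=> z _; set x := h z; set y := k z.
have := cabs_sqr (x - c * y); have := sqr_ge0 (cabs (x - c * y)).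
rewrite -exprMn -cabsM !cabs_sqr !ReImE; nra.
Qed.

Lemma H2proj_P g : (exists h, H2 t h /\
    forall k, H2 t k -> L2inner t (fun z => g z - h z) k = 0) ->
  H2 t (H2proj t g) /\
    forall k, H2 t k -> L2inner t (fun z => g z - H2proj t g z) k = 0.
Proof. exact: (@xgetPex _ _ [set h | _]). Qed.

(** It is applied to [f * h] for every [h] in the space, so both outcomes of [xget] are treated: a
    projection, which is a contraction, or the default. *)
Lemma L2norm_H2proj_le g (c : R) : measurable_fun setT g -> 0 <= c ->
  (\int[mu]_z (cabs (g z) ^+ 2)%:E <= (c ^+ 2)%:E)%E ->
  (L2norm t (H2proj t g) <= c%:E)%E.
Proof.
move=> mg c0 gc; have goo := le_lt_trans gc (ltry _).
rewrite /H2proj; case: xgetP => [h _ [Hh orth]|_].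
  have /H2P[mh hoo _] := Hh; rewrite L2norm_sqrt// lee_fin.
  rewrite -[leRHS]ger0_norm// -sqrtr_sqr ler_wsqrtr//.
  rewrite (le_trans (sqint_projection_le mg goo Hh (orth _ Hh)))//.
  rewrite -lee_fin fineK//; apply: integrable_fin_num => //.
  exact: L2_integrable_sqr.
(* H2proj is 0 when there is no projection. *)
rewrite L2normE; under eq_integral do rewrite cabs0 expr0n.
by rewrite integral0 poweR_EFin powR0 ?invr_eq0 ?lee_fin.
Qed.

(** [f * k_w] is dominated by a multiple of a coherent state, so its projection exists and has the
    same inner product with [k_w], namely the heat transform at [w]. Cauchy-Schwarz concludes, as
    [k_w] has norm 1. *)
Lemma cabs_heat_transform_le f (M : R) (w : 'rV[R[i]]_n) :
  measurable_fun setT f -> (forall z, cabs (f z) <= M) ->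
  ((cabs (heat_transform t f w))%:E <= L2norm t (toeplitz t f (coherent t w)))%E.
Proof.
move=> mf fM; have mc := measurable_coherent t w.
pose g z := f z * coherent t w z.
have mg : measurable_fun setT g by exact: measurable_complexM.
have M0 : 0 <= M by exact: le_trans (cabs_ge0 _) (fM 0).
have gM z : cabs (g z) <= M * expR ((4 * t)^-1 * complex.Re (hdot z w)).
  rewrite /g cabsM ler_pM ?cabs_ge0// cabs_coherent ler_expR gerBl.
  by rewrite mulr_ge0 ?sqnorm_ge0// divr_ge0// invr_ge0 mulr_ge0// ltW.
have [|Hh orth] := @H2proj_P g.
  exists (kernel_transform t g); split; first exact: kernel_transform_H2 gM.
  by move=> k; exact: kernel_transform_orthogonal gM k.
have Hc := H2_coherent w t0; have /H2P[_ coo _] := Hc.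
rewrite /toeplitz -/g; set h := H2proj t g in Hh orth *.
have /H2P[mh hoo _] := Hh.
have [ifc fcE] := cintegral_coherent w t0 mf fM.
have mcc : measurable_fun setT (fun z => (coherent t w z)^* ) by exact: measurable_conj.
have ccoo : (\int[mu]_z (cabs (coherent t w z)^* ^+ 2)%:E < +oo)%E.
  by under eq_integral do rewrite cabs_conj.
have ihc : cintegrable mu (fun z => h z * (coherent t w z)^* ) by exact: L2_cintegrableM.
have -> : heat_transform t f w = L2inner t h (coherent t w).
  apply/eqP; rewrite -subr_eq0 -fcE -cintegralB//; apply/eqP.
  rewrite -(orth _ Hc); congr cintegral; apply/funext => z.
  by rewrite mulrBl.
rewrite L2norm_sqrt// lee_fin -(ger0_norm (cabs_ge0 _)) -sqrtr_sqr ler_wsqrtr//.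
apply: cabs_L2inner_sqr_le => //.
by rewrite /Rintegral integral_cabs_coherent.
Qed.

End projection_bounds.

(** * Proof of the theorem *)

Section null_sets.
Context {R : realType} {n : nat}.
Implicit Types (t : R) (f g : 'rV[R[i]]_n -> R[i]).

Lemma preserves_integral_ae d (T : measurableType d) (mu : {measure set T -> \bar R})
    (phi : T -> T) (P : T -> Prop) : preserves_integral mu phi ->
  {ae mu, forall x, P x} -> {ae mu, forall x, P (phi x)}.
Proof.
move=> [mphi phiE] [N [mN N0 PN]]; exists (phi @^-1` N); split.
- by rewrite -[X in measurable X]setTI; exact: mphi.
- have mphiN : measurable (phi @^-1` N) by rewrite -[X in measurable X]setTI; exact: mphi.
  have := phiE (EFin \o \1_N); rewrite [in RHS]integral_indic// setIT N0 => <-.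
  + transitivity (\int[mu]_x (\1_(phi @^-1` N) x)%:E)%E => //.
    by rewrite integral_indic// setIT.
  + by apply/measurable_EFinP; exact: measurable_indic.
  + by move=> x; rewrite lee_fin.
- by move=> x /= Px; exact: PN.
Qed.

Lemma ae_gauss_measure t (P : 'rV[R[i]]_n -> Prop) :
  {ae lebesgue_Cn n, forall z, P z} -> {ae gauss_measure t, forall z, P z}.
Proof.
move=> [N [mN N0 PN]]; exists N; split => //.
rewrite [LHS]null_set_integral//; apply: measurable_funTS.
by apply/measurable_EFinP; exact: measurable_gauss_density.
Qed.

Lemma eq_heat_transform t f g : measurable_fun setT f -> measurable_fun setT g ->
  {ae lebesgue_Cn n, forall z, f z = g z} ->
  heat_transform t f = heat_transform t g.
Proof.
move=> mf mg fg; apply/funext => w.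
have mw : measurable_fun setT (fun z : 'rV[R[i]]_n => w - z).
  by apply: measurable_rVB => //; exact: measurable_cst.
apply: ae_eq_cintegral; [exact: measurableT_comp|exact: measurableT_comp|].
apply: ae_gauss_measure.
exact: (preserves_integral_ae (lebesgue_Cn_reflection w) fg).
Qed.

(** Both symbols give the same set of candidates for the projection, so [xget] makes the same
    choice. *)
Lemma eq_toeplitz t f g h : measurable_fun setT f -> measurable_fun setT g ->
  measurable_fun setT h -> {ae lebesgue_Cn n, forall z, f z = g z} ->
  toeplitz t f h = toeplitz t g h.
Proof.
move=> mf mg mh fg; rewrite /toeplitz /H2proj; congr xget.
have L2innerE p k : H2 t p -> H2 t k ->
    L2inner t (fun z => f z * h z - p z) k = L2inner t (fun z => g z * h z - p z) k.
  move=> /H2P[mp _ _] /H2P[mk _ _]; apply: ae_eq_cintegral.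
  - apply: measurable_complexM; last exact: measurable_conj.
    by apply: measurable_complexB => //; exact: measurable_complexM.
  - apply: measurable_complexM; last exact: measurable_conj.
    by apply: measurable_complexB => //; exact: measurable_complexM.
  - by apply: filterS (ae_gauss_measure t fg) => z ->.
apply/seteqP; split => p [Hp orth]; split => // k Hk.
  by rewrite -L2innerE// orth.
by rewrite L2innerE// orth.
Qed.

(** [Lnorm] at [+oo] is the essential supremum when the whole space has positive measure; a null
    space could not carry a Gaussian of integral 1. *)
Lemma lebesgue_CnT_gt0 : (0 < lebesgue_Cn n [set: 'rV[R[i]]_n])%E.
Proof.
rewrite lt0e measure_ge0 andbT; apply/eqP => L0.
have /eqP := @integral_gauss_density R n 1 ltr01.
rewrite null_set_integral//; first by rewrite eqe eq_sym oner_eq0.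
by apply/measurable_EFinP; exact: measurable_gauss_density.
Qed.

Lemma cLnorm_ess_sup f : cLnorm (lebesgue_Cn n) +oo f =
  ess_sup (lebesgue_Cn n) (fun z => (cabs (f z))%:E).
Proof.
rewrite /cLnorm unlock lebesgue_CnT_gt0; congr ess_sup; apply/funext => z.
by rewrite /= ger0_norm// cabs_ge0.
Qed.

Lemma cLnorm_ge0 f : (0 <= cLnorm (lebesgue_Cn n) +oo f)%E.
Proof.
rewrite cLnorm_ess_sup; apply: ess_sup_gee; first exact: lebesgue_CnT_gt0.
by apply: aeW => z; rewrite lee_fin cabs_ge0.
Qed.

Lemma cLnorm_leP f (c : \bar R) : (cLnorm (lebesgue_Cn n) +oo f <= c)%E <->
  {ae lebesgue_Cn n, forall z, ((cabs (f z))%:E <= c)%E}.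
Proof. by rewrite cLnorm_ess_sup; split => /ess_supP. Qed.

Lemma eq_cLnorm f g : {ae lebesgue_Cn n, forall z, f z = g z} ->
  cLnorm (lebesgue_Cn n) +oo f = cLnorm (lebesgue_Cn n) +oo g.
Proof.
by move=> fg; rewrite !cLnorm_ess_sup; apply: eq_ess_sup; apply: filterS fg => z ->.
Qed.

End null_sets.

(** * The limits for a symbol bounded everywhere by its essential supremum *)

Section bounded_symbol.
Context {R : realType} {n : nat} (f : 'rV[R[i]]_n -> R[i]) (M : R).
Hypotheses (mf : measurable_fun setT f) (fM : forall z, cabs (f z) <= M).

Local Notation Lambda := (lebesgue_Cn n).

Lemma ae_cvg_heat_transform :
  {ae Lambda, forall w, heat_transform t f w @[t --> 0^'+] --> f w}.
Proof.
have bR : bounded_measurable (fun z => complex.Re (f z)).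
  split; first exact: measurable_Re_comp.
  by exists M => z; exact: le_trans (Re_le_cabs _) (fM z).
have bI : bounded_measurable (fun z => complex.Im (f z)).
  split; first exact: measurable_Im_comp.
  by exists M => z; exact: le_trans (Im_le_cabs _) (fM z).
apply: filterS2 (bounded_ae_heat_cvg bR) (bounded_ae_heat_cvg bI) => w wR wI.
by apply/cvg_complexP; split.
Qed.

Let M0 : 0 <= M.
Proof. exact: le_trans (cabs_ge0 _) (fM 0). Qed.

Lemma H2_opnorm_toeplitz_le t : 0 < t -> (H2_opnorm t (toeplitz t f) <= M%:E)%E.
Proof.
move=> t0; apply: ge_ereal_sup => _ [h [Hh h1] <-]; have /H2P[mh hoo _] := Hh.
have ih := L2_integrable_sqr mh hoo.
apply: L2norm_H2proj_le => //; first exact: measurable_complexM.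
move: h1; rewrite L2norm_sqrt// lee_fin -[X in _ <= X -> _]sqrtr1 ler_sqrt// => h1.
apply: (@le_trans _ _ (\int[gauss_measure t]_z ((M ^+ 2)%:E * (cabs (h z) ^+ 2)%:E))%E).
  apply: ge0_le_integral => //.
  - by move=> z _; rewrite lee_fin sqr_ge0.
  - apply/measurable_EFinP; apply: measurable_funX; apply: measurable_cabs_comp.
    exact: measurable_complexM.
  - apply/measurable_EFinP; apply: measurable_funM => //; apply: measurable_funX.
    exact: measurable_cabs_comp.
  - move=> z _; rewrite -EFinM lee_fin cabsM exprMn ler_wpM2r ?sqr_ge0//.
    by rewrite lerXn2r ?nnegrE ?cabs_ge0.
rewrite integralZl// -[leRHS]mule1; apply: lee_wpmul2l; first by rewrite lee_fin sqr_ge0.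
by rewrite -[leLHS]fineK ?lee_fin//; exact: integrable_fin_num.
Qed.

Lemma cLnorm_heat_transform_le t : 0 < t ->
  (cLnorm Lambda +oo (heat_transform t f) <= H2_opnorm t (toeplitz t f))%E.
Proof.
move=> t0; apply/cLnorm_leP; apply: aeW => w.
rewrite (le_trans (cabs_heat_transform_le t0 w mf fM))//; apply: ereal_sup_ubound.
exists (coherent t w) => //; split; first exact: H2_coherent.
by rewrite L2norm_coherent.
Qed.

Hypothesis LM : cLnorm Lambda +oo f = M%:E.

(** The norms are at most [M]. If they were below [M - e] at arbitrarily small times, a sequence of
    such times would give, off countably many null sets, [cabs (f w) <= M - e] in the limit, against
    [LM]. The sequence is needed because null sets indexed by all real times could not be united. *)
Lemma cvg_cLnorm_heat_transform :
  cLnorm Lambda +oo (heat_transform t f) @[t --> 0^'+] --> M%:E.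
Proof.
pose N t := cLnorm Lambda +oo (heat_transform t f).
have NM t : 0 < t -> (N t <= M%:E)%E.
  by move=> t0; exact: le_trans (cLnorm_heat_transform_le t0) (H2_opnorm_toeplitz_le t0).
have N_fin t : 0 < t -> N t \is a fin_num.
  by move=> t0; rewrite ge0_fin_numE ?cLnorm_ge0// (le_lt_trans (NM _ t0))// ltry.
apply/fine_cvgP; split.
  by near=> t; apply: N_fin; near: t; exact: nbhs_right_gt.
apply/cvgrPdist_le => e e0; apply: contrapT => nP.
have small (j : nat) : exists t, [/\ 0 < t, t < j.+1%:R^-1 & fine (N t) < M - e].
  apply: contrapT => /forallNP nt; apply: nP; apply: nbhs_right0P.
  exists j.+1%:R^-1 => // t t0 tj; rewrite /= ger0_norm.
    rewrite leNgt; apply/negP => eN; apply: (nt t); split => //.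
    by rewrite -/(N t) in eN; lra.
  by rewrite subr_ge0 -lee_fin fineK ?NM// N_fin.
move/choice: small => [u uP].
have u0 : u j @[j --> \oo] --> 0.
  apply: (squeeze_cvgr _ (cvg_cst 0) (@cvg_harmonic R)); apply: nearW => j.
  by have [? ? _] := uP j; rewrite !ltW.
suff : (cLnorm Lambda +oo f <= (M - e)%:E)%E by rewrite LM lee_fin; lra.
apply/cLnorm_leP.
have ae_u : {ae Lambda, forall w, forall j, cabs (heat_transform (u j) f w) <= M - e}.
  apply: ae_foralln => j; have [uj0 _ /ltW] := uP j.
  by rewrite -lee_fin fineK ?N_fin// => /cLnorm_leP; apply: filterS => w; rewrite lee_fin.
apply: filterS2 ae_u ae_cvg_heat_transform => w wu wf; rewrite lee_fin.
apply: contrapT => /negP; rewrite -ltNge => fw.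
have /cvg_at_rightP/(_ u) : cabs (heat_transform t f w) @[t --> 0^'+] --> cabs (f w).
  apply/cvgrPdist_le => d d0; move/cvg_cabsP : wf => /(_ _ d0).
  apply: filterS => t; apply: le_trans; set a := f w; set b := heat_transform _ _ _.
  rewrite ler_norml; have := cabs_add (a - b) b; have := cabs_add (b - a) a.
  by rewrite !subrK (cabsB a); lra.
have uPos : (forall j, u j > 0) /\ u j @[j --> \oo] --> 0.
  by split => // j; have [] := uP j.
move=> /(_ uPos)/cvgr_gt/(_ _ fw) [j _ /(_ j (leqnn j))].
by rewrite /= ltNge wu.
Unshelve. all: by end_near. Qed.

Lemma cvg_H2_opnorm_toeplitz : H2_opnorm t (toeplitz t f) @[t --> 0^'+] --> M%:E.
Proof.
apply: (squeeze_cvge _ cvg_cLnorm_heat_transform (cvg_cst M%:E)).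
near=> t; have t0 : 0 < t by near: t; exact: nbhs_right_gt.
by rewrite cLnorm_heat_transform_le ?H2_opnorm_toeplitz_le.
Unshelve. all: by end_near. Qed.

End bounded_symbol.

Theorem theorem6p2 (R : realType) (n : nat) (f : 'rV[R[i]]_n -> R[i])
    (hf : cLfun (lebesgue_Cn n) +oo%E f) :
  {ae lebesgue_Cn n, forall w : 'rV[R[i]]_n,
    heat_transform t f w @[t --> 0^'+] --> f w} /\
  (cLnorm (lebesgue_Cn n) +oo%E (heat_transform t f) @[t --> 0^'+] -->
     cLnorm (lebesgue_Cn n) +oo%E f /\
   H2_opnorm t (toeplitz t f) @[t --> 0^'+] -->
     cLnorm (lebesgue_Cn n) +oo%E f).
Proof.
have [mf foo] := hf; pose M := fine (cLnorm (lebesgue_Cn n) +oo%E f).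
have fM : cLnorm (lebesgue_Cn n) +oo%E f = M%:E.
  by rewrite fineK// ge0_fin_numE ?cLnorm_ge0.
have M0 : 0 <= M by rewrite -lee_fin -fM cLnorm_ge0.
(* [g] is a representative of [f] bounded at every point by the essential supremum. The heat
   transforms and Toeplitz operators depend only on the class of [f], so the bounded case applies to
   it. *)
pose A := [set z | cabs (f z) <= M]; pose g z := f z * (\1_A z)%:C.
have mA : measurable A.
  have -> : A = (fun z => cabs (f z)) @^-1` `]-oo, M]%classic.
    by apply/seteqP; split => z; rewrite /A/= in_itv.
  rewrite -[X in measurable X]setTI.
  exact: (measurable_cabs_comp mf measurableT (measurable_itv _)).
have mg : measurable_fun setT g.
  by apply: measurable_complexM => //; apply: measurable_real_complex; exact: measurable_indic.
have gM z : cabs (g z) <= M.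
  rewrite /g cabsM cabs_real indicE.
  by case: (boolP (z \in A)) => [/set_mem|_]; rewrite ?normr1 ?mulr1 ?normr0 ?mulr0.
have fg : {ae lebesgue_Cn n, forall z, f z = g z}.
  have /cLnorm_leP : (cLnorm (lebesgue_Cn n) +oo f <= M%:E)%E by rewrite fM.
  apply: filterS => z; rewrite lee_fin => zM.
  by rewrite /g indicE mem_set// mulr1.
have gLM : cLnorm (lebesgue_Cn n) +oo%E g = M%:E by rewrite -fM; exact/esym/eq_cLnorm.
have heatE t : heat_transform t f = heat_transform t g by exact: eq_heat_transform.
rewrite fM; split; [|split].
- apply: filterS2 fg (ae_cvg_heat_transform mg gM) => w -> gw.
  by under eq_fun do rewrite heatE.
- by under eq_fun do rewrite heatE; exact: cvg_cLnorm_heat_transform.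
have opE t : H2_opnorm t (toeplitz t f) = H2_opnorm t (toeplitz t g).
  rewrite /H2_opnorm; congr ereal_sup; apply: eq_imagel => h [Hh _].
  by have /H2P[mh _ _] := Hh; rewrite (eq_toeplitz t mf mg mh fg).
by under eq_fun do rewrite opE; exact: cvg_H2_opnorm_toeplitz.
Qed.
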